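(* Let $N,d\ge 1$ and $m,n\ge 0$ be integers, let $t>0$ be real, and put $z=e^{-t/2}$. The microchiral partition function $Z_N^d$ of two-dimensional Yang--Mills theory with gauge group $\mathrm{U}_N$ on a compact orientable surface of area $t$ with $m$ holes and $n$ handles, which is a function of $(U_1,\dots,U_m)\in \mathrm{U}_N^m$, is given by $$Z_N^d=\left(zN^{2-2n-m}\right)^d\sum_{\alpha^1,\dots,\alpha^m\in \mathsf{Y}^d}P_{\alpha^1\dots\alpha^m}\sum_{\lambda\in \mathsf{Y}^d_N}\left(\frac{\dim \mathbf{V}^\lambda}{d!}\right)^{2-2n}\hat K_{\alpha^1\dots\alpha^m}(\lambda)\,\hat\Psi_{\frac tN}(\lambda)\,\hat\Omega_{\frac1N}(\lambda)^{2-2n-m}.$$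
   Context: $\mathsf{Y}^d$ is the set of Young diagrams with exactly $d$ cells and $\mathsf{Y}^d_N$ is the subset of those with at most $N$ rows. For $\lambda\in\mathsf{Y}^d_N$ (viewed as $\lambda_1\ge\dots\ge\lambda_N\ge0$), $\mathbf{W}_N^\lambda$ is the irreducible representation of the unitary group $\mathrm{U}_N$ with highest weight $\lambda$, $s_\lambda$ is its character, and $\hat C(\lambda)=\sum_{i=1}^N\lambda_i(\lambda_i+N+1-2i)$ is the eigenvalue of the quadratic Casimir in $\mathbf{W}_N^\lambda$. The microchiral partition function is by definition $$Z_N^d(U_1,\dots,U_m)=\sum_{\lambda\in\mathsf{Y}_N^d}\frac{s_\lambda(U_1)\cdots s_\lambda(U_m)}{(\dim\mathbf{W}_N^\lambda)^{m+2n-2}}\,e^{-\frac{t}{2N}\hat C(\lambda)}.$$ $\mathbf{V}^\lambda$ ($\lambda\in\mathsf{Y}^d$) is the irreducible representation of the symmetric group $\mathrm{S}^d$ indexed by $\lambda$. For $\alpha\in\mathsf{Y}^d$, $K_\alpha$ is the conjugacy class of permutations of cycle type $\alpha$, $\hat K_\alpha(\lambda)$ is the scalar by which the class sum $\sum_{\pi\in K_\alpha}\pi\in\mathbb{C}\mathrm{S}^d$ acts in $\mathbf{V}^\lambda$, and $\hat K_{\alpha^1\dots\alpha^m}(\lambda)=\prod_{i=1}^m\hat K_{\alpha^i}(\lambda)$. $p_\alpha(U)=\prod_{i=1}^{\ell(\alpha)}\mathrm{Tr}\,U^{\alpha_i}$, where $\ell(\alpha)$ is the number of rows of $\alpha$,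 and $P_{\alpha^1\dots\alpha^m}(U_1,\dots,U_m)=\prod_{i=1}^m p_{\alpha^i}(U_i)$. When $m=0$ the outer sum has a single term, with all empty products equal to $1$. The content $c(\Box)$ of a cell is its column index minus its row index. The numbers $\hat\Psi_s(\lambda)=\prod_{\Box\in\lambda}e^{-s\,c(\Box)}$ and $\hat\Omega_q(\lambda)=\prod_{\Box\in\lambda}(1+q\,c(\Box))$ are the eigenvalues, in $\mathbf{V}^\lambda$, of the exponential adjacency operator $\Psi_s=e^{-sK}$ and the exponential distance operator $\Omega_q=\sum_{\pi\in\mathrm{S}^d}q^{|\pi|}\pi$ of the Cayley graph of $\mathrm{S}^d$ generated by all transpositions, where $K$ is the sum of all transpositions and $|\pi|$ is the minimal number of transpositions in a factorization of $\pi$. *)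

(* Defs.v *)
From HB Require Import structures.
From mathcomp Require Import all_boot all_order all_algebra all_fingroup all_character.
From mathcomp Require Import complex spectral.
From mathcomp Require Import all_classical all_reals all_analysis.

Set Implicit Arguments.
Unset Strict Implicit.
Unset Printing Implicit Defensive.

Import Order.TTheory GRing.Theory Num.Theory numFieldNormedType.Exports.
Local Open Scope ring_scope.

(** * Young diagrams *)

(* A Young diagram with [d] cells is the weakly decreasing sequence of its row
   lengths, padded with zeros to length [d]. *)
Definition is_young (d : nat) (s : d.-tuple 'I_d.+1) : bool :=
  sorted geq (map val s) && (sumn (map val s) == d).

Record young (d : nat) : Type := Young {
  young_tuple : d.-tuple 'I_d.+1;
  _ : is_young young_tuple }.

HB.instance Definition _ (d : nat) := [isSub for @young_tuple d].
HB.instance Definition _ (d : nat) := [Finite of young d by <:].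

Section YoungDiagrams.
Variables (d : nat) (la : young d).

Definition rows : seq nat := map val (young_tuple la).

Definition row_len (i : nat) : nat := nth 0%N rows i.

Definition nrows : nat := count (fun r : nat => r != 0%N) rows.

(* Product of [F] over the contents (column index minus row index) of the
   cells of the diagram. *)
Definition content_prod (A : comNzRingType) (F : int -> A) : A :=
  \prod_(i < d) \prod_(j < row_len i) F (j%:Z - i%:Z).

End YoungDiagrams.

(** * Irreducible representations of the symmetric group *)

Section Symmetric.
Variables (C : fieldType) (d : nat).
Implicit Types la al : young d.

(* The boxes of a diagram are numbered by ['I_d] in reading order (left to
   right, top row first): box [k] lies in row [reshape_index (rows la) k] and
   column [reshape_offset (rows la) k]. *)
Definition row_group la : {set 'S_d} :=
  [set s : 'S_d | [forall k : 'I_d,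
     reshape_index (rows la) (s k) == reshape_index (rows la) k]].

Definition col_group la : {set 'S_d} :=
  [set s : 'S_d | [forall k : 'I_d,
     reshape_offset (rows la) (s k) == reshape_offset (rows la) k]].

(* The Young symmetrizer, as an operator of the regular representation. *)
Definition young_symmetrizer la : 'M[C]_#|[set: 'S_d]%G| :=
  \sum_(s in row_group la) \sum_(u in col_group la)
     (-1) ^+ odd_perm u *: regular_repr C [set: 'S_d]%G (s * u)%g.

(* [V^la] is the Specht module: the ideal of the group algebra generated by
   the Young symmetrizer. *)
Definition specht_mx la : 'M[C]_#|[set: 'S_d]%G| :=
  cyclic_mx (regular_repr C [set: 'S_d]%G) (gring_row (young_symmetrizer la)).

Definition dimV la : nat := \rank (specht_mx la).

Definition specht_repr la : mx_representation C [set: 'S_d]%G (dimV la) :=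
  submod_repr (cyclic_mx_module (regular_repr C [set: 'S_d]%G)
                                (gring_row (young_symmetrizer la))).

Definition conj_class al : {set 'S_d} :=
  [set s : 'S_d | perm_eq [seq #|X| | X : {set 'I_d} <- enum (porbits s)]
                          [seq r <- rows al | r != 0%N]].

(* The scalar by which the sum of the class [conj_class al] acts in [V^la]. *)
Definition hatK1 al la : C :=
  xget 0 [set c : C |
    \sum_(s in conj_class al) specht_repr la s = c%:M]%classic.

Definition hatK (m : nat) (al : {ffun 'I_m -> young d}) la : C :=
  \prod_(i < m) hatK1 (al i) la.

End Symmetric.

(** * Representations of the unitary group *)

(* A finite-dimensional continuous complex representation of [U_N].  Only the
   values of [uact] on unitary matrices are relevant. *)
Record unitary_rep (C : numClosedFieldType) (N : nat) : Type := UnitaryRep {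
  dimW : nat;
  uact : 'M[C]_N -> 'M[C]_dimW;
  uact1 : uact 1%:M = 1%:M;
  uactM : forall g h : 'M[C]_N, g \is unitarymx -> h \is unitarymx ->
    uact (g *m h) = uact g *m uact h;
  uact_continuous :
    {within [set g : 'M[C]_N | g \is unitarymx], continuous uact}%classic }.

Section Unitary.
Variables (C : numClosedFieldType) (N : nat).
Implicit Types W : unitary_rep C N.

Definition uirreducible W : Prop :=
  (0 < dimW W)%N /\
  forall S : {vspace 'cV[C]_(dimW W)},
    (forall g v, g \is unitarymx -> v \in S -> uact W g *m v \in S) ->
    S = 0%VS \/ S = fullv.

(* Weights with respect to the maximal torus of diagonal unitary matrices. *)
Definition is_weight W (mu : 'I_N -> int) : Prop :=
  exists2 v : 'cV[C]_(dimW W), v != 0 &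
    forall x : 'rV[C]_N, (forall i, `|x 0 i| = 1) ->
      uact W (diag_mx x) *m v = (\prod_(i < N) x 0 i ^ mu i) *: v.

(* [mu] is lower than [la]: their difference is a nonnegative integral
   combination of the positive roots [e_i - e_j], [i < j]. *)
Definition weight_le (mu la : 'I_N -> int) : Prop :=
  exists c : 'I_N -> 'I_N -> nat, forall k : 'I_N,
    la k - mu k = \sum_(i < N) \sum_(j < N | (i < j)%N)
                    (c i j)%:Z * ((k == i)%:Z - (k == j)%:Z).

Definition has_highest_weight W (la : 'I_N -> int) : Prop :=
  is_weight W la /\ forall mu, is_weight W mu -> weight_le mu la.

Definition uchar W (g : 'M[C]_N) : C := \tr (uact W g).

End Unitary.

(* [W] is (a model of) [W_N^la]; it is determined up to isomorphism. *)
Definition is_Wrep (C : numClosedFieldType) (N d : nat)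
    (W : unitary_rep C N) (la : young d) : Prop :=
  uirreducible W /\ has_highest_weight W (fun i => (row_len la i)%:Z).

(** * The two sides of the identity *)

Section YangMills.
Variables (R : realType) (N d : nat).
Implicit Types la : young d.

(* The index [i] ranges over [0, .., N-1], hence the shift [i.+1]. *)
Definition casimir la : int :=
  \sum_(i < N) (row_len la i)%:Z *
     ((row_len la i)%:Z + N%:Z + 1 - 2 * (i.+1)%:Z).

Definition microchiral (m n : nat) (t : R)
    (W : young d -> unitary_rep R[i] N) (U : 'I_m -> 'M[R[i]]_N) : R[i] :=
  \sum_(la : young d | (nrows la <= N)%N)
     (\prod_(i < m) uchar (W la) (U i)) /
       (dimW (W la))%:R ^ (m%:Z + 2 * n%:Z - 2)
     * (expR (- (t / (2 * N%:R)) * (casimir la)%:~R))%:C%C.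

Definition power_sum (al : young d) (U : 'M[R[i]]_N) : R[i] :=
  \prod_(i < nrows al) \tr (U ^+ row_len al i).

Definition power_sums (m : nat) (al : {ffun 'I_m -> young d})
    (U : 'I_m -> 'M[R[i]]_N) : R[i] :=
  \prod_(i < m) power_sum (al i) (U i).

(* [hatPsi s] and [hatOmega q] are the eigenvalues in [V^la] of [exp (- s K)],
   [K] the sum of all transpositions, and of [\sum_pi q ^ |pi| pi], written as
   products over contents. *)
Definition hatPsi (s : R) la : R :=
  content_prod la (fun c => expR (- s * c%:~R)).

Definition hatOmega (q : R) la : R :=
  content_prod la (fun c => 1 + q * c%:~R).

End YangMills.

(* Main.v *)
(** Both identities behind the theorem are instances of Schur-Weyl duality on
    T = (C^N)^{(x) d}.  Let e = r c be the Young symmetrizer of la, so that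
    e e = k e with k dim V = d!, and a central element acts on e by a scalar.
    The trace of U^{(x) d} e on T is the sum over al of p_al(U) K_al(la), and
    at U = 1 it is the product of the N + c(box), by removing boxes one at a
    time.  It remains to show that the character of W_la is 1/k times this
    trace.

    Restricted to the torus, a continuous W splits into characters x^mu, so its
    character is a symmetric polynomial whose exponents are dominated by la; by
    triangularity it is a combination of the traces tr(U^{(x) d} e_mu).  The
    tensor powers of unitary matrices span the commutant of the symmetric group
    on T, and by Burnside's theorem the image of U_N spans End W.  Hence the
    class sums, which lie in the commutant, act on W by scalars; this leaves
    only mu = la.  Finally the projection on the weight space of la, composed
    with e, has rank one on T, and this forces the multiplicity of la in W to
    be one, which fixes the constant 1/k. *)
Require Import Defs.
From HB Require Import structures.
From mathcomp Require Import all_boot all_order all_algebra all_fingroup all_character.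
From mathcomp Require Import complex spectral.
From mathcomp Require Import all_classical all_reals all_analysis.
From mathcomp Require Import ring lra zify separable cyclotomic.

Set Implicit Arguments.
Unset Strict Implicit.
Unset Printing Implicit Defensive.

Import Order.TTheory GRing.Theory Num.Theory numFieldNormedType.Exports.
Local Open Scope ring_scope.

(** * Row and column permutations of a diagram *)

(** All that is known of [W] is a multiplicative map on unitary matrices, its continuity and its
    weights. Linear independence of monomials on the torus plays the role of orthogonality of
    characters: every comparison of characters becomes a comparison of coefficients. Continuity
    serves only to make the torus act diagonally with integral exponents.

    The obstacle is to carry information from the tensor power to [W] without an embedding of one in
    the other. The link is the correspondence between [tens d g] and [uact W g], extended linearly
    on both sides; a trace identity and the nondegeneracy of the trace on [End W] show that it is a
    function.

    The exponents of the theorem come from two facts. With [a = dim V / d!], each character carries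
    one factor [a], and the dimension is [a N^d] times [hatOmega] at [1 / N]. The exponential factor
    splits because the Casimir eigenvalue is [N d] plus twice the sum of the contents. *)

Section AbstractDiagram.
Variables (d : nat) (rw cl : 'I_d -> nat).

Hypothesis box_inj : forall i j, rw i = rw j -> cl i = cl j -> i = j.
Hypothesis box_down : forall k r c, (r <= rw k)%N -> (c <= cl k)%N ->
  exists2 x, rw x = r & cl x = c.

(** On a column of height [h] an injective [f] has at most [min h k] values below [k], and [rw]
    attains this bound: by [box_down] its values there are 0, ..., [h - 1]. *)
Lemma column_count_le (f : 'I_d -> nat) (c k : nat) :
    (forall i j, cl i = cl j -> f i = f j -> i = j) ->
  (#|[set b | (cl b == c) && (f b < k)%N]| <=
   #|[set b | (cl b == c) && (rw b < k)%N]|)%N.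
Proof.
move=> finj.
have [allk|] := boolP [forall b, (cl b == c) ==> (rw b < k)%N].
  apply/subset_leq_card/fintype.subsetP => b; rewrite !inE => /andP[cb _].
  by rewrite cb /=; move/forallP: allk => /(_ b); rewrite cb.
rewrite negb_forall => /existsP[b0]; rewrite negb_imply -leqNgt => /andP[/eqP cb0 kb0].
have le_l : (#|[set b | (cl b == c) && (f b < k)%N]| <= k)%N.
  have injf : {in [set b | (cl b == c) && (f b < k)%N] &, injective (fun b => inord (f b) : 'I_k.+1)}.
    move=> i j; rewrite !inE => /andP[/eqP ci fi] /andP[/eqP cj fj] /(congr1 val) /=.
    rewrite !inordK ?ltnS 1?ltnW // => /finj; apply; by rewrite ci cj.
  rewrite -(card_in_imset injf).
  have sub : [set (inord (f b) : 'I_k.+1) | b in [set b | (cl b == c) && (f b < k)%N]] \subset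
     ~: [set ord_max].
    apply/fintype.subsetP => x /imsetP[b]; rewrite !inE => /andP[_ fb] ->.
    by rewrite -val_eqE /= inordK ?ltnS 1?ltnW // neq_ltn fb.
  by apply: leq_trans (subset_leq_card sub) _; rewrite cardsC1 card_ord.
apply: leq_trans le_l _.
have ex (r : 'I_k) : exists x, (rw x == r) && (cl x == c).
  have [||x rx cx] := @box_down b0 r (cl b0) => //.
    by apply: leq_trans (ltnW (ltn_ord r)) kb0.
  by exists x; rewrite rx cx cb0 !eqxx.
pose g (r : 'I_k) := xchoose (ex r).
have gP r : (rw (g r) = r) /\ (cl (g r) = c).
  by have /andP[/eqP ? /eqP] := xchooseP (ex r).
have ginj : injective g.
  by move=> r s e; apply: val_inj; rewrite /= -(gP r).1 -(gP s).1 e.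
rewrite -[leqLHS](card_ord k) -(card_imset _ ginj); apply/subset_leq_card.
apply/fintype.subsetP => x /imsetP[r _ ->]; rewrite inE.
by have [-> ->] := gP r; rewrite eqxx ltn_ord.
Qed.

Lemma card_by_column (P : pred 'I_d) :
  #|[set b | P b]| =
  (\sum_(c < (\max_(b : 'I_d) cl b).+1) #|[set b | (cl b == c) && P b]|)%N.
Proof.
rewrite -sum1_card.
rewrite (partition_big (fun b => inord (cl b) : 'I_(\max_(b : 'I_d) cl b).+1) xpredT) //=.
apply: eq_bigr => c _; rewrite -sum1_card; apply: eq_bigl => b.
rewrite !inE -val_eqE /= inordK 1?andbC // ltnS; exact: leq_bigmax.
Qed.

Lemma column_injective_dominated (f : 'I_d -> nat) (k : nat) :
    (forall i j, cl i = cl j -> f i = f j -> i = j) ->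
  (#|[set b | (f b < k)%N]| <= #|[set b | (rw b < k)%N]|)%N.
Proof.
move=> finj; rewrite (card_by_column (fun b => (f b < k)%N)).
rewrite (card_by_column (fun b => (rw b < k)%N)).
by apply: leq_sum => c _; exact: column_count_le.
Qed.

Definition row_stab : {set 'S_d} := [set s : 'S_d | [forall k, rw (s k) == rw k]].
Definition col_stab : {set 'S_d} := [set s : 'S_d | [forall k, cl (s k) == cl k]].

Lemma row_stabP (s : 'S_d) : reflect (forall k, rw (s k) = rw k) (s \in row_stab).
Proof. by rewrite inE; apply: (iffP forallP) => H k; apply/eqP. Qed.

Lemma col_stabP (s : 'S_d) : reflect (forall k, cl (s k) = cl k) (s \in col_stab).
Proof. by rewrite inE; apply: (iffP forallP) => H k; apply/eqP. Qed.

Lemma row_stab_group : group_set row_stab.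
Proof.
apply/group_setP; split; first by apply/row_stabP => k; rewrite perm1.
by move=> s t /row_stabP hs /row_stabP ht; apply/row_stabP => k; rewrite permM ht hs.
Qed.

Lemma col_stab_group : group_set col_stab.
Proof.
apply/group_setP; split; first by apply/col_stabP => k; rewrite perm1.
by move=> s t /col_stabP hs /col_stabP ht; apply/col_stabP => k; rewrite permM ht hs.
Qed.

Definition rstab := Group row_stab_group.
Definition cstab := Group col_stab_group.

Lemma row_col_stab1 (s : 'S_d) : s \in row_stab -> s \in col_stab -> s = 1%g.
Proof.
move=> /row_stabP hr /col_stabP hc; apply/permP => k.
by rewrite perm1; exact: box_inj.
Qed.

(* The equality case of [column_injective_dominated]: on every column [f] takes
   exactly the values of [rw]. *)
Lemma column_injective_same_content (f : 'I_d -> nat) :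
    (forall i j, cl i = cl j -> f i = f j -> i = j) ->
    (forall k, #|[set b | (f b < k)%N]| = #|[set b | (rw b < k)%N]|) ->
  exists2 u, u \in col_stab & forall b, f b = rw (u b).
Proof.
move=> finj feq.
have eqc c k : #|[set b | (cl b == c) && (f b < k)%N]| =
    #|[set b | (cl b == c) && (rw b < k)%N]|.
  have [cM|Mc] := ltnP c (\max_(b : 'I_d) cl b).+1; last first.
    have h P : #|[set b | (cl b == c) && P b]| = 0%N.
      apply/eqP; rewrite cards_eq0; apply/eqP/setP => b; rewrite !inE.
      suff /negPf -> : cl b != c by [].
      by rewrite neq_ltn (leq_trans _ Mc) // ltnS leq_bigmax.
    by rewrite !h.
  move: (feq k); rewrite (card_by_column (fun b => (f b < k)%N)).
  rewrite (card_by_column (fun b => (rw b < k)%N)) => /eqP E.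
  have /leqif_sum L : forall i : 'I_(\max_(b : 'I_d) cl b).+1, xpredT i ->
     (#|[set b | (cl b == i) && (f b < k)%N]| <=
      #|[set b | (cl b == i) && (rw b < k)%N]| ?= iff
      (#|[set b | (cl b == i) && (f b < k)%N]| ==
      #|[set b | (cl b == i) && (rw b < k)%N]|))%N.
    by move=> i _; split => //; exact: column_count_le.
  move: E; rewrite L => /forallP /(_ (Ordinal cM)) /=; by move/eqP.
(* On the column of [b] the count below [f b + 1] exceeds the count below [f b], since [b] itself is
   added; by [eqc] the same holds for [rw], so some box of the column lies in row [f b]. *)
have ex b : exists x, (rw x == f b) && (cl x == cl b).
  have : (#|[set x | (cl x == cl b) && (rw x < f b)%N]| <
          #|[set x | (cl x == cl b) && (rw x < (f b).+1)%N]|)%N.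
    rewrite -!eqc; apply: proper_card; apply/properP; split.
      by apply/fintype.subsetP => x; rewrite !inE => /andP[-> /ltnW].
    by exists b; rewrite !inE eqxx ?ltnSn ?ltnn.
  rewrite ltnNge => /negP N; apply: contra_notP N => /forallNP N.
  apply/subset_leq_card/fintype.subsetP => x; rewrite !inE ltnS leq_eqVlt.
  case/andP => cx /orP[rx|->]; last by rewrite cx.
  by case: (N x); rewrite rx cx.
pose g b := xchoose (ex b).
have gP b : rw (g b) = f b /\ cl (g b) = cl b.
  by have /andP[/eqP ? /eqP] := xchooseP (ex b).
have ginj : injective g.
  move=> i j e; apply: finj; first by rewrite -(gP i).2 -(gP j).2 e.
  by rewrite -(gP i).1 -(gP j).1 e.
exists (perm ginj); first by apply/col_stabP => k; rewrite permE (gP k).2.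
by move=> b; rewrite permE (gP b).1.
Qed.

(** By hypothesis the filling [rw (x^-1 b)] is injective on columns, and it has the same content as
    [rw]. A column permutation [v] therefore turns it back into [rw], which means that [x * v]
    preserves rows. *)
Lemma perm_row_col_split (x : 'S_d) :
    (forall i j, i != j -> rw i = rw j -> cl (x i) <> cl (x j)) ->
  exists s u, [/\ s \in row_stab, u \in col_stab & x = (s * u)%g].
Proof.
move=> hx.
have [||v vC hv] := @column_injective_same_content (fun b => rw (x^-1%g b)).
- move=> a b cab rab; case: (eqVneq (x^-1%g a) (x^-1%g b)) => [/perm_inj //|ne].
  by case: (hx _ _ ne rab); rewrite !permKV.
- move=> k; rewrite -[RHS](card_imset _ (@perm_inj _ x)); congr #|pred_of_set _|.
  apply/setP => y; rewrite inE; apply/idP/imsetP => [hy|[b]].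
    by exists (x^-1%g y); rewrite ?inE ?permKV.
  by rewrite inE => hb ->; rewrite permK.
exists (x * v)%g, v^-1%g; split; last by rewrite mulgK.
- by apply/row_stabP => b; rewrite permM -hv permK.
- by rewrite (groupV cstab).
Qed.

End AbstractDiagram.

(** * Young symmetrizers *)

(** In a full rank factorization [E = X Y] the relation becomes [Y X = k], and the trace of [X Y] is
    that of [Y X]. The case [k = 0] is included, so the formula can serve to exclude it. *)
Lemma mulmx_idem_trace (F : fieldType) n (E : 'M[F]_n) (k : F) :
  E *m E = k *: E -> \tr E = k * (\rank E)%:R.
Proof.
move=> EE; have eE := mulmx_base E.
have [A cA] : exists A, A *m col_base E = 1%:M.
  by apply/row_fullP; rewrite col_base_full.
have [B rB] : exists B, row_base E *m B = 1%:M by apply/row_freeP/row_base_free.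
move: (\rank E) (col_base E) (row_base E) eE A cA B rB => r X Y eE A cA B rB.
have YX : Y *m X = k%:M.
  have e : A *m (E *m E) *m B = k *: (A *m E *m B).
    by rewrite EE -scalemxAr -scalemxAl.
  have {}e : A *m (X *m Y *m (X *m Y)) *m B = k *: (A *m (X *m Y) *m B) by rewrite eE.
  rewrite !mulmxA cA !mul1mx rB -[_ *m Y *m B]mulmxA rB mulmx1 in e.
  by rewrite e scalemx1.
by rewrite -eE mxtrace_mulC YX mxtrace_scalar mulr_natr.
Qed.

(** Both copies of [e] move to the right and merge into [k e]. The factors [w] and [X] need not
    commute; later [w] is a weight projection and [e] a Young symmetrizer. *)
Lemma commuting_sandwich (F : fieldType) n (w X X' e : 'M[F]_n) (k : F) :
    e *m e = k *: e -> w *m e = e *m w -> X *m e = e *m X -> X' *m e = e *m X' ->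
  (w *m e) *m X *m (w *m e) *m X' = k *: (w *m X *m w *m X' *m e).
Proof.
move=> ee we Xe X'e; rewrite -(mulmxA w e X) -Xe -(mulmxA (w *m (X *m e))) -(mulmxA w e X') -X'e.
rewrite !mulmxA -(mulmxA (w *m X) e w) -we !mulmxA -(mulmxA _ e X') -X'e !mulmxA.
by rewrite -(mulmxA _ e e) ee -scalemxAr.
Qed.

Lemma rank1_sandwich (F : fieldType) n (a : 'cV[F]_n) (b : 'rV[F]_n) (X : 'M[F]_n) :
  (a *m b) *m X *m (a *m b) = (b *m X *m a) 0 0 *: (a *m b).
Proof.
rewrite !mulmxA -(mulmxA a b) -(mulmxA a (b *m X)).
by move: (b *m X *m a) => s; rewrite {1}[s]mx11_scalar mul_mx_scalar -scalemxAl.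
Qed.

Section Symmetrizer.
Variables (C : numFieldType) (d : nat) (rw cl : 'I_d -> nat).
Hypothesis box_inj : forall i j, rw i = rw j -> cl i = cl j -> i = j.
Hypothesis box_down : forall k r c, (r <= rw k)%N -> (c <= cl k)%N ->
  exists2 x, rw x = r & cl x = c.

Let RS := row_stab rw.
Let CS := col_stab cl.

(** The coefficient of [x] in the Young symmetrizer. At most one pair contributes, because the row
    and column groups meet trivially; the sum avoids choosing a factorization of [x]. *)
Definition sym_coef (x : 'S_d) : C :=
  \sum_(s in RS) \sum_(u in CS) ((s * u)%g == x)%:R * (-1) ^+ odd_perm u.

Lemma sym_coef_mul s u : s \in RS -> u \in CS -> sym_coef (s * u)%g = (-1) ^+ odd_perm u.
Proof.
move=> sR uC; rewrite /sym_coef (bigD1 s) //= (bigD1 u) //= eqxx mul1r.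
rewrite big1 ?addr0 => [|v /andP[vC vu]]; last first.
  by rewrite (inj_eq (mulgI s)) (negPf vu) mul0r.
rewrite big1 ?addr0 // => t /andP[tR ts]; rewrite big1 // => v vC.
case: eqP => [e|]; last by rewrite mul0r.
have : (s^-1 * t)%g = (u * v^-1)%g.
  by apply: (mulgI s); rewrite mulKVg mulgA -e mulgK.
move=> e1; have : (s^-1 * t)%g = 1%g.
  apply: (row_col_stab1 box_inj).
    by apply: (@groupM _ (rstab rw)) => //; rewrite (groupV (rstab rw)).
  by rewrite e1; apply: (@groupM _ (cstab cl)) => //; rewrite (groupV (cstab cl)).
by move=> e2; case/eqP: ts; rewrite -[t](mulKVg s) e2 mulg1.
Qed.

Lemma sym_coef1 : sym_coef 1%g = 1.
Proof.
have := sym_coef_mul (group1 (rstab rw)) (group1 (cstab cl)).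
by rewrite mulg1 odd_perm1.
Qed.

Section Rep.
Variables (n : nat) (rG : mx_representation C [set: 'S_d]%G n).

Definition row_sum : 'M[C]_n := \sum_(s in RS) rG s.
Definition col_sum : 'M[C]_n := \sum_(u in CS) (-1) ^+ odd_perm u *: rG u.
Definition symmetrizer : 'M[C]_n := row_sum *m col_sum.

Let rM (s t : 'S_d) : rG s *m rG t = rG (s * t)%g.
Proof. by rewrite repr_mxM ?inE. Qed.

Lemma row_sum_mulr s : s \in RS -> row_sum *m rG s = row_sum.
Proof.
move=> sR; rewrite /row_sum mulmx_suml [RHS](reindex_inj (mulIg s)) /=.
apply: eq_big => [t|t _]; last by rewrite rM.
by rewrite (groupMr (G := rstab rw)).
Qed.

Lemma col_sum_mull u : u \in CS -> rG u *m col_sum = (-1) ^+ odd_perm u *: col_sum.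
Proof.
move=> uC; rewrite /col_sum mulmx_sumr [in RHS](reindex_inj (mulgI u)) /= scaler_sumr.
apply: eq_big => [t|t _]; first by rewrite (groupMl (G := cstab cl)).
by rewrite -scalemxAr rM odd_permM signr_addb scalerA mulrA -signr_addb addbb mul1r.
Qed.

Lemma symmetrizerE : symmetrizer = \sum_(x : 'S_d) sym_coef x *: rG x.
Proof.
rewrite /symmetrizer /row_sum mulmx_suml.
under [RHS]eq_bigr do rewrite scaler_suml.
rewrite exchange_big /=; apply: eq_bigr => s sR.
rewrite /col_sum mulmx_sumr; under [RHS]eq_bigr do rewrite scaler_suml.
rewrite exchange_big /=; apply: eq_bigr => u uC.
rewrite (bigD1 (s * u)%g) //= eqxx mul1r big1 ?addr0 => [|x]; first by rewrite -scalemxAr rM.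
by rewrite eq_sym => /negPf ->; rewrite mul0r scale0r.
Qed.

(* Von Neumann's lemma: either [x] splits as a row times a column permutation,
   or some transposition of two boxes of a row is carried by [x] to a
   transposition of two boxes of a column, and the product vanishes. *)
Lemma row_mul_col x : row_sum *m rG x *m col_sum = sym_coef x *: symmetrizer.
Proof.
have [/existsP[i /existsP[j /and3P[ij /eqP rij /eqP cij]]]|H] :=
  boolP [exists i, exists j, [&& i != j, rw i == rw j & cl (x i) == cl (x j)]].
  have tR : tperm i j \in RS.
    by apply/row_stabP => k; case: tpermP => [->|->|//].
  have tC : tperm (x i) (x j) \in CS.
    by apply/col_stabP => k; case: tpermP => [->|->|//].
  have tx : (tperm i j * x)%g = (x * tperm (x i) (x j))%g.
    by rewrite -tpermJ conjgE !mulgA mulgV mul1g.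
  have -> : sym_coef x = 0.
    rewrite /sym_coef big1 // => s sR; rewrite big1 // => u uC.
    case: eqP => [e|]; last by rewrite mul0r.
    move: cij; rewrite -e !permM; move/col_stabP: uC => uC; rewrite !uC => cs.
    have /perm_inj e2 : s i = s j.
      by apply: box_inj => //; move/row_stabP: sR => sR; rewrite !sR.
    by rewrite e2 eqxx in ij.
  have : row_sum *m rG x *m col_sum = - (row_sum *m rG x *m col_sum).
    rewrite -{1}(row_sum_mulr tR) -(mulmxA row_sum) rM tx -rM mulmxA -mulmxA.
    by rewrite col_sum_mull // odd_tperm (inj_eq perm_inj) ij expr1 scaleN1r mulmxN.
  move/eqP; rewrite -addr_eq0 -mulr2n -scaler_nat scaler_eq0 pnatr_eq0 /=.
  by move/eqP ->; rewrite scale0r.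
have [|s [u [sR uC ->]]] := perm_row_col_split box_down (x := x).
  move=> i j ij rij cij; case/existsP: H; exists i; apply/existsP; exists j.
  by rewrite ij rij cij !eqxx.
rewrite -rM mulmxA row_sum_mulr // -mulmxA col_sum_mull // -scalemxAr.
by rewrite sym_coef_mul.
Qed.

(** In [e x e = R (C x R) C] the inner factor is a combination of permutations, and [row_mul_col]
    collapses each term. The scalar does not depend on the representation, which allows passing from
    the regular representation to the tensor power. *)
Lemma symmetrizer_sandwich x :
  symmetrizer *m rG x *m symmetrizer =
  (\sum_(u in CS) \sum_(s in RS) (-1) ^+ odd_perm u * sym_coef (u * x * s)%g) *: symmetrizer.
Proof.
have -> : symmetrizer *m rG x *m symmetrizer =
    row_sum *m (col_sum *m rG x *m row_sum) *m col_sum by rewrite /symmetrizer !mulmxA.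
have -> : col_sum *m rG x *m row_sum =
    \sum_(u in CS) \sum_(s in RS) (-1) ^+ odd_perm u *: rG (u * x * s)%g.
  rewrite /col_sum !mulmx_suml; apply: eq_bigr => u uC.
  rewrite /row_sum mulmx_sumr; apply: eq_bigr => s sR.
  by rewrite -!scalemxAl !rM.
move: row_mul_col; rewrite /symmetrizer; move: row_sum col_sum => A B AB.
rewrite mulmx_sumr mulmx_suml scaler_suml; apply: eq_bigr => u uC.
rewrite mulmx_sumr mulmx_suml scaler_suml; apply: eq_bigr => s sR.
by rewrite -scalemxAr -scalemxAl AB scalerA.
Qed.

End Rep.

(** This is [d!] divided by the dimension of the Specht module, by [sym_kappa_rank]. The idle factor
    [1] keeps the form of the scalar in [symmetrizer_sandwich]. *)
Definition sym_kappa : C :=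
  \sum_(u in CS) \sum_(s in RS) (-1) ^+ odd_perm u * sym_coef (u * 1 * s)%g.

Lemma symmetrizer_sqr n (rG : mx_representation C [set: 'S_d]%G n) :
  symmetrizer rG *m symmetrizer rG = sym_kappa *: symmetrizer rG.
Proof.
by have := symmetrizer_sandwich rG 1%g; rewrite repr_mx1 mulmx1.
Qed.

Local Notation reg := (regular_repr C [set: 'S_d]%G).

Lemma gring_row_regular (x g : 'S_d) :
  gring_row (reg x) 0 (gring_index [set: 'S_d]%G g) = (x == g)%:R.
Proof.
have := @gring_projE C _ [set: 'S_d]%G g x.
rewrite !inE => /(_ isT isT) /(congr1 (fun A : 'M[C]_1 => A 0 0)).
by rewrite /gring_proj /= !mxE /= => ->; rewrite eq_sym; case: (x == g); rewrite ?mulr1n ?mulr0n mxE.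
Qed.

(** Two computations of the trace of the map [g -> e g] on the group algebra. Its matrix [M]
    satisfies [M M = kappa M] and has the ideal generated by [e] as row space; each diagonal entry
    is the coefficient of the identity in [e], which is 1. *)
Lemma sym_kappa_rank :
  sym_kappa * (\rank (cyclic_mx reg (gring_row (symmetrizer reg))))%:R = (d`!)%:R.
Proof.
set E := symmetrizer reg.
pose M := enveloping_algebra_mx reg *m lin_mul_row (gring_row E).
have rowM i : row i M = gring_row (E *m reg (enum_val i)).
  rewrite row_mul mul_rV_lin1 /= rowK mxvecK; symmetry; exact: gring_row_mul.
have ringE i : (E *m reg (enum_val i) \in group_ring C [set: 'S_d]%G)%MS.
  apply: envelop_mxM; last by rewrite envelop_mx_id ?inE.
  rewrite /E symmetrizerE linear_sum summx_sub // => x _.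
  by rewrite linearZ scalemx_sub // envelop_mx_id ?inE.
have MM : M *m M = sym_kappa *: M.
  apply/row_matrixP => i; rewrite row_mul linearZ /= rowM.
  rewrite /M mulmxA mul_rV_lin1 /=.
  have -> : vec_mx (gring_row (E *m reg (enum_val i)) *m enveloping_algebra_mx reg)
     = E *m reg (enum_val i) by exact: gring_rowK.
  by rewrite -gring_row_mul mulmxA symmetrizer_sqr -scalemxAl linearZ.
have -> : \rank (cyclic_mx reg (gring_row E)) = \rank M by rewrite genmxE.
rewrite -(mulmx_idem_trace MM) /mxtrace.
under eq_bigr => i _.
  have -> : M i i = 1.
    rewrite (_ : M i i = row i M 0 i); last by rewrite [RHS]mxE.
    rewrite rowM /E symmetrizerE mulmx_suml linear_sum summxE.
    rewrite (bigD1 1%g) //= big1 ?addr0 => [|x x1].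
      rewrite sym_coef1 scale1r repr_mx1 mul1mx -{2}(gring_valK i).
      by rewrite gring_row_regular eqxx.
    rewrite -scalemxAl linearZ /= mxE -repr_mxM ?inE // -{2}(gring_valK i).
    rewrite gring_row_regular -{2}(mul1g (enum_val i)) (inj_eq (mulIg _)) (negPf x1).
    by rewrite mulr0.
  over.
by rewrite sumr_const card_ord cardsT card_Sn.
Qed.

Lemma sym_kappa_neq0 : sym_kappa != 0.
Proof.
apply/negP => /eqP k0; have := sym_kappa_rank; rewrite k0 mul0r => /eqP.
by rewrite eq_sym pnatr_eq0 eqn0Ngt fact_gt0.
Qed.

Lemma class_function_sum_comm (z : 'S_d -> C) n
    (rG : mx_representation C [set: 'S_d]%G n) (g : 'S_d) :
    (forall x y, z (y^-1 * x * y)%g = z x) ->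
  rG g *m (\sum_x z x *: rG x) = (\sum_x z x *: rG x) *m rG g.
Proof.
move=> zJ; rewrite mulmx_sumr mulmx_suml (reindex_inj (conjg_inj g)) /=.
apply: eq_bigr => x _; rewrite -scalemxAl -scalemxAr -!repr_mxM ?inE //.
by rewrite conjgE mulgA zJ; congr (_ *: rG _); rewrite !mulgA mulgV mul1g.
Qed.

(* A central element [z] acts on the ideal of [e] by a scalar, because
   [k e z = e e z = e z e] is a multiple of [e]. *)
Lemma symmetrizer_central (z : 'S_d -> C) :
    (forall x y, z (y^-1 * x * y)%g = z x) ->
  exists c, forall n (rG : mx_representation C [set: 'S_d]%G n),
    symmetrizer rG *m (\sum_x z x *: rG x) = c *: symmetrizer rG.
Proof.
(* The scalar is introduced before [rG], so the value found at the end is common to all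
   representations. *)
move=> zJ; eexists => n rG.
have cent g := class_function_sum_comm rG g zJ.
have centE : symmetrizer rG *m (\sum_x z x *: rG x) =
    (\sum_x z x *: rG x) *m symmetrizer rG.
  rewrite symmetrizerE mulmx_suml [RHS]mulmx_sumr; apply: eq_bigr => g _.
  by rewrite -scalemxAl cent scalemxAr.
apply: (scalerI sym_kappa_neq0).
rewrite scalemxAl -symmetrizer_sqr -mulmxA centE mulmxA mulmx_sumr mulmx_suml.
under eq_bigr => x _ do rewrite -scalemxAr -scalemxAl symmetrizer_sandwich scalerA.
rewrite -scaler_suml scalerA; congr (_ *: _).
by rewrite [RHS]mulrC; apply: (canRL (divfK sym_kappa_neq0)); reflexivity.
Qed.

End Symmetrizer.

(** * Young diagrams and Specht modules *)

Section YoungBoxes.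
Variables (d : nat) (la : young d).

Definition box_row (k : 'I_d) : nat := reshape_index (rows la) k.
Definition box_col (k : 'I_d) : nat := reshape_offset (rows la) k.

Lemma size_rows : size (rows la) = d.
Proof. by rewrite /rows size_map size_tuple. Qed.

Lemma sumn_rows : sumn (rows la) = d.
Proof. by have /andP[_ /eqP] := valP la. Qed.

Lemma row_len_anti i j : (i <= j)%N -> (row_len la j <= row_len la i)%N.
Proof.
move=> ij; have /andP[so _] := valP la.
have [jd|dj] := ltnP j d; last by rewrite /row_len [X in (X <= _)%N]nth_default ?size_rows.
have tr : transitive geq by move=> x y z /= yx xz; exact: leq_trans xz yx.
have rf : reflexive geq by move=> x /=; exact: leqnn.
have /(_ i j) := sorted_leq_nth tr rf 0%N so; apply => //; rewrite inE ?size_map ?size_tuple //.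
exact: leq_ltn_trans ij jd.
Qed.

Lemma row_len_default i : (d <= i)%N -> row_len la i = 0%N.
Proof. by move=> di; rewrite /row_len nth_default ?size_rows. Qed.

Lemma box_col_lt k : (box_col k < row_len la (box_row k))%N.
Proof. by apply: reshape_offsetP; rewrite sumn_rows. Qed.

Lemma box_rowcolK k : flatten_index (rows la) (box_row k) (box_col k) = k.
Proof. exact: reshape_indexK. Qed.

Lemma box_inj i j : box_row i = box_row j -> box_col i = box_col j -> i = j.
Proof. by move=> r c; apply: val_inj; rewrite /= -box_rowcolK r c box_rowcolK. Qed.

Lemma box_exists r c : (c < row_len la r)%N -> exists2 x, box_row x = r & box_col x = c.
Proof.
move=> cr; have ltd : (flatten_index (rows la) r c < d)%N.
  by have := flatten_indexP cr; rewrite sumn_rows.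
exists (Ordinal ltd); [exact: flatten_indexKl | exact: flatten_indexKr].
Qed.

Lemma box_down k r c : (r <= box_row k)%N -> (c <= box_col k)%N ->
  exists2 x, box_row x = r & box_col x = c.
Proof.
move=> rk ck; apply: box_exists.
by apply: leq_ltn_trans ck _; apply: leq_trans (box_col_lt k) (row_len_anti rk).
Qed.

(** Reading order extends the product order of the boxes, so each initial segment of the boxes is
    again a diagram; the content product is built along these segments. *)
Lemma box_order i j : (box_row i <= box_row j)%N -> (box_col i <= box_col j)%N -> (i <= j)%N.
Proof.
move=> r c; rewrite -(box_rowcolK i) -(box_rowcolK j) /flatten_index leq_add //.
by rewrite -(subnKC r) takeD sumn_cat leq_addr.
Qed.

Lemma box_row_enum i : exists2 h : 'I_(row_len la i) -> 'I_d,
  injective h /\ (forall c, box_row (h c) = i /\ box_col (h c) = c) &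
  [set b | box_row b == i] = [set h c | c in 'I_(row_len la i)].
Proof.
have ex (c : 'I_(row_len la i)) : exists x, (box_row x == i) && (box_col x == c).
  by have [x xi xc] := box_exists (ltn_ord c); exists x; rewrite xi xc !eqxx.
pose h c := xchoose (ex c).
have hP c : box_row (h c) = i /\ box_col (h c) = c.
  by have /andP[/eqP ? /eqP] := xchooseP (ex c).
exists h.
  by split=> // a b e; apply: val_inj; rewrite /= -(hP a).2 -(hP b).2 e.
apply/setP => b; rewrite inE; apply/eqP/imsetP => [bi|[c _ ->]]; last exact: (hP c).1.
have cl := box_col_lt b; rewrite bi in cl; exists (Ordinal cl) => //.
by apply: box_inj; rewrite ?(hP _).1 ?(hP _).2.
Qed.

Lemma card_box_row i : #|[set b | box_row b == i]| = row_len la i.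
Proof. by have [h [hi _] ->] := box_row_enum i; rewrite card_imset // card_ord. Qed.

Lemma box_row_lt k : (box_row k < d)%N.
Proof. by rewrite -[X in (_ < X)%N]size_rows; apply: reshape_indexP; rewrite sumn_rows. Qed.

Lemma ltn_nrows i : (i < nrows la)%N = (0 < row_len la i)%N.
Proof.
rewrite /nrows -{1}(cat_take_drop i (rows la)) count_cat.
have [id|di] := ltnP i (size (rows la)); last first.
  rewrite (drop_oversize di) addn0 row_len_default -?size_rows //.
  by apply/negbTE; rewrite -leqNgt (leq_trans (count_size _ _)) // (take_oversize di).
have [ri|ri] := posnP (row_len la i).
  have -> : count (fun r => r != 0%N) (drop i (rows la)) = 0%N.
    apply/eqP; rewrite -leqn0 leqNgt -has_count -all_predC.
    apply/(all_nthP 0%N) => j _; rewrite nth_drop /= negbK.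
    by have := row_len_anti (leq_addr j i); rewrite ri leqn0.
  apply/negbTE; rewrite -leqNgt addn0 (leq_trans (count_size _ _)) //.
  by rewrite size_takel // ltnW.
rewrite (drop_nth 0%N id) /= -/(row_len la i) -lt0n ri addnA addn1 ltnS.
apply: leq_trans (leq_addr _ _).
have /eqP -> : count (fun r => r != 0%N) (take i (rows la)) == size (take i (rows la)).
  rewrite -all_count; apply/(all_nthP 0%N) => j; rewrite size_takel ?(ltnW id) // => ji.
  by rewrite nth_take // -lt0n; apply: leq_trans ri (row_len_anti (ltnW ji)).
by rewrite size_takel // ltnW.
Qed.

Lemma nrows_le : (nrows la <= d)%N.
Proof. by apply: leq_trans (count_size _ _) _; rewrite size_rows. Qed.

Lemma box_row_lt_nrows k : (box_row k < nrows la)%N.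
Proof. by rewrite ltn_nrows (leq_ltn_trans _ (box_col_lt k)). Qed.

Lemma big_boxes (A : Type) (idx : A) (op : Monoid.com_law idx) (F : nat -> nat -> A) :
  \big[op/idx]_(k < d) F (box_row k) (box_col k) =
  \big[op/idx]_(i < d) \big[op/idx]_(j < row_len la i) F i j.
Proof.
rewrite (partition_big (fun k => Ordinal (box_row_lt k)) xpredT) //=.
apply: eq_bigr => i _.
have [h [hi hP] hE] := box_row_enum i.
rewrite (eq_bigl (fun k => k \in [set h c | c in 'I_(row_len la i)])) /=; last first.
  by move=> k; rewrite -hE inE -val_eqE.
rewrite big_imset /=; last by move=> a b _ _; exact: hi.
by apply: eq_bigr => c _; rewrite (hP c).1 (hP c).2.
Qed.

Lemma content_prodE (A : comNzRingType) (F : int -> A) :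
  content_prod la F = \prod_(k < d) F ((box_col k)%:Z - (box_row k)%:Z).
Proof. by rewrite (big_boxes _ (fun i j => F (j%:Z - i%:Z))). Qed.

End YoungBoxes.

(** * Conjugacy classes and cycle types *)

Section ConjClass.
Variable d : nat.
Implicit Types (s t : 'S_d) (al : young d).

Lemma porbits_conjg s t :
  porbits (s ^ t)%g = [set [set t x | x in X] | X : {set 'I_d} in porbits s].
Proof.
have pc x : porbit (s ^ t)%g (t x) = [set t y | y in porbit s x].
  apply/setP => y; apply/porbitP/imsetP => [[i ->]|[z /porbitP[i ->] ->]].
    exists ((s ^+ i)%g x); first by apply/porbitP; exists i.
    by rewrite -conjXg permJ.
  by exists i; rewrite -conjXg permJ.
apply/setP => Y; apply/imsetP/imsetP => [[y _ ->]|[X /imsetP[x _ ->] ->]].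
  exists (porbit s (t^-1%g y)); first exact: imset_f.
  by rewrite -pc permKV.
by exists (t x); rewrite ?inE ?pc.
Qed.

Lemma conj_classJ al s t : ((s ^ t)%g \in conj_class al) = (s \in conj_class al).
Proof.
have inj : injective (fun X : {set 'I_d} => [set t x | x in X]).
  exact/imset_inj/perm_inj.
rewrite !inE.
have E : perm_eq (enum (porbits (s ^ t)%g)) [seq [set t x | x in X] | X : {set 'I_d} <- enum (porbits s)].
  apply: uniq_perm; rewrite ?enum_uniq ?map_inj_uniq ?enum_uniq // => Y.
  rewrite mem_enum porbits_conjg; apply/imsetP/mapP => -[X hX ->]; exists X => //; first by rewrite mem_enum.
  by rewrite mem_enum in hX.
have {}E : perm_eq [seq #|X| | X : {set 'I_d} <- enum (porbits (s ^ t)%g)]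
    [seq #|X| | X : {set 'I_d} <- enum (porbits s)].
  apply: perm_trans (perm_map _ E) _; rewrite -map_comp.
  rewrite (eq_map (g := fun X : {set 'I_d} => #|X|)) // => X /=.
  by rewrite card_imset //; exact: perm_inj.
by rewrite (permPl E).
Qed.

Lemma conj_classV al s : (s^-1%g \in conj_class al) = (s \in conj_class al).
Proof. by rewrite !inE porbitsV. Qed.

Lemma young_eq al be : (forall i, row_len al i = row_len be i) -> al = be.
Proof.
move=> e; apply: val_inj; apply: val_inj; apply: (inj_map val_inj).
apply: (@eq_from_nth _ 0%N) => [|i _]; first by rewrite !size_map !size_tuple.
exact: e.
Qed.

Lemma conj_class_inj al be s : s \in conj_class al -> s \in conj_class be -> al = be.
Proof.
rewrite !inE => sa sb; apply: young_eq => i; congr (nth _ _ _).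
have tr : transitive geq by move=> x y z /= yx xz; exact: leq_trans xz yx.
have an : antisymmetric geq.
  by move=> x y /andP[xy yx]; apply/eqP; rewrite eqn_leq; apply/andP.
have /andP[soa _] := valP al; have /andP[sob _] := valP be.
apply: (sorted_eq tr an soa sob); rewrite -/(rows al) -/(rows be).
rewrite -(perm_filterC (fun r => r != 0%N)) perm_sym -(perm_filterC (fun r => r != 0%N)) perm_sym.
rewrite perm_cat //; first by rewrite perm_sym in sa; exact: perm_trans sa sb.
have z (ga : young d) : [seq r <- rows ga | predC (fun r => r != 0%N) r] =
      nseq (d - count (fun r => r != 0%N) (rows ga)) 0%N.
  have -> : (d - count (fun r => r != 0%N) (rows ga))%N =
      size [seq r <- rows ga | predC (fun r => r != 0%N) r].
    have e := count_predC (fun r => r != 0%N) (rows ga); rewrite size_rows in e.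
    by rewrite size_filter; apply: (canLR (addKn _)); exact: esym e.
  by apply/all_pred1P; apply/allP => r; rewrite mem_filter /= negbK => /andP[].
rewrite !z; suff -> : count (fun r => r != 0%N) (rows al) = count (fun r => r != 0%N) (rows be) by [].
by rewrite -!size_filter -(perm_size sa) (perm_size sb).
Qed.

Lemma sum_card_porbits s : (\sum_(X in porbits s) #|X| = d)%N.
Proof.
rewrite -[RHS]card_ord -sum1_card (partition_big (porbit s) (mem (porbits s))) /=.
  apply: eq_bigr => X /imsetP[p _ ->]; rewrite -sum1_card; apply: eq_bigl => k.
  by rewrite eq_porbit_mem.
by move=> k _; exact: imset_f.
Qed.

Lemma conj_class_exists s : exists al, s \in conj_class al.
Proof.
set ty := [seq #|X| | X : {set 'I_d} <- enum (porbits s)].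
have tyP : all (fun r => 0 < r <= d)%N ty.
  apply/allP => r /mapP[X]; rewrite mem_enum => /imsetP[p _ ->] ->.
  by rewrite lt0n card_porbit_neq0 -[X in (_ <= X)%N](card_ord d) max_card.
have sumty : sumn ty = d by rewrite sumnE big_map big_enum sum_card_porbits.
have szty : (size ty <= d)%N.
  rewrite -sumty; elim: (ty) tyP => //= r l IH /andP[/andP[r0 _] /IH]; lia.
pose ro := sort geq ty ++ nseq (d - size ty) 0%N.
have szro : size ro = d by rewrite size_cat size_sort size_nseq subnKC.
have roP : all (fun r => r < d.+1)%N ro.
  rewrite all_cat all_nseq orbT andbT all_sort; apply: sub_all tyP => r /andP[] //.
pose t : seq 'I_d.+1 := [seq inord r | r <- ro].
have valt : map val t = ro.
  rewrite -map_comp -[RHS]map_id; apply/eq_in_map => r /(allP roP) /= rd.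
  by rewrite inordK.
have szt : size t == d by rewrite size_map szro.
have Y : is_young (Tuple szt).
  rewrite /is_young /= valt; apply/andP; split.
    have tr : transitive geq by move=> x y z /= yx xz; exact: leq_trans xz yx.
    rewrite (sorted_pairwise tr) pairwise_cat.
    rewrite -(sorted_pairwise tr) sort_sorted => [|x y]; last exact: leq_total.
    rewrite -(sorted_pairwise tr); apply/andP; split.
      by apply/allrelP => x y _ /nseqP[-> _].
    by elim: (d - size ty)%N => //= -[|n].
  rewrite sumn_cat sumn_nseq mul0n addn0 (perm_sumn (s2 := ty)) ?sumty //.
  by rewrite perm_sort.
exists (Young Y); rewrite inE -/ty /rows /= valt /ro filter_cat.
have -> : [seq r <- nseq (d - size ty) 0%N | r != 0%N] = [::].
  by elim: (d - size ty)%N.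
rewrite cats0 (all_filterP _) ?perm_sort 1?perm_sym ?perm_sort //.
by rewrite all_sort; apply: sub_all tyP => r /andP[]; rewrite lt0n.
Qed.

End ConjClass.

(** * Class sums acting on Specht modules *)

Section SpechtScalars.
Variables (C : numFieldType) (d : nat) (la : young d).
Local Notation reg := (regular_repr C [set: 'S_d]%G).
Local Notation coef := (@sym_coef C d (box_row la) (box_col la)).
Local Notation kappa := (@sym_kappa C d (box_row la) (box_col la)).
Local Notation e := (@symmetrizer C d (box_row la) (box_col la) _).

Lemma young_symmetrizerE : young_symmetrizer C la = e reg.
Proof.
rewrite /young_symmetrizer /symmetrizer /row_sum mulmx_suml.
apply: eq_bigr => s _; rewrite /col_sum mulmx_sumr; apply: eq_bigr => u _.
by rewrite -scalemxAr -repr_mxM ?inE.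
Qed.

Lemma kappa_dimV : kappa * (dimV C la)%:R = (d`!)%:R.
Proof.
rewrite /dimV /specht_mx young_symmetrizerE.
exact: (sym_kappa_rank C (@box_inj d la) (@box_down d la)).
Qed.

Lemma kappa_neq0 : kappa != 0.
Proof. exact: (sym_kappa_neq0 C (@box_inj d la) (@box_down d la)). Qed.

Lemma dimV_gt0 : (0 < dimV C la)%N.
Proof.
rewrite lt0n; apply/eqP => f0; have := kappa_dimV; rewrite f0 mulr0 => /esym/eqP.
by rewrite pnatr_eq0 eqn0Ngt fact_gt0.
Qed.

Lemma gring_row_comb1 (a : 'S_d -> C) :
  gring_row (\sum_x a x *: reg x) 0 (gring_index [set: 'S_d]%G 1%g) = a 1%g.
Proof.
rewrite linear_sum summxE (bigD1 1%g) //= big1 ?addr0 => [|x x1].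
  by rewrite linearZ /= mxE gring_row_regular eqxx mulr1.
by rewrite linearZ /= mxE gring_row_regular (negPf x1) mulr0.
Qed.

(** Since [hatK1] is a choice among scalars, existence and uniqueness are both required: the scalar
    comes from [symmetrizer_central], and it is unique because [dimV la] is positive. The conclusion
    then holds in every representation, in particular on tensors. *)
Lemma hatK1_symmetrizer (al : young d) n (rG : mx_representation C [set: 'S_d]%G n) :
  e rG *m (\sum_(x in conj_class al) rG x) = hatK1 C al la *: e rG.
Proof.
pose z x : C := (x \in conj_class al)%:R.
have zJ x y : z (y^-1 * x * y)%g = z x.
  by rewrite /z -mulgA -conjgE conj_classJ.
have [c cP] := symmetrizer_central (C := C) (@box_inj d la) (@box_down d la) zJ.
have sumz m (rH : mx_representation C [set: 'S_d]%G m) :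
    \sum_x z x *: rH x = \sum_(x in conj_class al) rH x.
  rewrite [RHS]big_mkcond; apply: eq_bigr => x _; rewrite /z.
  by case: ifP => _; rewrite ?scale1r ?scale0r.
suff -> : hatK1 C al la = c by rewrite -sumz; exact: cP.
have c_ok : \sum_(s in conj_class al) specht_repr C la s = c%:M.
  set Z := \sum_x z x *: reg x.
  (* The rows of [M] are the products [e g], which span the Specht module; the central [Z] moves
     past [g] to stand next to [e]. *)
  pose M := enveloping_algebra_mx reg *m lin_mul_row (gring_row (e reg)).
  have MZ : M *m Z = c *: M.
    apply/row_matrixP => i; rewrite row_mul linearZ /= row_mul mul_rV_lin1 /= rowK mxvecK.
    rewrite -mulmxA (class_function_sum_comm reg _ zJ) mulmxA -gring_row_mul cP.
    by rewrite [gring_row (_ *: _)]linearZ scalemxAl.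
  have SZ : specht_mx C la *m Z = c *: specht_mx C la.
    rewrite /specht_mx young_symmetrizerE.
    have /submxP[D ->] : (cyclic_mx reg (gring_row (e reg)) <= M)%MS by rewrite genmxE.
    by rewrite -mulmxA MZ -scalemxAr.
  apply: (@val_submod_inj C _ (specht_mx C la)).
  have vJ s : val_submod (1%:M *m specht_repr C la s) =
      val_submod (1%:M : 'M[C]_(dimV C la)) *m reg s.
    by apply: val_submodJ; rewrite inE.
  rewrite -[\sum_(s in _) _]mul1mx mulmx_sumr linear_sum (eq_bigr _ (fun s _ => vJ s)).
  rewrite -mulmx_sumr -sumz -/Z.
  have /submxP[D eD] : (val_submod (1%:M : 'M[C]_(dimV C la)) <= specht_mx C la)%MS.
    exact: val_submodP.
  rewrite eD -mulmxA SZ -scalemxAr -eD -linearZ /=.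
  by rewrite scalemx1.
rewrite /hatK1; set P := (P in xget _ P).
have : P (xget 0 P) by apply: (@xgetPex _ 0 P); exists c.
rewrite /P /= c_ok => /(congr1 (fun A : 'M[C]_(dimV C la) =>
  A (Ordinal dimV_gt0) (Ordinal dimV_gt0))).
by rewrite !mxE eqxx !mulr1n => <-.
Qed.

(** Compare the coefficients of the identity in [e Z = hatK1 e]: that of [e] is 1, and inversion
    permutes the class. *)
Lemma hatK1E (al : young d) : hatK1 C al la = \sum_(x in conj_class al) coef x.
Proof.
have := congr1 (fun A => gring_row A 0 (gring_index [set: 'S_d]%G 1%g))
  (hatK1_symmetrizer al reg).
have gZ (a : C) A i : gring_row (a *: A) 0 i = a * gring_row A 0 i :> C.
  by rewrite /gring_row !mxE.
rewrite symmetrizerE /= gZ gring_row_comb1.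
rewrite (sym_coef1 C (@box_inj d la)) mulr1 => <-.
have -> : (\sum_x coef x *: reg x) *m (\sum_(x in conj_class al) reg x) =
    \sum_x (\sum_(y in conj_class al) coef (x * y^-1)%g) *: reg x.
  rewrite mulmx_sumr.
  under eq_bigr => y _.
    rewrite mulmx_suml (reindex_inj (mulIg y^-1%g)) /=.
    under eq_bigr => x _ do rewrite -scalemxAl -repr_mxM ?inE // mulgKV.
    over.
  rewrite exchange_big /=; apply: eq_bigr => x _; by rewrite scaler_suml.
rewrite gring_row_comb1 (reindex_inj invg_inj) /=.
by apply: eq_big => [x|x _]; rewrite ?conj_classV // mul1g invgK.
Qed.

End SpechtScalars.

(** * The content polynomial *)

(** Stated for abstract [rw] and [cl] because it is used twice, the second time with rows and
    columns exchanged, to count the boxes above [k]. *)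
Lemma card_boxes_left d (rw cl : 'I_d -> nat) (k : 'I_d) :
    (forall i j, rw i = rw j -> cl i = cl j -> i = j) ->
    (forall k r c, (r <= rw k)%N -> (c <= cl k)%N -> exists2 x, rw x = r & cl x = c) ->
    (forall i j, (rw i <= rw j)%N -> (cl i <= cl j)%N -> (i <= j)%N) ->
  #|[set j | (rw j == rw k) && (j <= k)%N & j != k]| = cl k.
Proof.
move=> box_inj box_down box_order.
have ex (c : 'I_(cl k)) : exists x, (rw x == rw k) && (cl x == c).
  by have [x xi xc] := box_down k _ _ (leqnn _) (ltnW (ltn_ord c)); exists x; rewrite xi xc !eqxx.
pose g c := xchoose (ex c).
have gP c : rw (g c) = rw k /\ cl (g c) = c.
  by have /andP[/eqP ? /eqP] := xchooseP (ex c).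
have gi : injective g by move=> a b e; apply: val_inj; rewrite /= -(gP a).2 -(gP b).2 e.
rewrite -[RHS]card_ord -(card_imset _ gi); congr #|pred_of_set _|.
apply/setP => j; rewrite inE; apply/andP/imsetP => [[/andP[/eqP rj jk] njk]|[c _ ->]].
  have cj : (cl j < cl k)%N.
    rewrite ltnNge; apply/negP => ckj; move/negP: njk; apply.
    rewrite -val_eqE eqn_leq jk box_order //; by rewrite rj.
  by exists (Ordinal cj) => //; apply: box_inj; rewrite ?(gP _).1 ?(gP _).2.
have [-> cg] := gP c; rewrite eqxx box_order ?(gP c).1 ?cg ?(ltnW (ltn_ord c)) //.
by split=> //; apply/eqP => e; have := ltn_ord c; rewrite -{2}e cg ltnn.
Qed.

Section ContentPolynomial.
Variable d : nat.
Implicit Types (h : 'I_d -> nat) (s t u : 'S_d).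

Lemma card_porbits_conj s t : #|porbits (s ^ t)%g| = #|porbits s|.
Proof. by rewrite porbits_conjg card_imset //; exact/imset_inj/perm_inj. Qed.

Lemma card_porbitsC s t : #|porbits (s * t)%g| = #|porbits (t * s)%g|.
Proof. by rewrite -[in RHS](card_porbits_conj _ t) conjgE !mulgA mulVg mul1g. Qed.

(** The fixed point [k] is an orbit by itself, and the transposition merges it with the orbit of
    [i]. *)
Lemma card_porbits_mul_tperm s (i k : 'I_d) : s k = k -> i != k ->
  #|porbits s| = #|porbits (s * tperm i k)%g|.+1.
Proof.
move=> sk ik; rewrite card_porbitsC; have := porbits_mul_tperm s i k => /=.
have -> : porbit s k = [set k].
  apply/setP => y; rewrite inE; apply/porbitP/eqP => [[n ->]|->]; last by exists 0%N; rewrite expg0 perm1.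
  by rewrite permX; elim: n => //= n ->.
by rewrite inE ik /= -[_.*2]/2%N => /eqP; rewrite addn2 addn1 eqSS => /eqP.
Qed.

(** For [h] the row or column function, this is the row or column group of the subdiagram formed by
    the first [k] boxes. *)
Definition lower_stab h (k : nat) : {set 'S_d} :=
  [set s : 'S_d | [forall b, h (s b) == h b] && [forall b : 'I_d, (k <= b)%N ==> (s b == b)]].

Lemma lower_stabP h k s :
  reflect ((forall b, h (s b) = h b) /\ (forall b : 'I_d, (k <= b)%N -> s b = b))
          (s \in lower_stab h k).
Proof.
rewrite inE; apply: (iffP andP) => -[H1 H2].
  split=> b; first exact/eqP/(forallP H1).
  by move=> kb; apply/eqP; move/forallP/(_ b)/implyP: H2; exact.
split; apply/forallP => b; first by rewrite H1.
by apply/implyP => kb; rewrite H2.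
Qed.

Lemma lower_stab_group h k : group_set (lower_stab h k).
Proof.
apply/group_setP; split; first by apply/lower_stabP; split=> b; rewrite perm1.
move=> s t /lower_stabP[s1 s2] /lower_stabP[t1 t2]; apply/lower_stabP; split=> b.
  by rewrite permM t1 s1.
by move=> kb; rewrite permM s2 // t2.
Qed.

Definition lstab h k := Group (lower_stab_group h k).

Lemma tperm_lower_stab h k (i j : 'I_d) :
  h i = h j -> (i < k)%N -> (j < k)%N -> tperm i j \in lower_stab h k.
Proof.
move=> hij ik jk; apply/lower_stabP; split=> b.
  by case: tpermP => [->|->|//].
by move=> kb; rewrite tpermD //; apply/eqP => e; move: kb; rewrite -e leqNgt ?ik ?jk.
Qed.

(** Coset decomposition over the subgroup that also fixes box [k]. The representatives exchange [k]
    with an earlier box of its line; [j = k] gives the identity. *)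
Lemma sum_lower_stabS (A : nmodType) h (k : 'I_d) (G : 'S_d -> A) :
  \sum_(s in lower_stab h k.+1) G s =
  \sum_(j | (h j == h k) && (j <= k)%N) \sum_(s in lower_stab h k) G (tperm j k * s)%g.
Proof.
rewrite (partition_big (fun s => s^-1%g k) (fun j => (h j == h k) && (j <= k)%N)) /=; last first.
  move=> s; rewrite -(groupV (lstab h k.+1)) => /lower_stabP[s1 s2].
  rewrite s1 eqxx leqNgt; apply/negP => kj.
  by have := s2 _ kj => /perm_inj e; rewrite e ltnn in kj.
apply: eq_bigr => j /andP[/eqP hj jk].
rewrite (reindex_inj (mulgI (tperm j k))) /=; apply: eq_bigl => s.
have tk : tperm j k \in lower_stab h k.+1 by apply: tperm_lower_stab; rewrite ?ltnS.
rewrite (groupMl (G := lstab h k.+1)) // invMg permM tpermV.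
apply/andP/lower_stabP => [[/lower_stabP[s1 s2] /eqP sk]|[s1 s2]].
  split=> // b; rewrite leq_eqVlt => /orP[/eqP kb|/s2 //].
  have -> : b = k by apply: val_inj.
  move: sk => /(canRL (tpermK _ _)); rewrite tpermL => /(canRL (permKV _)); by [].
split; first by apply/lower_stabP; split=> // b /ltnW/s2.
have -> : s^-1%g k = k by apply: (@perm_inj _ s); rewrite permKV s2.
by rewrite tpermR.
Qed.

Lemma sum_lower_stabSV (A : nmodType) h (k : 'I_d) (G : 'S_d -> A) :
  \sum_(s in lower_stab h k.+1) G s =
  \sum_(j | (h j == h k) && (j <= k)%N) \sum_(s in lower_stab h k) G (s * tperm j k)%g.
Proof.
rewrite (reindex_inj invg_inj) /=.
rewrite (eq_bigl (mem (lower_stab h k.+1))) => [|s]; last exact: (groupV (lstab h k.+1)).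
rewrite (sum_lower_stabS h k (fun s => G s^-1%g)); apply: eq_bigr => j _.
rewrite (reindex_inj invg_inj) /=.
apply: eq_big => [s|s _]; first exact: (groupV (lstab h k)).
by rewrite invMg invgK tpermV.
Qed.

Variables (rw cl : 'I_d -> nat).
Hypothesis box_inj : forall i j, rw i = rw j -> cl i = cl j -> i = j.
Hypothesis box_down : forall k r c, (r <= rw k)%N -> (c <= cl k)%N ->
  exists2 x, rw x = r & cl x = c.
Hypothesis box_order : forall i j, (rw i <= rw j)%N -> (cl i <= cl j)%N -> (i <= j)%N.
Variables (C : numFieldType) (X : C).
Hypothesis X0 : X != 0.

(** For [X = N] this is the trace of [s] on the tensor power, and [phi k t] is the trace of the
    symmetrizer of the first [k] boxes times [t]. *)
Let cyc s : C := X ^+ #|porbits s|.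
Let phi (k : nat) (t : 'S_d) : C :=
  \sum_(s in lower_stab rw k) \sum_(u in lower_stab cl k) (-1) ^+ odd_perm u * cyc (s * u * t)%g.

Lemma cycC s t : cyc (s * t)%g = cyc (t * s)%g.
Proof. by rewrite /cyc card_porbitsC. Qed.

Lemma phi_tperm (k j : 'I_d) : j != k -> X * phi k (tperm j k) = phi k 1%g.
Proof.
move=> jk; rewrite /phi mulr_sumr; apply: eq_bigr => s /lower_stabP[_ sk].
rewrite mulr_sumr; apply: eq_bigr => u /lower_stabP[_ uk].
rewrite mulrCA -exprS mulg1; congr (_ * _ ^+ _); symmetry.
by apply: card_porbits_mul_tperm; rewrite // permM sk // uk.
Qed.

(* Let [x] be the box in the row of [i] and the column of [j].  Moving
   [tperm x j] into the column group changes the sign, moving [tperm i x] into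
   the row group does not, and both give the same product with [tperm i j]. *)
Lemma phi_3cycle (k i j : 'I_d) : (i < k)%N -> (j < k)%N -> cl i = cl k -> rw j = rw k ->
  phi k (tperm i k * tperm j k)%g = 0.
Proof.
move=> ik jk ci rj.
have ri : (rw i <= rw k)%N.
  by rewrite leqNgt; apply/negP => /ltnW /box_order; rewrite ci leqnn => /(_ isT); rewrite leqNgt ik.
have cj : (cl j <= cl k)%N.
  by rewrite leqNgt; apply/negP => /ltnW; move/(box_order (i := k)) => /=;
     rewrite rj leqnn => /(_ isT); rewrite leqNgt jk.
have [x rx cx] := box_down ri cj.
have xi : (x <= i)%N by apply: box_order; rewrite ?rx // cx ci.
have xk : (x < k)%N by apply: leq_ltn_trans xi ik.
have nik : i != k by rewrite neq_ltn ik.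
have njk : j != k by rewrite neq_ltn jk.
have nij : i != j.
  by apply/eqP => e; move/eqP: nik; apply; apply: box_inj; rewrite ?ci // e rj.
have nxi : x != i.
  apply/eqP => e; move/eqP: njk; apply; apply: box_inj; rewrite ?rj //.
  by rewrite -cx e ci.
have nxj : x != j.
  apply/eqP => e; move/eqP: nik; apply; apply: box_inj; rewrite ?ci //.
  by rewrite -rx e rj.
have [nki nkj nji nix njx] : [/\ k != i, k != j, j != i, i != x & j != x].
  by split; rewrite eq_sym.
have -> : (tperm i k * tperm j k = tperm i j * tperm i k)%g.
  apply/permP => b; rewrite !permM.
  case: (eqVneq b i) => [->|bi]; first by rewrite !tpermL tpermR tpermD.
  case: (eqVneq b j) => [->|bj]; first by rewrite (@tpermD _ i k j) // tpermL !tpermR tpermL.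
  case: (eqVneq b k) => [->|bk]; first by rewrite tpermR (@tpermD _ j k i) // (@tpermD _ i j k) // tpermR.
  by rewrite !tpermD // eq_sym.
apply: (mulfI X0); rewrite mulr0.
have -> : X * phi k (tperm i j * tperm i k)%g = phi k (tperm i j).
  rewrite /phi mulr_sumr; apply: eq_bigr => s /lower_stabP[_ sk].
  rewrite mulr_sumr; apply: eq_bigr => u /lower_stabP[_ uk].
  rewrite mulrCA -exprS mulgA; congr (_ * _ ^+ _); symmetry.
  by apply: card_porbits_mul_tperm; rewrite // !permM sk // uk // tpermD.
have S1 : phi k (tperm i j) = - phi k (tperm x j * tperm i j)%g.
  rewrite /phi -sumrN; apply: eq_bigr => s _; rewrite -sumrN.
  have tk : tperm x j \in lower_stab cl k by apply: tperm_lower_stab.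
  rewrite (reindex_inj (mulIg (tperm x j))) /=.
  apply: eq_big => [u|u _]; first by rewrite (groupMr (G := lstab cl k)) //.
  by rewrite odd_permM odd_tperm nxj signr_addb expr1 mulrN1 mulNr !mulgA.
have S2 : phi k (tperm i j) = phi k (tperm i j * tperm i x)%g.
  have tk : tperm i x \in lower_stab rw k by apply: tperm_lower_stab.
  rewrite /phi (reindex_inj (mulgI (tperm i x))) /=.
  apply: eq_big => [u|s _]; first by rewrite (groupMl (G := lstab rw k)) //.
  by apply: eq_bigr => u _; rewrite -!mulgA cycC !mulgA.
have S3 : (tperm x j * tperm i j = tperm i j * tperm i x)%g.
  by rewrite -[LHS](mulKVg (tperm i j)) -conjgE tpermJ tpermD ?tpermR 1?eq_sym // [tperm x i]tpermC.
move: S1; rewrite S3 -S2 => /eqP; rewrite -addr_eq0 -mulr2n -mulr_natr mulf_eq0 pnatr_eq0 orbF.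
by move/eqP.
Qed.

(** Both groups are decomposed over the transpositions with [k]. The [cl k] row transpositions each
    contribute [X^-1 phi], the [rw k] column transpositions each [- X^-1 phi], and the mixed terms
    are the vanishing 3-cycles. *)
Lemma phiS (k : 'I_d) : X * phi k.+1 1%g = (X + (cl k)%:R - (rw k)%:R) * phi k 1%g.
Proof.
have cardJ := card_boxes_left k box_inj box_down box_order.
have cardI : #|[set j | (cl j == cl k) && (j <= k)%N & j != k]| = rw k.
  apply: card_boxes_left => [i j ci ri|i r c rk ck|i j ci ri]; first exact: box_inj.
    by have [x xc xr] := box_down ck rk; exists x.
  exact: box_order.
have -> : phi k.+1 1%g =
    \sum_(j | (rw j == rw k) && (j <= k)%N) \sum_(i | (cl i == cl k) && (i <= k)%N)
       (-1) ^+ (i != k) * phi k (tperm i k * tperm j k)%g.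
  rewrite /phi sum_lower_stabS; apply: eq_bigr => j _.
  under eq_bigr => s _ do rewrite sum_lower_stabSV.
  rewrite exchange_big /=; apply: eq_bigr => i _.
  rewrite mulr_sumr; apply: eq_bigr => s _; rewrite mulr_sumr; apply: eq_bigr => u _.
  rewrite mulg1 odd_permM odd_tperm signr_addb mulrA [X in X * _ = _]mulrC; congr (_ * _).
  by rewrite -!mulgA cycC !mulgA.
have kk : tperm k k = 1%g.
  by apply/permP => b; rewrite perm1; case: tpermP => // ->.
rewrite (bigD1 k) ?eqxx ?leqnn //= (bigD1 k) ?eqxx ?leqnn //= kk mulg1 mul1r.
have phit i : i != k -> phi k (tperm i k) = X^-1 * phi k 1%g.
  by move=> /phi_tperm <-; rewrite mulKf.
have -> : \sum_(i | (cl i == cl k) && (i <= k)%N && (i != k))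
    (-1) ^+ (i != k) * phi k (tperm i k * 1)%g = - (rw k)%:R * (X^-1 * phi k 1%g).
  rewrite -cardI (eq_bigr (fun=> - (X^-1 * phi k 1%g))) => [|i /andP[_ ik]].
    by rewrite sumr_const cardsE mulNr mulr_natl mulNrn.
  by rewrite mulg1 ik expr1 mulN1r phit.
have -> : \sum_(j | (rw j == rw k) && (j <= k)%N && (j != k))
   \sum_(i | (cl i == cl k) && (i <= k)%N) (-1) ^+ (i != k) * phi k (tperm i k * tperm j k)%g
   = (cl k)%:R * (X^-1 * phi k 1%g).
  rewrite -{2}cardJ (eq_bigr (fun=> X^-1 * phi k 1%g)) => [|j /andP[/andP[/eqP rj jk] njk]].
    by rewrite sumr_const cardsE mulr_natl.
  rewrite (bigD1 k) ?eqxx ?leqnn //= kk mul1g mul1r phit // big1 ?addr0 // => i /andP[/andP[/eqP ci ik] nik].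
  by rewrite phi_3cycle ?mulr0 // ltn_neqAle ?nik ?njk.
by field.
Qed.

Lemma sum_signed_cycles :
  \sum_(s in row_stab rw) \sum_(u in col_stab cl) (-1) ^+ odd_perm u * X ^+ #|porbits (s * u)%g| =
  \prod_(k < d) (X + (cl k)%:R - (rw k)%:R).
Proof.
have lsd h : lower_stab h d = row_stab h.
  apply/setP => s; rewrite !inE andb_idr // => _; apply/forallP => b.
  by rewrite leqNgt ltn_ord.
have phi_d : phi d 1%g = \sum_(s in row_stab rw) \sum_(u in col_stab cl)
     (-1) ^+ odd_perm u * X ^+ #|porbits (s * u)%g|.
  by rewrite /phi !lsd; apply: eq_bigr => s _; apply: eq_bigr => u _; rewrite mulg1.
have ls0 h : lower_stab h 0 = [set 1%g].
  apply/setP => s; rewrite finset.in_set1; apply/lower_stabP/eqP => [[_ s0]|->].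
    by apply/permP => b; rewrite perm1 s0.
  by split=> b; rewrite perm1.
(* In [phi k] the [d - k] boxes not yet reached are fixed points, each worth a factor [X];
   multiplying by [X ^+ k] balances them against [X ^+ d]. *)
have phi_k k : (k <= d)%N -> phi k 1%g * X ^+ k =
      X ^+ d * \prod_(i < d | (i < k)%N) (X + (cl i)%:R - (rw i)%:R).
  elim: k => [_|k IH kd].
    rewrite big_pred0 // expr0 !mulr1 /phi !ls0 !big_set1 odd_perm1 mul1r !mulg1.
    congr (_ ^+ _); rewrite /porbits card_imset ?card_ord //.
    move=> a b e; have := porbit_id 1%g a; rewrite e => /porbitP[n ->].
    by rewrite expg1n perm1.
  have pS : X * phi k.+1 1%g =
    (X + (cl (Ordinal kd))%:R - (rw (Ordinal kd))%:R) * phi k 1%g := phiS (Ordinal kd).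
  move: (phi k.+1 1%g) (phi k 1%g) IH pS => p1 p0 IH pS.
  rewrite exprS mulrCA mulrA pS -mulrA IH; last exact: ltnW.
  rewrite mulrCA [in RHS](bigD1 (Ordinal kd)) //=.
  by do 2 congr (_ * _); apply: eq_bigl => i; rewrite ltnS ltn_neqAle andbC -val_eqE.
apply: (mulIf (expf_neq0 d X0)); rewrite -phi_d phi_k // mulrC; congr (_ * _).
by apply: eq_bigl => i; rewrite ltn_ord.
Qed.

End ContentPolynomial.

(** * The tensor power representation *)

Section FunctionMatrices.
Variables (C : comNzRingType) (F : finType).

(** Operators on tensors are described by kernels on index functions, and [enum_val] turns them into
    matrices, on which representations act. *)
Definition ker_mx (K : F -> F -> C) : 'M[C]_#|F| :=
  \matrix_(i, j) K (enum_val i) (enum_val j).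

Lemma ker_mxE K f h : ker_mx K (enum_rank f) (enum_rank h) = K f h.
Proof. by rewrite mxE !enum_rankK. Qed.

Lemma ker_mx_eta (A : 'M[C]_#|F|) : A = ker_mx (fun f h => A (enum_rank f) (enum_rank h)).
Proof. by apply/matrixP => i j; rewrite mxE !enum_valK. Qed.

Lemma eq_ker_mx K L : (forall f h, K f h = L f h) -> ker_mx K = ker_mx L.
Proof. by move=> KL; apply/matrixP => i j; rewrite !mxE. Qed.

Lemma sum_enum_rank (A : nmodType) (G : 'I_#|F| -> A) : \sum_i G i = \sum_f G (enum_rank f).
Proof. by rewrite (reindex (@enum_rank F)) //=; apply: onW_bij; apply: enum_rank_bij. Qed.

Lemma ker_mxM K L : ker_mx K *m ker_mx L = ker_mx (fun f h => \sum_g K f g * L g h).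
Proof.
apply/matrixP => i j; rewrite !mxE sum_enum_rank; apply: eq_bigr => g _.
by rewrite !mxE enum_rankK.
Qed.

Lemma ker_mx_tr K : \tr (ker_mx K) = \sum_f K f f.
Proof. by rewrite /mxtrace sum_enum_rank; apply: eq_bigr => f _; rewrite ker_mxE. Qed.

Lemma ker_mx1 : ker_mx (fun f h : F => (f == h)%:R : C) = 1%:M.
Proof. by apply/matrixP => i j; rewrite !mxE (inj_eq enum_val_inj). Qed.

End FunctionMatrices.

Section TensorPower.
Variables (C : fieldType) (N d : nat).
Local Notation tpos := {ffun 'I_d -> 'I_N}.
Implicit Types (f h : tpos) (s : 'S_d) (g : 'M[C]_N).

Definition tens g : 'M[C]_#|{: tpos}| := ker_mx (fun f h : tpos => \prod_k g (f k) (h k)).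

Lemma tensM g1 g2 : tens (g1 *m g2) = tens g1 *m tens g2.
Proof.
rewrite /tens ker_mxM; apply: eq_ker_mx => f h.
under eq_bigr => k _ do rewrite mxE.
rewrite bigA_distr_bigA /=; apply: eq_bigr => u _; exact: big_split.
Qed.

Lemma tens1 : tens 1%:M = 1%:M.
Proof.
rewrite -ker_mx1; apply: eq_ker_mx => f h.
case: eqP => [->|ne].
  by rewrite big1 // => k _; rewrite mxE eqxx.
have [k fk] : exists k, f k != h k.
  apply/existsP; rewrite -negb_forall; apply/negP => /forallP fh; apply: ne.
  by apply/ffunP => k; apply/eqP.
by rewrite (bigD1 k) //= mxE (negPf fk) mul0r.
Qed.

(** The convention [f = h \o s] makes this a homomorphism for the product of ['S_d], in which
    [(s * t) k = t (s k)]. *)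
Definition place_perm s : 'M[C]_#|{: tpos}| :=
  ker_mx (fun f h : tpos => (f == [ffun k => h (s k)])%:R).

Lemma place_perm_repr : mx_repr [set: 'S_d]%G place_perm.
Proof.
split=> [|s t _ _].
  rewrite -ker_mx1; apply: eq_ker_mx => f h; congr (_ == _)%:R.
  by apply/ffunP => k; rewrite ffunE perm1.
rewrite /place_perm ker_mxM; apply: eq_ker_mx => f h.
rewrite (bigD1 [ffun k => h (t k)]) //= eqxx mulr1 [X in _ + X]big1 ?addr0 => [|u /negPf ->];
  last by rewrite mulr0.
congr (_ == _)%:R; apply/ffunP => k; by rewrite !ffunE permM.
Qed.

Definition place_repr := MxRepresentation place_perm_repr.

Lemma tens_place_perm g s :
  tens g *m place_perm s = ker_mx (fun f h : tpos => \prod_k g (f k) (h (s k))).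
Proof.
rewrite /tens /place_perm ker_mxM; apply: eq_ker_mx => f h.
rewrite (bigD1 [ffun k => h (s k)]) //= eqxx mulr1 [X in _ + X]big1 ?addr0 => [|u /negPf ->];
  last by rewrite mulr0.
by apply: eq_bigr => k _; rewrite ffunE.
Qed.

Lemma place_permC (K : tpos -> tpos -> C) s :
    (forall f h, K [ffun k => f (s k)] [ffun k => h (s k)] = K f h) ->
  ker_mx K *m place_perm s = place_perm s *m ker_mx K.
Proof.
move=> Ks; rewrite /place_perm !ker_mxM; apply: eq_ker_mx => f h.
rewrite (bigD1 [ffun k => h (s k)]) //= eqxx mulr1 [X in _ + X]big1 ?addr0 => [|u /negPf ->];
  last by rewrite mulr0.
rewrite (bigD1 [ffun k => f (s^-1%g k)]) //= [X in _ + X]big1 ?addr0 => [|u ne].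
  have {1 2}-> : f = [ffun k => [ffun k => f (s^-1%g k)] (s k)].
    by apply/ffunP => k; rewrite !ffunE permK.
  by rewrite eqxx mul1r Ks.
case: eqP => [e|]; last by rewrite mul0r.
by case/eqP: ne; apply/ffunP => k; rewrite e !ffunE permKV.
Qed.

Lemma tens_place_permC g s : tens g *m place_perm s = place_perm s *m tens g.
Proof.
apply: place_permC => f h; rewrite [RHS](reindex_inj (@perm_inj _ s)) /=.
by apply: eq_bigr => k _; rewrite !ffunE.
Qed.

(** Only index functions constant on the cycles of [s] contribute. They are the functions on the set
    of orbits, and distributivity turns the sum over them into a product over orbits. *)
Lemma trace_tens_diag (x : 'rV[C]_N) s :
  \tr (tens (diag_mx x) *m place_perm s) = \prod_(X in porbits s) \sum_i x 0 i ^+ #|X|.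
Proof.
rewrite tens_place_perm ker_mx_tr.
have sumE f : \prod_k diag_mx x (f k) (f (s k)) =
    if [forall k, f (s k) == f k] then \prod_k x 0 (f k) else 0.
  case: ifPn => [/forallP fs|].
    by apply: eq_bigr => k _; rewrite mxE (eqP (fs k)) eqxx.
  rewrite negb_forall => /existsP[k fk]; rewrite (bigD1 k) //= mxE eq_sym (negPf fk).
  by rewrite mulr0n mul0r.
rewrite (eq_bigr _ (fun f _ => sumE f)).
rewrite -big_mkcond /=.
pose orb := {X | X \in porbits s}.
have cls_in k : porbit s k \in porbits s by apply: imset_f.
pose cls k : orb := exist _ (porbit s k) (cls_in k).
have pt_ex (X : orb) : exists k, k \in sval X.
  by case: X => X /= /imsetP[k _ ->]; exists k; exact: porbit_id.
pose pt X := xchoose (pt_ex X).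
have clspt X : cls (pt X) = X.
  apply: val_inj => /=; have : pt X \in val X := xchooseP (pt_ex X).
  move: (pt X) => p; have /imsetP[k _ /= eX] := valP X; rewrite eX => pk.
  by apply/eqP; rewrite eq_porbit_mem.
rewrite (reindex_onto (fun h : {ffun orb -> 'I_N} => [ffun k => h (cls k)])
  (fun f => [ffun X => f (pt X)])) /=; last first.
  move=> f /forallP fs; apply/ffunP => k; rewrite !ffunE.
  have : pt (cls k) \in porbit s k by exact: (xchooseP (pt_ex (cls k))).
  case/porbitP => n ->; elim: n => [|n IH]; first by rewrite expg0 perm1.
  by rewrite expgSr permM (eqP (fs _)).
rewrite (eq_bigl xpredT) => [|h]; last first.
  apply/andP; split.
    apply/forallP => k; rewrite !ffunE; apply/eqP; congr (h _); apply: val_inj => /=.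
    by rewrite -{1}[s k]/((s ^+ 1)%g k) porbit_perm.
  by apply/eqP/ffunP => X; rewrite !ffunE clspt.
have -> : \prod_(X in porbits s) \sum_i x 0 i ^+ #|X| =
    \prod_(X : orb) \sum_i x 0 i ^+ #|sval X| by rewrite big_sub.
rewrite bigA_distr_bigA /=; apply: eq_bigr => h _.
rewrite (partition_big cls xpredT) //=; apply: eq_bigr => X _.
rewrite (eq_bigr (fun=> x 0 (h X))) => [|k /eqP <-]; last by rewrite ffunE.
rewrite prodr_const; congr (_ ^+ _); apply: eq_card => k.
have /imsetP[p _ /= eX] := valP X.
rewrite -[LHS]/(cls k == X) eX -eq_porbit_mem -eX.
by apply/eqP/eqP => [<-//|e]; exact: val_inj.
Qed.

Lemma trace_tens_conj (v g : 'M[C]_N) s : v \in unitmx ->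
  \tr (tens (invmx v *m g *m v) *m place_perm s) = \tr (tens g *m place_perm s).
Proof.
move=> vu; rewrite !tensM -!mulmxA (mxtrace_mulC (tens (invmx v))).
by rewrite -!mulmxA -tens_place_permC (mulmxA (tens v)) -tensM mulmxV // tens1 mul1mx.
Qed.

Lemma trace_tens_conj_sum (v g : 'M[C]_N) (a : 'S_d -> C) : v \in unitmx ->
  \tr (tens (invmx v *m g *m v) *m \sum_s a s *: place_perm s) =
  \tr (tens g *m \sum_s a s *: place_perm s).
Proof.
move=> vu; rewrite !mulmx_sumr !linear_sum; apply: eq_bigr => s _.
by rewrite -!scalemxAr !linearZ /= trace_tens_conj.
Qed.

Lemma trace_pow_conj_diag (v : 'M[C]_N) (x : 'rV[C]_N) n : v \in unitmx ->
  \tr ((invmx v *m diag_mx x *m v) ^+ n) = \sum_i x 0 i ^+ n.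
Proof.
move=> vu; have -> : (invmx v *m diag_mx x *m v) ^+ n =
    invmx v *m diag_mx (\row_i x 0 i ^+ n) *m v.
  elim: n => [|n IH].
    have -> : diag_mx (\row_i x 0 i ^+ 0) = 1%:M.
      by apply/matrixP => i j; rewrite !mxE expr0.
    by rewrite expr0 mulmx1 mulVmx.
  rewrite exprS IH -[_ * _]/(_ *m _) !mulmxA (mulmxK vu).
  rewrite -(mulmxA (invmx v) (diag_mx x)) mulmx_diag; congr (_ *m diag_mx _ *m _).
  by apply/rowP => i; rewrite !mxE exprS.
rewrite mxtrace_mulC mulmxA mulmxV // mul1mx mxtrace_diag.
by apply: eq_bigr => i _; rewrite mxE.
Qed.

Lemma trace_tens_diagonalizable (v : 'M[C]_N) (x : 'rV[C]_N) s : v \in unitmx ->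
  let g := invmx v *m diag_mx x *m v in
  \tr (tens g *m place_perm s) = \prod_(X in porbits s) \tr (g ^+ #|X|).
Proof.
move=> vu g; rewrite trace_tens_conj // trace_tens_diag.
by apply: eq_bigr => X _; rewrite trace_pow_conj_diag.
Qed.

End TensorPower.

Lemma unitary_diag (C : numClosedFieldType) N (g : 'M[C]_N) : g \is unitarymx ->
  exists (v : 'M[C]_N) (x : 'rV[C]_N),
    [/\ v \is unitarymx, forall i, `|x 0 i| = 1 & g = invmx v *m diag_mx x *m v].
Proof.
move=> gU.
have gN : g \is normalmx.
  apply/normalmxP; rewrite (unitarymxP gU).
  by rewrite -(invmx_unitary gU) mulVmx // unitarymx_unit.
have /orthomx_spectralP eg := gN.
exists (spectralmx g), (spectral_diag g); split=> //; first exact: spectral_unitarymx.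
move=> i; set v := spectralmx g in eg *; set x := spectral_diag g in eg *.
have vU : v \is unitarymx by exact: spectral_unitarymx.
have xE : diag_mx x = v *m g *m invmx v.
  by rewrite eg !mulmxA mulmxV ?unitarymx_unit // mul1mx mulmxK // unitarymx_unit.
have xU : diag_mx x \is unitarymx.
  by rewrite xE !mul_unitarymx // invmx_unitary // trmxC_unitary.
have /matrixP/(_ i i) := unitarymxP xU.
rewrite tr_diag_mx map_diag_mx mulmx_diag !mxE eqxx !mulr1n -normCK => /eqP.
by rewrite sqrp_eq1 ?normr_ge0 // => /eqP.
Qed.

Lemma unitarymx1 (C : numClosedFieldType) N : (1%:M : 'M[C]_N) \is unitarymx.
Proof. by apply/unitarymxP; rewrite trmx1 map_mx1 mulmx1. Qed.

Lemma unitarymx_inv (C : numClosedFieldType) N (v : 'M[C]_N) :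
  v \is unitarymx -> invmx v \is unitarymx.
Proof. by move=> vU; rewrite invmx_unitary // trmxC_unitary. Qed.

Lemma diag_unitary (C : numClosedFieldType) N (x : 'rV[C]_N) :
  (forall i, `|x 0 i| = 1) -> diag_mx x \is unitarymx.
Proof.
move=> x1; apply/unitarymxP; rewrite tr_diag_mx map_diag_mx mulmx_diag.
by apply/matrixP => i j; rewrite !mxE -normCK x1 expr1n.
Qed.

Lemma conj_diag_unitary (C : numClosedFieldType) N (v : 'M[C]_N) (x : 'rV[C]_N) :
  v \is unitarymx -> (forall i, `|x 0 i| = 1) -> invmx v *m diag_mx x *m v \is unitarymx.
Proof.
move=> vU x1; apply: mul_unitarymx => //; apply: mul_unitarymx; last exact: diag_unitary.
exact: unitarymx_inv.
Qed.

Lemma horner_affine (A : comNzRingType) (a b y : A) : (a%:P + b%:P * 'X).[y] = a + y * b.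
Proof. by rewrite hornerD hornerM !hornerC hornerX mulrC. Qed.

(** * Traces of Young symmetrizers on the tensor power *)

Section SpechtTensor.
Variables (R : realType) (N d : nat).
Implicit Types (la al : young d) (g : 'M[R[i]]_N).

Definition tens_sym la := symmetrizer (box_row la) (box_col la) (place_repr R[i] N d).

Lemma power_sum_cycles al g s : s \in conj_class al ->
  power_sum al g = \prod_(X in porbits s) \tr (g ^+ #|X|).
Proof.
rewrite inE => sal; rewrite /power_sum.
transitivity (\prod_(r <- [seq r <- rows al | r != 0%N]) \tr (g ^+ r)).
  rewrite big_filter (big_nth 0%N) big_mkord size_rows.
  rewrite (big_ord_widen _ (fun i => \tr (g ^+ row_len al i)) (nrows_le al)).
  by apply: eq_bigl => i; rewrite /= ltn_nrows lt0n.
by rewrite -(perm_big _ sal) /= big_map big_enum.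
Qed.

(** Each permutation lies in exactly one class, so by [hatK1E] the sum over [al] is the expansion of
    the symmetrizer; the trace of a single permutation is computed after diagonalizing [g]. *)
Lemma sum_power_sum_hatK1 la g : g \is unitarymx ->
  \sum_al power_sum al g * hatK1 R[i] al la = \tr (tens d g *m tens_sym la).
Proof.
move=> /unitary_diag[v [x [vU _ eg]]].
have trE (s : 'S_d) : \tr (tens d g *m place_perm R[i] N s) = \prod_(X in porbits s) \tr (g ^+ #|X|).
  by rewrite eg trace_tens_diagonalizable // unitarymx_unit.
rewrite /tens_sym symmetrizerE mulmx_sumr linear_sum /=.
under [RHS]eq_bigr => s _ do rewrite -scalemxAr linearZ /= trE.
under eq_bigr => al _ do rewrite hatK1E mulr_sumr big_mkcond /=.
rewrite exchange_big /=; apply: eq_bigr => s _.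
have [al0 sal0] := conj_class_exists s.
rewrite (bigD1 al0) //= sal0 big1 ?addr0 => [|al ne].
  by rewrite mulrC (power_sum_cycles _ sal0).
by case: ifP => // sal; rewrite (conj_class_inj sal sal0) eqxx in ne.
Qed.

Lemma trace_tens_sym la : (0 < N)%N ->
  \tr (tens_sym la) = content_prod la (fun c => N%:R + c%:~R).
Proof.
move=> N0; have N0' : N%:R != 0 :> R[i] by rewrite pnatr_eq0 -lt0n.
have trE (s : 'S_d) : \tr (place_perm R[i] N s) = N%:R ^+ #|porbits s|.
  have -> : place_perm R[i] N s = tens d (diag_mx (const_mx 1)) *m place_perm R[i] N s.
    by rewrite diag_const_mx tens1 mul1mx.
  rewrite trace_tens_diag -prodr_const; apply: eq_bigr => X _.
  under eq_bigr => i _ do rewrite mxE expr1n.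
  by rewrite sumr_const card_ord.
rewrite /tens_sym symmetrizerE linear_sum /=.
under eq_bigr => s _ do rewrite linearZ /= trE.
rewrite content_prodE.
have := sum_signed_cycles (@box_inj d la) (@box_down d la) (@box_order d la) N0'.
under [in RHS]eq_bigr => k _.
  have -> : N%:R + (box_col la k)%:R - (box_row la k)%:R =
    N%:R + ((box_col la k)%:Z - (box_row la k)%:Z)%:~R :> R[i].
    by rewrite intrB -addrA.
  over.
move=> <-; rewrite /sym_coef.
under eq_bigr => x _ do rewrite mulr_suml.
rewrite exchange_big /=; apply: eq_bigr => s _.
under eq_bigr => x _ do rewrite mulr_suml.
rewrite exchange_big /=; apply: eq_bigr => u _.
rewrite (bigD1 (s * u)%g) //= eqxx mul1r big1 ?addr0 // => x.
by rewrite eq_sym => /negPf ->; rewrite !mul0r.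
Qed.

End SpechtTensor.

(** * Weights of the tensor power *)

Section Content.
Variables (J : finType) (d : nat).
Implicit Types (f h : {ffun 'I_d -> J}).

(** The weight of the basis tensor [f], unrelated to the contents of cells. Its values are taken in
    ['I_d.+1] so that weights form a finite type. *)
Definition content f : {ffun J -> 'I_d.+1} := [ffun i => inord #|[set k | f k == i]|].

Lemma contentE f i : content f i = #|[set k | f k == i]| :> nat.
Proof. by rewrite ffunE inordK // ltnS -[X in (_ <= X)%N](card_ord d) max_card. Qed.

Lemma content_perm f (s : 'S_d) : content [ffun k => f (s k)] = content f.
Proof.
apply/ffunP => i; apply: val_inj; rewrite /= !contentE -(card_imset _ (@perm_inj _ s)).
congr #|pred_of_set _|; apply/setP => k; rewrite inE; apply/imsetP/idP => [[j]|fk].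
  by rewrite inE ffunE => fj ->.
by exists (s^-1%g k); rewrite ?inE ?ffunE permKV.
Qed.

Lemma content_eq_perm f h : content f = content h -> exists s : 'S_d, f = [ffun k => h (s k)].
Proof.
move=> e; have pe : perm_eq [tuple f k | k < d] [tuple h k | k < d].
  apply/allP => j _ /=; apply/eqP.
  have cE (u : {ffun 'I_d -> J}) : count_mem j [seq u k | k <- enum 'I_d] = content u j.
    by rewrite contentE count_map cardsE cardE size_filter enumT.
  by rewrite !cE e.
have /tuple_permP[s es] := pe; exists s; apply/ffunP => k; rewrite ffunE.
have es' : [tuple f k | k < d] = [tuple tnth [tuple h k | k < d] (s k) | k < d] by exact: val_inj.
by have := congr1 (fun t => tnth t k) es'; rewrite !tnth_mktuple.
Qed.

Lemma prod_content (A : comNzRingType) f (x : J -> A) :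
  \prod_k x (f k) = \prod_i x i ^+ content f i.
Proof.
rewrite (partition_big f xpredT) //=; apply: eq_bigr => i _.
rewrite contentE (eq_bigr (fun=> x i)) => [|k /eqP -> //].
by rewrite prodr_const; congr (_ ^+ _); apply: eq_card => k; rewrite !inE.
Qed.

End Content.

Section Contents.
Variables (N d : nat).
Local Notation tpos := {ffun 'I_d -> 'I_N}.
Local Notation comp := {ffun 'I_N -> 'I_d.+1}.
Implicit Types (f h : tpos) (nu : comp) (la mu : young d).

Definition prefix nu k : nat := (\sum_(i < N | (i < k)%N) nu i)%N.

Lemma prefix_content f k : prefix (content f) k = #|[set b | (f b < k)%N]|.
Proof.
rewrite /prefix -sum1_card [RHS](partition_big f (fun i : 'I_N => (i < k)%N)) => [|b]; last by rewrite inE.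
apply: eq_bigr => i ik; rewrite contentE -sum1_card; apply: eq_bigl => b.
by rewrite !inE; case: eqP => [->|]; rewrite ?ik ?andbF.
Qed.

Definition shape la : comp := [ffun i : 'I_N => inord (row_len la i)].

Lemma row_len_le la i : (row_len la i <= d)%N.
Proof. by rewrite -card_box_row -[X in (_ <= X)%N](card_ord d) max_card. Qed.

Lemma shapeE la (i : 'I_N) : shape la i = row_len la i :> nat.
Proof. by rewrite ffunE inordK // ltnS row_len_le. Qed.

Lemma prefix_shape la k : (nrows la <= N)%N ->
  prefix (shape la) k = #|[set b | (box_row la b < k)%N]|.
Proof.
move=> laN; have ltN b : (box_row la b < N)%N by apply: leq_trans (box_row_lt_nrows la b) laN.
pose f : tpos := [ffun b => Ordinal (ltN b)].
have -> : [set b | (box_row la b < k)%N] = [set b | (f b < k)%N].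
  by apply/setP => b; rewrite !inE ffunE.
rewrite -prefix_content; congr prefix; apply/ffunP => i; apply: val_inj => /=.
rewrite shapeE contentE -card_box_row; congr #|pred_of_set _|; apply/setP => b.
by rewrite !inE ffunE -val_eqE.
Qed.

Definition row_filling la f := [forall b, f b == box_row la b :> nat].

Lemma row_filling_exists la : (nrows la <= N)%N -> exists f, row_filling la f.
Proof.
move=> laN; have ltN b : (box_row la b < N)%N by apply: leq_trans (box_row_lt_nrows la b) laN.
by exists [ffun b => Ordinal (ltN b)]; apply/forallP => b; rewrite ffunE.
Qed.

Lemma content_row_filling la f : row_filling la f -> content f = shape la.
Proof.
move=> /forallP fla; apply/ffunP => i; apply: val_inj => /=.
rewrite shapeE contentE -card_box_row; congr #|pred_of_set _|; apply/setP => b.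
by rewrite !inE -(eqP (fla b)) -val_eqE.
Qed.

Lemma prefixS nu (i : 'I_N) : prefix nu i.+1 = (prefix nu i + nu i)%N.
Proof.
rewrite /prefix (bigD1 i) //= addnC; congr (_ + _)%N; apply: eq_bigl => j.
by rewrite ltnS ltn_neqAle andbC.
Qed.

Lemma prefix_inj nu nu' : (forall k, (k <= N)%N -> prefix nu k = prefix nu' k) -> nu = nu'.
Proof.
move=> e; apply/ffunP => i; apply: val_inj; apply: (@addnI (prefix nu i)).
by rewrite -prefixS e // prefixS e // ltnW.
Qed.

Lemma shape_inj la mu : (nrows la <= N)%N -> (nrows mu <= N)%N -> shape la = shape mu -> la = mu.
Proof.
move=> laN muN e; apply: young_eq => i.
have [iN|Ni] := ltnP i N; first by rewrite -(shapeE la (Ordinal iN)) e shapeE.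
have z ka : (nrows ka <= N)%N -> row_len ka i = 0%N.
  move=> kN; apply/eqP; rewrite eqn0Ngt -ltn_nrows -leqNgt; exact: leq_trans kN Ni.
by rewrite !z.
Qed.

Definition dominated nu nu' := forall k, (prefix nu k <= prefix nu' k)%N.
(** Strictly monotone for dominance, by [dominated_rank_eq], so that maximal diagrams can be chosen
    by maximizing a natural number. *)
Definition dom_rank nu : nat := (\sum_(k < N.+1) prefix nu k)%N.

Lemma dominated_rank nu nu' : dominated nu nu' -> (dom_rank nu <= dom_rank nu')%N.
Proof. by move=> D; apply: leq_sum => k _; exact: D. Qed.

Lemma dominated_rank_eq nu nu' :
  dominated nu nu' -> (dom_rank nu' <= dom_rank nu)%N -> nu = nu'.
Proof.
move=> D le; have /leqif_sum L : forall k : 'I_N.+1, xpredT k ->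
    (prefix nu k <= prefix nu' k ?= iff (prefix nu k == prefix nu' k))%N.
  by move=> k _; split.
have : dom_rank nu == dom_rank nu' by rewrite eqn_leq le dominated_rank.
rewrite L => /forallP e; apply: prefix_inj => k kN.
by move: kN; rewrite -ltnS => kN; have /eqP := e (Ordinal kN).
Qed.

Lemma sort_composition nu : (\sum_i nu i = d)%N ->
  exists la (p : 'S_N), (nrows la <= N)%N /\ nu = [ffun i => shape la (p i)].
Proof.
move=> sumnu; pose vs := [tuple nat_of_ord (nu i) | i < N].
have tr : transitive geq by move=> x y z /= yx xz; exact: leq_trans xz yx.
have rf : reflexive geq by move=> x /=; exact: leqnn.
have so : sorted geq (sort geq vs) by apply: sort_sorted => x y; exact: leq_total.
have /tuple_permP[p ep] : perm_eq vs (sort_tuple geq vs) by rewrite perm_sym perm_sort.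
pose r i := nth 0%N (sort geq vs) i.
have szs : size (sort geq vs) = N by rewrite size_sort size_tuple.
have sums : sumn (sort geq vs) = d.
  rewrite (perm_sumn (s2 := vs)) ?perm_sort // sumnE big_map -[RHS]sumnu.
  by rewrite big_enum.
have r_anti i j : (i <= j)%N -> (r j <= r i)%N.
  move=> ij; have [jN|Nj] := ltnP j N; last by rewrite /r [X in (X <= _)%N]nth_default ?szs.
  have /(_ i j) := sorted_leq_nth tr rf 0%N so; apply => //; rewrite inE szs //.
  exact: leq_ltn_trans ij jN.
have sumr n : (\sum_(i < n) r i <= d)%N.
  rewrite -sums sumnE (big_nth 0%N) szs big_mkord -/r.
  have [nN|Nn] := leqP n N.
    by rewrite (big_ord_widen _ r nN) [leqLHS]big_mkcond leq_sum // => i _; case: ifP.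
  rewrite (big_ord_widen _ r (ltnW Nn)) [leqRHS]big_mkcond leq_sum // => i _.
  by case: ifPn => //; rewrite -leqNgt => Ni; rewrite /r nth_default ?szs.
(* Otherwise [r 0], ..., [r d] would be [d + 1] positive terms of a sum bounded by [d]. *)
have r_d i : (d <= i)%N -> r i = 0%N.
  move=> di; apply/eqP; rewrite eqn0Ngt; apply/negP => ri.
  have := sumr d.+1; rewrite leqNgt => /negP; apply.
  rewrite -{1}[d.+1]card_ord -sum1_card; apply: leq_sum => k _.
  by apply: leq_trans (r_anti k d _); [apply: leq_trans ri (r_anti _ _ di) | rewrite -ltnS].
have r_le i : (r i < d.+1)%N.
  by rewrite ltnS; apply: leq_trans (sumr i.+1); rewrite big_ord_recr /= leq_addl.
pose t := [tuple inord (r i) : 'I_d.+1 | i < d].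
have mapt : map val t = mkseq r d.
  rewrite /t /= -map_comp /mkseq -val_enum_ord -map_comp; apply: eq_map => i /=.
  by rewrite inordK.
have Y : is_young t.
  rewrite /is_young mapt; apply/andP; split.
    apply/(sortedP 0%N) => i; rewrite size_mkseq => id.
    by rewrite !nth_mkseq ?(ltnW id) //= r_anti.
  rewrite sumnE big_map -{1}[d]subn0 -/(index_iota 0 d) big_mkord eqn_leq sumr /=.
  rewrite -[leqLHS]sums sumnE (big_nth 0%N) szs big_mkord -/r.
  have [nN|Nn] := leqP d N.
    rewrite (big_ord_widen _ r nN) [leqRHS]big_mkcond leq_sum // => i _.
    by case: ifPn => //; rewrite -leqNgt => /r_d; rewrite /r => ->.
  by rewrite (big_ord_widen _ r (ltnW Nn)) [leqLHS]big_mkcond leq_sum // => i _; case: ifP.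
have rlE i : row_len (Young Y) i = r i.
  rewrite /row_len /rows /= mapt; have [id|di] := ltnP i d; first by rewrite nth_mkseq.
  by rewrite nth_default ?size_mkseq // r_d.
exists (Young Y), p; split.
  rewrite leqNgt ltn_nrows rlE; apply/negP; by rewrite /r nth_default ?szs.
apply/ffunP => i; rewrite ffunE; apply: val_inj; rewrite /= shapeE rlE.
have ep' : vs = [tuple tnth (sort_tuple geq vs) (p j) | j < N] by exact: val_inj.
by have := congr1 (fun s => tnth s i) ep'; rewrite !tnth_mktuple (tnth_nth 0%N).
Qed.

End Contents.

Section WeightSpaces.
Variables (R : realType) (N d : nat).
Local Notation C := R[i].
Local Notation tpos := {ffun 'I_d -> 'I_N}.
Local Notation comp := {ffun 'I_N -> 'I_d.+1}.
Implicit Types (f h : tpos) (nu : comp) (la mu : young d).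
Local Notation P := (place_perm C N).
Local Notation T := 'M[C]_#|{: tpos}|.

Definition equivariant (X : T) := forall s : 'S_d, X *m P s = P s *m X.

Lemma equivariant_tens_sym X la : equivariant X -> X *m tens_sym R N la = tens_sym R N la *m X.
Proof.
move=> eX; rewrite /tens_sym symmetrizerE mulmx_sumr mulmx_suml.
by apply: eq_bigr => s _; rewrite -scalemxAr -scalemxAl /= eX.
Qed.

Lemma equivariant_tens (g : 'M[C]_N) : equivariant (tens d g).
Proof. by move=> s; exact: tens_place_permC. Qed.

Definition wt nu : T := ker_mx (fun f h : tpos => ((f == h) && (content f == nu))%:R).

Lemma wt_mulE nu (A : T) f h :
  (wt nu *m A) (enum_rank f) (enum_rank h) = (content f == nu)%:R * A (enum_rank f) (enum_rank h).
Proof.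
rewrite mxE sum_enum_rank (bigD1 f) //= ker_mxE eqxx /= big1 ?addr0 // => u.
by rewrite ker_mxE eq_sym => /negPf ->; rewrite mul0r.
Qed.

Lemma wt_idem nu : wt nu *m wt nu = wt nu.
Proof.
rewrite [LHS]ker_mx_eta [RHS]ker_mx_eta; apply: eq_ker_mx => f h; rewrite wt_mulE !ker_mxE.
by rewrite -natrM mulnb andbCA andbb.
Qed.

Lemma equivariant_wt nu : equivariant (wt nu).
Proof.
move=> s; apply: place_permC => f h; rewrite content_perm; congr (_ && _)%:R.
apply/eqP/eqP => [/ffunP e|-> //]; apply/ffunP => k.
by have := e (s^-1%g k); rewrite !ffunE permKV.
Qed.

Lemma place_perm_mulE (s : 'S_d) (A : T) f h :
  (P s *m A) (enum_rank [ffun k => f (s k)]) (enum_rank h) = A (enum_rank f) (enum_rank h).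
Proof.
rewrite mxE sum_enum_rank (bigD1 f) //= ker_mxE eqxx mul1r big1 ?addr0 // => u ne.
rewrite ker_mxE; case: eqP => [/ffunP e|]; last by rewrite mul0r.
case/eqP: ne; apply/ffunP => k; have := e (s^-1%g k); by rewrite !ffunE permKV.
Qed.

Variable la : young d.
Local Notation Cm := (col_sum (box_col la) (place_repr C N d)).
Local Notation Rm := (row_sum (box_row la) (place_repr C N d)).
Local Notation E := (tens_sym R N la).
Local Notation kappa := (@sym_kappa C d (box_row la) (box_col la)).

Lemma col_sum_perm f h (u : 'S_d) : u \in col_stab (box_col la) ->
  Cm (enum_rank [ffun k => f (u k)]) (enum_rank h) =
  (-1) ^+ odd_perm u * Cm (enum_rank f) (enum_rank h).
Proof.
move=> uC; have := place_perm_mulE u Cm f h.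
rewrite (_ : P u *m Cm = (-1) ^+ odd_perm u *: Cm); last first.
  exact: (col_sum_mull (place_repr C N d) uC).
by rewrite mxE => <-; rewrite mulrA -signr_addb addbb mul1r.
Qed.

Lemma col_sum_vanish f h i j : i != j -> box_col la i = box_col la j -> f i = f j ->
  Cm (enum_rank f) (enum_rank h) = 0.
Proof.
move=> ij cij fij.
have tC : tperm i j \in col_stab (box_col la).
  by apply/col_stabP => k; case: tpermP => [->|->|].
have := col_sum_perm f h tC; have -> : [ffun k => f (tperm i j k)] = f.
  by apply/ffunP => k; rewrite ffunE; case: tpermP => [->|->|].
rewrite odd_tperm ij expr1 mulN1r => /eqP; rewrite -addr_eq0 -mulr2n -mulr_natr.
by rewrite mulf_eq0 pnatr_eq0 orbF => /eqP.
Qed.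

Lemma col_sum_injective f h : Cm (enum_rank f) (enum_rank h) != 0 ->
  forall i j, box_col la i = box_col la j -> f i = f j :> nat -> i = j.
Proof.
move=> nz i j cij /val_inj fij; apply/eqP; apply: contraNT nz => ij.
by apply/eqP; apply: col_sum_vanish ij cij fij.
Qed.

Hypothesis laN : (nrows la <= N)%N.

Lemma wt_tens_sym_row nu : wt nu *m E = Rm *m (wt nu *m Cm).
Proof.
rewrite /tens_sym /symmetrizer !mulmxA; congr (_ *m _).
rewrite /row_sum mulmx_sumr mulmx_suml; apply: eq_bigr => s _; exact: equivariant_wt.
Qed.

(** A nonzero entry provides a filling of content [nu] that is injective on columns, and
    [column_injective_dominated] bounds its content. *)
Lemma wt_tens_sym_dominated nu : wt nu *m E != 0 -> dominated nu (shape N la).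
Proof.
rewrite wt_tens_sym_row => nz.
have [f [h]] : exists f h, (wt nu *m Cm) (enum_rank f) (enum_rank h) != 0.
  apply: contrapT => N0; move/eqP: nz; apply.
  suff -> : wt nu *m Cm = 0 by rewrite mulmx0.
  rewrite [LHS]ker_mx_eta; apply/matrixP => i j; rewrite [LHS]mxE [RHS]mxE.
  by apply/eqP; apply: contrapT => /negP nz; apply: N0; exists (enum_val i), (enum_val j).
rewrite wt_mulE; have [<-|_] := eqVneq (content f) nu; last by rewrite mul0r eqxx.
rewrite mul1r => /col_sum_injective finj k.
rewrite prefix_content prefix_shape //.
exact: (column_injective_dominated (@box_down d la) (f := fun b => f b)).
Qed.

Variable f0 : tpos.
Hypothesis f0la : row_filling la f0.

Let f0E b : f0 b = box_row la b :> nat. Proof. by move/forallP: f0la => /(_ b)/eqP. Qed.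

Lemma col_sum_row_filling : Cm (enum_rank f0) (enum_rank f0) = 1.
Proof.
rewrite /col_sum summxE (bigD1 1%g) /=; last exact: (group1 (cstab _)).
rewrite mxE odd_perm1 mul1r ker_mxE big1 ?addr0 => [|u /andP[uC u1]].
  by rewrite (_ : [ffun k => _] = f0) ?eqxx //; apply/ffunP => k; rewrite ffunE perm1.
rewrite mxE ker_mxE; case: eqP => [/ffunP e|]; last by rewrite mulr0.
case/eqP: u1; apply: (row_col_stab1 (@box_inj d la)) => //.
by apply/row_stabP => k; rewrite -!f0E; have := e k; rewrite ffunE => <-.
Qed.

(* On the weight space of [la] the column symmetrizer has rank one: up to sign,
   every non-vanishing row is the row of the superstandard filling [f0]. *)
Lemma wt_col_sum_rank1 :
  wt (shape N la) *m Cm = col (enum_rank f0) (wt (shape N la) *m Cm) *m row (enum_rank f0) Cm.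
Proof.
rewrite [LHS]ker_mx_eta [RHS]ker_mx_eta; apply: eq_ker_mx => f h.
rewrite [RHS]mxE big_ord1 [col _ _ _ _]mxE [row _ _ _ _]mxE !wt_mulE.
case: eqP => [cf|]; last by rewrite !mul0r.
rewrite !mul1r.
have [[i [j [ij cij fij]]]|inj] :=
    pselect (exists i j, [/\ i != j, box_col la i = box_col la j & f i = f j]).
  by rewrite !(col_sum_vanish _ ij cij fij) mul0r.
have finj i j : box_col la i = box_col la j -> f i = f j :> nat -> i = j.
  move=> cij /val_inj fij; apply/eqP; case: (boolP (i == j)) => // ij.
  by case: inj; exists i, j.
have [k|u uC fu] := column_injective_same_content (@box_down d la) finj.
  by rewrite -prefix_content cf prefix_shape.
have -> : f = [ffun k => f0 (u k)].
  by apply/ffunP => k; apply: val_inj; rewrite ffunE /= fu f0E.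
by rewrite !(col_sum_perm _ _ uC) col_sum_row_filling mulr1.
Qed.

Lemma wt_tens_sym_rank1 : exists (a : 'cV[C]_#|{: tpos}|) (b : 'rV[C]_#|{: tpos}|),
  wt (shape N la) *m E = a *m b.
Proof.
rewrite wt_tens_sym_row wt_col_sum_rank1 mulmxA.
by eexists; eexists; reflexivity.
Qed.

(** The diagonal entry at [f0] is the order of the row group: row permutations fix the tensor [f0],
    and the column sum has entry 1 there. *)
Lemma wt_tens_sym_neq0 : wt (shape N la) *m E != 0.
Proof.
apply/eqP => /(congr1 (fun A : T => A (enum_rank f0) (enum_rank f0))).
rewrite wt_mulE (content_row_filling f0la) eqxx mul1r [RHS]mxE /tens_sym /symmetrizer => /eqP.
rewrite mxE sum_enum_rank (bigD1 f0) //= col_sum_row_filling mulr1.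
have RE h : Rm (enum_rank f0) (enum_rank h) = (h == f0)%:R * #|row_stab (box_row la)|%:R.
  rewrite /row_sum summxE mulr_natr -sumr_const; apply: eq_bigr => s sR.
  rewrite ker_mxE; congr (_ : bool)%:R; apply/eqP/eqP => [/ffunP e|->].
    apply/ffunP => k; have := e (s^-1%g k); rewrite ffunE permKV => <-.
    apply: val_inj; rewrite /= !f0E; apply/row_stabP.
    by rewrite (groupV (rstab _)).
  by apply/ffunP => k; rewrite ffunE; apply: val_inj; rewrite /= !f0E; apply/esym/row_stabP.
rewrite RE eqxx mul1r big1 ?addr0 => [|h /negPf hf]; last by rewrite RE hf !mul0r.
by rewrite pnatr_eq0 eqn0Ngt (cardG_gt0 (rstab _)).
Qed.

(** A nonzero matrix of rank one whose square is [kappa] times itself has trace [kappa]. *)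
Lemma trace_wt_tens_sym : \tr (wt (shape N la) *m E) = kappa.
Proof.
have [a [b ab]] := wt_tens_sym_rank1.
have EE : E *m E = kappa *: E by exact: (symmetrizer_sqr (@box_inj d la) (@box_down d la)).
have sq : (a *m b) *m (a *m b) = kappa *: (a *m b).
  rewrite -ab -mulmxA (mulmxA E) -(equivariant_tens_sym la (@equivariant_wt _)).
  by rewrite -mulmxA EE mulmxA wt_idem -scalemxAr mulmxA ?wt_idem // -scalemxAr.
have ab0 : a *m b != 0 by rewrite -ab wt_tens_sym_neq0.
have bE : b *m a = (b *m a) 0 0 *: 1%:M by rewrite {1}[b *m a]mx11_scalar scalemx1.
rewrite ab mxtrace_mulC bE mxtraceZ mxtrace1 mulr1.
apply/eqP; rewrite -subr_eq0; have := sq.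
rewrite -mulmxA (mulmxA b) bE -scalemxAl mul1mx -scalemxAr => /eqP.
by rewrite -subr_eq0 -scalerBl scaler_eq0 (negPf ab0) orbF -bE.
Qed.

End WeightSpaces.

(** * The span of the tensor powers of unitary matrices *)

Lemma digits_inj K n (u v : 'I_n -> nat) :
    (forall i, (u i < K)%N) -> (forall i, (v i < K)%N) ->
  (\sum_i u i * K ^ i = \sum_i v i * K ^ i)%N -> u =1 v.
Proof.
elim: n u v => [|n IH] u v uK vK; first by move=> _ [].
rewrite !big_ord_recl /= !expn0 !muln1.
have shift w : (\sum_(i < n) w (lift ord0 i) * K ^ bump 0 i =
    (\sum_(i < n) w (lift ord0 i) * K ^ i) * K)%N.
  by rewrite big_distrl; apply: eq_bigr => i _; rewrite /= -mulnA -expnSr.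
rewrite !shift => e.
have K0 : (0 < K)%N by apply: leq_ltn_trans (uK ord0).
have e0 : u ord0 = v ord0.
  have := congr1 (modn^~ K) e.
  by rewrite addnC modnMDl addnC modnMDl !modn_small.
have e1 : (\sum_(i < n) u (lift ord0 i) * K ^ i = \sum_(i < n) v (lift ord0 i) * K ^ i)%N.
  by move: e; rewrite e0 => /addnI /eqP; rewrite eqn_pmul2r // => /eqP.
move=> i; case: (unliftP ord0 i) => [j|] -> //.
exact: (IH (fun j => u (lift ord0 j)) (fun j => v (lift ord0 j)) _ _ e1).
Qed.

(** * Independence of monomials on the torus *)

Section MonomialIndependence.
Variable C : numClosedFieldType.

(** The Cayley transform of [k]: infinitely many points of modulus one, obtained algebraically in
    any [numClosedFieldType]. *)
Definition circle_pt (k : nat) : C := (1 + 'i * k%:R) / (1 - 'i * k%:R).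

Lemma circle_den_neq0 k : 1 - 'i * k%:R != 0 :> C.
Proof.
apply/eqP => e; have : (1 - 'i * k%:R) * (1 + 'i * k%:R) = (1 + k * k)%:R :> C.
  by rewrite -subr_sqr expr1n exprMn sqrCi mulN1r opprK natrD natrM expr2.
by rewrite e mul0r => /esym/eqP; rewrite pnatr_eq0.
Qed.

Lemma norm_circle_pt k : `|circle_pt k| = 1.
Proof.
have cd : (1 - 'i * k%:R : C)^* = 1 + 'i * k%:R.
  by rewrite rmorphB rmorph1 rmorphM /= conjCi conjC_nat mulNr opprK.
rewrite /circle_pt normf_div -cd norm_conjC divff // normr_eq0; exact: circle_den_neq0.
Qed.

Lemma circle_pt_inj : injective circle_pt.
Proof.
move=> k l /eqP; rewrite /circle_pt eqr_div ?circle_den_neq0 // -subr_eq0.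
have -> : (1 + 'i * k%:R) * (1 - 'i * l%:R) - (1 + 'i * l%:R) * (1 - 'i * k%:R) =
   'i * 2%:R * (k%:R - l%:R) :> C by ring.
rewrite !mulf_eq0 (negPf (neq0Ci C)) pnatr_eq0 /= subr_eq0 eqr_nat.
by move/eqP.
Qed.

Lemma poly_circle_eq0 (p : {poly C}) : (forall z, `|z| = 1 -> p.[z] = 0) -> p = 0.
Proof.
move=> pz; apply/eqP; apply: contraT => p0.
have := max_poly_roots p0 (rs := [seq circle_pt k | k <- iota 0 (size p)]).
rewrite size_map size_iota ltnn; apply.
  by apply/allP => z /mapP[k _ ->]; apply/eqP/pz/norm_circle_pt.
by rewrite map_inj_uniq ?iota_uniq //; exact: circle_pt_inj.
Qed.

(* Kronecker substitution: [x i = z ^+ (K ^ i)] turns distinct monomials into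
   distinct powers of [z]. *)
Lemma monomial_independence (I : finType) K (F : {ffun I -> 'I_K} -> C) :
    (forall x : I -> C, (forall i, `|x i| = 1) -> \sum_nu F nu * \prod_i x i ^+ nu i = 0) ->
  forall nu, F nu = 0.
Proof.
move=> F0 nu0.
pose e (nu : {ffun I -> 'I_K}) := (\sum_(j < #|I|) nu (enum_val j) * K ^ j)%N.
have e_inj : injective e.
  move=> nu nu' /digits_inj H; apply/ffunP => i; apply: val_inj.
  by have := H (fun j => ltn_ord _) (fun j => ltn_ord _) (enum_rank i); rewrite enum_rankK.
pose p : {poly C} := \sum_nu F nu *: 'X^(e nu).
have p0 : p = 0.
  apply: poly_circle_eq0 => z z1.
  rewrite -[RHS](F0 (fun i => z ^+ (K ^ enum_rank i))) => [|i]; last by rewrite normrX z1 expr1n.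
  rewrite horner_sum; apply: eq_bigr => nu _; rewrite hornerZ hornerXn; congr (_ * _).
  rewrite /e -prodrXr; rewrite [RHS](reindex (@enum_val I I)) /=; last first.
    exact: onW_bij (@enum_val_bij I).
  by apply: eq_bigr => j _; rewrite enum_valK mulnC exprM.
have := congr1 (fun q : {poly C} => q`_(e nu0)) p0.
rewrite coef0 coef_sum (bigD1 nu0) //= coefZ coefXn eqxx mulr1 big1 ?addr0 // => nu ne.
by rewrite coefZ coefXn (inj_eq e_inj) eq_sym (negPf ne) mulr0.
Qed.

End MonomialIndependence.

(** * Spans and linear forms *)

Section SpanDuality.
Variables (K : fieldType) (V : vectType K) (P : V -> Prop).

(** [P] may hold for infinitely many vectors. A finite family is enlarged as long as its span misses
    one of them, and the codimension bounds the number of enlargements. *)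
Lemma spanning_seq : exists2 X : seq V,
  (forall y, y \in X -> P y) & (forall y, P y -> y \in <<X>>%VS).
Proof.
suff H n : forall X : seq V, (forall y, y \in X -> P y) -> (\dim {:V} - \dim <<X>> <= n)%N ->
    exists2 X : seq V, (forall y, y \in X -> P y) & (forall y, P y -> y \in <<X>>%VS).
  by apply: (H _ [::] _ (leqnn _)).
elim: n => [|n IH] X sP dn.
  exists X => // y _; suff -> : <<X>>%VS = fullv by exact: memvf.
  by apply/eqP; rewrite eqEdim subvf -subn_eq0 -leqn0.
have [H|/existsNP[y /not_implyP[Py ys]]] := pselect (forall y, P y -> y \in <<X>>%VS).
  by exists X.
apply: (IH (y :: X)) => [z|]; first by rewrite inE => /orP[/eqP ->|/sP].
have lt : (\dim <<X>> < \dim <<(y :: X)>>)%N.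
  rewrite ltnNge; apply/negP => le; apply: ys.
  have /eqP -> : <<X>>%VS == <<(y :: X)>>%VS.
    by rewrite eqEdim le andbT; apply: sub_span => z zs; rewrite inE zs orbT.
  by rewrite memv_span // mem_head.
have := dimvS (subvf <<(y :: X)>>%VS); lia.
Qed.

(** The coordinates of [v - projv <<X>> v] are linear forms in [v] that vanish on [P], hence at
    [x]. *)
Lemma span_duality x :
    (forall phi : V -> K, (forall a u v, phi (a *: u + v) = a * phi u + phi v) ->
       (forall y, P y -> phi y = 0) -> phi x = 0) ->
  exists n (a : 'I_n -> K) (y : 'I_n -> V), (forall i, P (y i)) /\ x = \sum_i a i *: y i.
Proof.
move=> H; have [X sP sS] := spanning_seq.
have xs : x \in <<X>>%VS.
  pose b := vbasis {:V}.
  pose phi i (v : V) := coord b i (v - projv <<X>> v).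
  have phiL i a u v : phi i (a *: u + v) = a * phi i u + phi i v.
    rewrite /phi -linearP /=; congr (coord b i _).
    by rewrite linearP scalerBr addrACA opprD.
  have x0 i : phi i x = 0.
    apply: (H (phi i)) => [a u v|y /sS ys]; first exact: phiL.
    by rewrite /phi projv_id // subrr linear0.
  have : x - projv <<X>> x = 0.
    rewrite [LHS](coord_vbasis (memvf _)) big1 // => i _.
    by have := x0 i; rewrite /phi => ->; rewrite scale0r.
  by move/eqP; rewrite subr_eq0 => /eqP ->; exact: memv_proj.
exists (size X), (fun i => coord (in_tuple X) i x), (fun i => X`_i); split.
  by move=> i; apply: sP; exact: mem_nth.
by rewrite {1}(@coord_span _ _ _ (in_tuple X) x).
Qed.

End SpanDuality.

(** * Linear forms vanishing on the tensor powers of unitary matrices *)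

Section UnitarySpan.
Variables (R : realType) (N d : nat).
Local Notation C := R[i].
Local Notation tpos := {ffun 'I_d -> 'I_N}.
Local Open Scope sesquilinear_scope.
Local Notation T := 'M[C]_#|{: tpos}|.
Implicit Types (f h : tpos).

Variable phi : T -> C.
Hypothesis phiL : forall a u v, phi (a *: u + v) = a * phi u + phi v.
Hypothesis phiU : forall g : 'M[C]_N, g \is unitarymx -> phi (tens d g) = 0.

Let phi0 : phi 0 = 0.
Proof. by have := phiL (-1) 0 0; rewrite scaler0 addr0 mulN1r addNr. Qed.

Let phi_sum (I : finType) (a : I -> C) (u : I -> T) :
  phi (\sum_i a i *: u i) = \sum_i a i * phi (u i).
Proof.
elim/big_rec2: _ => [|i y1 y2 _ <-]; first exact: phi0.
by rewrite phiL.
Qed.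

Let unit_ker f h : T := ker_mx (fun u v => ((u == f) && (v == h))%:R).
Let L f h : C := phi (unit_ker f h).

Let phi_ker (K : tpos -> tpos -> C) : phi (ker_mx K) = \sum_(f : tpos) \sum_(h : tpos) K f h * L f h.
Proof.
have -> : ker_mx K = \sum_(p : tpos * tpos) K p.1 p.2 *: unit_ker p.1 p.2.
  apply/matrixP => i j; rewrite summxE (bigD1 (enum_val i, enum_val j)) //= !mxE !eqxx mulr1.
  rewrite big1 ?addr0 // => -[f h] /= ne; rewrite !mxE; case: andP => [[/eqP e1 /eqP e2]|].
    by rewrite e1 e2 eqxx in ne.
  by rewrite mulr0.
by rewrite phi_sum pair_big.
Qed.

Lemma tens_diag_wt (x : 'rV[C]_N) :
  tens d (diag_mx x) = \sum_(nu : {ffun 'I_N -> 'I_d.+1}) (\prod_i x 0 i ^+ nu i) *: wt R nu.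
Proof.
apply/matrixP => i j; rewrite summxE (bigD1 (content (enum_val i))) //= !mxE.
rewrite eqxx andbT [X in _ + X]big1 ?addr0 => [|nu ne]; last first.
  by rewrite !mxE [content _ == _]eq_sym (negPf ne) andbF mulr0.
case: eqP => [->|ne].
  rewrite mulr1 -(prod_content _ (fun i => x 0 i)).
  by apply: eq_bigr => k _; rewrite mxE eqxx.
have [k fk] : exists k, enum_val i k != enum_val j k.
  apply/existsP; rewrite -negb_forall; apply/negP => /forallP fh; apply: ne.
  by apply/ffunP => k; apply/eqP.
by rewrite mulr0 (bigD1 k) //= mxE (negPf fk) mul0r.
Qed.

(** For fixed [v] this is a polynomial in [x] that vanishes on the torus, so its coefficients vanish
    and [x] may be arbitrary. *)
Lemma span_conj_diag (v : 'M[C]_N) (x : 'rV[C]_N) : v \is unitarymx ->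
  phi (tens d (invmx v *m diag_mx x *m v)) = 0.
Proof.
move=> vU; pose F nu := phi (tens d (invmx v) *m wt R nu *m tens d v).
have FE (y : 'rV[C]_N) : phi (tens d (invmx v *m diag_mx y *m v)) =
    \sum_nu F nu * \prod_i y 0 i ^+ nu i.
  rewrite !tensM tens_diag_wt mulmx_sumr mulmx_suml.
  under eq_bigr => nu _ do rewrite -scalemxAr -scalemxAl.
  by rewrite phi_sum; apply: eq_bigr => nu _; rewrite mulrC.
rewrite FE big1 // => nu _; rewrite (@monomial_independence _ _ _ F) ?mul0r // => y y1.
have := FE (\row_i y i); under [in RHS]eq_bigr => mu _.
  under eq_bigr => i _ do rewrite mxE.
  over.
by move=> <-; apply: phiU; apply: conj_diag_unitary => // i; rewrite mxE.
Qed.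

Lemma span_hermitian (H : 'M[C]_N) : H \is hermsymmx -> phi (tens d H) = 0.
Proof.
move=> /hermitian_normalmx /orthomx_spectralP ->; apply: span_conj_diag.
exact: spectral_unitarymx.
Qed.

Let phi_tens A : phi (tens d A) = \sum_(f : tpos) \sum_(h : tpos) (\prod_k A (f k) (h k)) * L f h.
Proof. exact: phi_ker. Qed.

(* [A = H1 + 'i H2] with [H1], [H2] hermitian, and a polynomial in [y] that
   vanishes at [H1 + y H2] for all real [y] also vanishes for [y = 'i]. *)
Lemma span_all (A : 'M[C]_N) : phi (tens d A) = 0.
Proof.
pose H1 : 'M[C]_N := 2^-1 *: (A + A ^t*).
pose H2 : 'M[C]_N := (2^-1 * - 'i) *: (A - A ^t*).
have herm (B : 'M[C]_N) : B ^t* = B -> B \is hermsymmx.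
  by move=> e; apply/is_hermitianmxP; rewrite expr0 scale1r e.
have starE (B : 'M[C]_N) i j : (B ^t*) i j = (B j i)^* by rewrite !mxE.
have hermD (B1 B2 : 'M[C]_N) n : B1 ^t* = B1 -> B2 ^t* = B2 -> (B1 + n%:R *: B2) ^t* = B1 + n%:R *: B2.
  move=> e1 e2; apply/matrixP => i j; rewrite starE !mxE rmorphD rmorphM /= conjC_nat.
  by rewrite -!starE e1 e2.
have H1s : H1 ^t* = H1.
  apply/matrixP => i j; rewrite starE !mxE rmorphM rmorphD /= conjCK fmorphV /= conjC_nat.
  by rewrite [X in _ * X]addrC.
have H2s : H2 ^t* = H2.
  apply/matrixP => i j; rewrite starE !mxE !rmorphM rmorphB rmorphN /= conjCK fmorphV /= conjC_nat conjCi.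
  ring.
have AE : A = H1 + 'i *: H2.
  apply/matrixP => i j; rewrite !mxE; have := sqrCi C; have : 2 != 0 :> C by rewrite pnatr_eq0.
  move: (A i j) ((A j i)^*) => a b two ii.
  have -> : 'i * (2^-1 * - 'i * (a - b)) = - ('i ^+ 2) * (2^-1 * (a - b)) :> C by ring.
  by rewrite ii; field.
pose p : {poly C} := \sum_(f : tpos) \sum_(h : tpos)
  (\prod_k ((H1 (f k) (h k))%:P + (H2 (f k) (h k))%:P * 'X)) * (L f h)%:P.
have pE y : p.[y] = phi (tens d (H1 + y *: H2)).
  rewrite phi_tens horner_sum; apply: eq_bigr => f _; rewrite horner_sum; apply: eq_bigr => h _.
  rewrite hornerM hornerC horner_prod; congr (_ * _); apply: eq_bigr => k _.
  by rewrite horner_affine [RHS]mxE; congr (_ + _); rewrite [RHS]mxE.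
have p0 : p = 0.
  apply/eqP; apply: contraT => pn0.
  have := max_poly_roots pn0 (rs := [seq n%:R | n <- iota 0 (size p)]).
  rewrite size_map size_iota ltnn; apply.
    apply/allP => z /mapP[n _ ->]; apply/eqP; rewrite pE; apply/span_hermitian/herm.
    exact: hermD.
  rewrite map_inj_uniq ?iota_uniq // => a b /eqP; by rewrite eqr_nat => /eqP.
by rewrite AE -pE p0 horner0.
Qed.

(** A kernel commuting with ['S_d] is constant on the pairs [(f, h)] of given joint content [c]. The
    sum [F c] of [L] over such pairs is a coefficient of [phi (tens d A)] as a polynomial in the
    entries of [A], and this polynomial vanishes. *)
Lemma span_equivariant (X : T) : equivariant X -> phi X = 0.
Proof.
move=> eX; rewrite [X]ker_mx_eta; set K := (K in ker_mx K).
have KE f h (s : 'S_d) : K [ffun k => f (s k)] [ffun k => h (s k)] = K f h.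
  have := place_perm_mulE (N := N) s X f h.
  rewrite -eX -/(K f h) => <-; rewrite mxE sum_enum_rank (bigD1 [ffun k => h (s k)]) //= ker_mxE eqxx mulr1.
  by rewrite big1 ?addr0 // => u ne; rewrite ker_mxE (negPf ne) mulr0.
pose zip f h : {ffun 'I_d -> 'I_N * 'I_N} := [ffun k => (f k, h k)].
pose F (c : {ffun 'I_N * 'I_N -> 'I_d.+1}) :=
   \sum_(p : tpos * tpos | content (zip p.1 p.2) == c) L p.1 p.2.
have F0 c : F c = 0.
  apply: (@monomial_independence C _ _ F) => x _ .
  have := span_all (\matrix_(i, j) x (i, j)); rewrite phi_tens pair_big /= => {2}<-.
  rewrite [RHS](partition_big (fun p => content (zip p.1 p.2)) xpredT) //=.
  apply: eq_bigr => nu _; rewrite mulrC mulr_sumr; apply: eq_bigr => -[f h] /= /eqP <-.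
  rewrite -(prod_content _ x); congr (_ * _).
  by apply: eq_bigr => k _; rewrite ffunE mxE.
rewrite phi_ker pair_big /= (partition_big (fun p => content (zip p.1 p.2)) xpredT) //=.
rewrite big1 // => c _.
have [[[f0 h0] /= c0]|none] := pselect (exists p : tpos * tpos, content (zip p.1 p.2) = c); last first.
  by rewrite big_pred0 // => p; apply/negP => /eqP e; apply: none; exists p.
rewrite (eq_bigr (fun p => K f0 h0 * L p.1 p.2)) => [|[f h] /= /eqP c1].
  by rewrite -mulr_sumr -/(F c) F0 mulr0.
have [s es] : exists s : 'S_d, zip f h = [ffun k => zip f0 h0 (s k)].
  by apply: content_eq_perm; rewrite c0 c1.
congr (_ * _); rewrite -(KE f0 h0 s); congr K; apply/ffunP => k.
  by have := congr1 (fun u : {ffun 'I_d -> 'I_N * 'I_N} => (u k).1) es; rewrite !ffunE.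
by have := congr1 (fun u : {ffun 'I_d -> 'I_N * 'I_N} => (u k).2) es; rewrite !ffunE.
Qed.

End UnitarySpan.

(* The commutant of the symmetric group on the tensor power is spanned by the
   tensor powers of unitary matrices. *)
Lemma equivariant_unitary_span (R : realType) (N d : nat)
    (X : 'M[R[i]]_#|{: {ffun 'I_d -> 'I_N}}|) : equivariant X ->
  exists n (a : 'I_n -> R[i]) (g : 'I_n -> 'M[R[i]]_N),
    (forall k, g k \is unitarymx) /\ X = \sum_k a k *: tens d (g k).
Proof.
move=> eX.
pose P (Y : 'M[R[i]]_#|{: {ffun 'I_d -> 'I_N}}|) :=
  exists2 g : 'M[R[i]]_N, g \is unitarymx & Y = tens d g.
have [|n [a [y [yP ->]]]] := @span_duality _ _ P X.
  move=> phi phiL phi0; apply: span_equivariant eX => // g gU.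
  by apply: phi0; exists g.
exists n, a, (fun k => projT1 (cid2 (yP k))); split.
  by move=> k; case: (cid2 (yP k)).
by apply: eq_bigr => k _; case: (cid2 (yP k)) => g _ /= ->.
Qed.

(** * Expansion of symmetric polynomials *)

Lemma symmetric_coefficients (C : numClosedFieldType) N K (F : {ffun 'I_N -> 'I_K} -> C) (p : 'S_N) :
    (forall x : 'I_N -> C, (forall i, `|x i| = 1) ->
       \sum_nu F nu * \prod_i x (p i) ^+ nu i = \sum_nu F nu * \prod_i x i ^+ nu i) ->
  forall nu : {ffun 'I_N -> 'I_K}, F [ffun i => nu (p i)] = F nu.
Proof.
move=> sym nu0; apply/eqP; rewrite -subr_eq0.
apply/eqP; apply: (@monomial_independence C _ _
  (fun nu : {ffun 'I_N -> 'I_K} => F [ffun i => nu (p i)] - F nu)) => x x1.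
under eq_bigr => nu _ do rewrite mulrBl.
rewrite sumrB; apply/eqP; rewrite subr_eq0 -(sym x x1); apply/eqP.
pose h (nu : {ffun 'I_N -> 'I_K}) : {ffun 'I_N -> 'I_K} := [ffun i => nu (p^-1%g i)].
rewrite (reindex h) /=; last first.
  exists (fun nu : {ffun 'I_N -> 'I_K} => [ffun i => nu (p i)]) => nu _; apply/ffunP => i;
    by rewrite !ffunE ?permK ?permKV.
apply: eq_bigr => nu _; congr (F _ * _).
  by apply/ffunP => i; rewrite !ffunE permK.
rewrite (reindex_inj (@perm_inj _ p)) /=; apply: eq_bigr => i _.
by rewrite ffunE permK.
Qed.

Section KostkaExpansion.
Variables (R : realType) (N d : nat).
Local Notation C := R[i].
Local Notation comp := {ffun 'I_N -> 'I_d.+1}.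
Implicit Types (nu : comp) (la mu : young d).

(** Up to the factor [kappa], the Kostka number of shape [la] and content [nu]. Dominance and the
    diagonal value [kappa] make the matrix [kost mu (shape N la)] triangular. *)
Definition kost la nu : C := \tr (wt R nu *m tens_sym R N la).

Lemma trace_diag_kost la (x : 'rV[C]_N) :
  \tr (tens d (diag_mx x) *m tens_sym R N la) = \sum_nu kost la nu * \prod_i x 0 i ^+ nu i.
Proof.
rewrite tens_diag_wt mulmx_suml linear_sum; apply: eq_bigr => nu _.
by rewrite -scalemxAl linearZ /= mulrC.
Qed.

(** The trace is a polynomial in the power sums of [x], hence symmetric, and so are its
    coefficients. *)
Lemma kost_perm la nu (p : 'S_N) : kost la [ffun i => nu (p i)] = kost la nu.
Proof.
apply: symmetric_coefficients => x _.
have E (y : 'I_N -> C) : \sum_nu kost la nu * \prod_i y i ^+ nu i =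
    \sum_s sym_coef C (box_row la) (box_col la) s * \prod_(X in porbits s) \sum_i y i ^+ #|X|.
  have := trace_diag_kost la (\row_i y i).
  under [in X in _ = X]eq_bigr => mu _ do under eq_bigr => i _ do rewrite mxE.
  move=> <-; rewrite /tens_sym symmetrizerE mulmx_sumr linear_sum; apply: eq_bigr => s _.
  rewrite -scalemxAr linearZ /= trace_tens_diag; congr (_ * _).
  by apply: eq_bigr => X _; apply: eq_bigr => i _; rewrite mxE.
rewrite (E (fun i => x (p i))) E; apply: eq_bigr => s _; congr (_ * _).
apply: eq_bigr => X _; by rewrite [RHS](reindex_inj (@perm_inj _ p)).
Qed.

Lemma kost_dominated la nu : (nrows la <= N)%N -> kost la nu != 0 -> dominated nu (shape N la).
Proof.
move=> laN nz; apply: (wt_tens_sym_dominated (R := R) laN); apply/eqP => e.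
by rewrite /kost e mxtrace0 eqxx in nz.
Qed.

Lemma kost_shape la : (nrows la <= N)%N ->
  kost la (shape N la) = sym_kappa C (box_row la) (box_col la).
Proof. by move=> laN; have [f0 f0la] := row_filling_exists laN; exact: trace_wt_tens_sym f0la. Qed.

(** Among the diagrams with [c la != 0] take one of maximal [dom_rank]: a nonzero
    [kost mu (shape N la)] puts [mu] above [la], so the equation at [la] reduces to its diagonal
    term. *)
Lemma kost_independence (c : young d -> C) :
    (forall la, (nrows la <= N)%N ->
       \sum_(mu : young d | (nrows mu <= N)%N) c mu * kost mu (shape N la) = 0) ->
  forall la, (nrows la <= N)%N -> c la = 0.
Proof.
move=> H la0 la0N; apply/eqP; apply: contraT => c0.
pose Q la := (nrows la <= N)%N && (c la != 0).
have Q0 : Q la0 by rewrite /Q la0N c0.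
have [la /andP[laN cla] lamax] := @arg_maxnP _ la0 Q (fun la => dom_rank (shape N la)) Q0.
have := H la laN; rewrite (bigD1 la) //= big1 ?addr0 => [|mu /andP[muN ne]].
  by move/eqP; rewrite mulf_eq0 (negPf cla) kost_shape // (negPf (kappa_neq0 _ _)).
have [->|cmu] := eqVneq (c mu) 0; first by rewrite mul0r.
have [->|kmu] := eqVneq (kost mu (shape N la)) 0; first by rewrite mulr0.
have D := kost_dominated muN kmu.
have := lamax mu; rewrite /Q muN cmu => /(_ isT) /(dominated_rank_eq D) /(shape_inj laN muN) e.
by rewrite e eqxx in ne.
Qed.

(** Independence makes the square matrix [M] invertible. The coefficients are solved for at dominant
    weights and carry over to all others by symmetry; weights of total other than [d] occur on
    neither side. *)
Lemma kost_expansion (F : comp -> C) :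
    (forall nu (p : 'S_N), F [ffun i => nu (p i)] = F nu) ->
    (forall nu, (\sum_i nu i)%N <> d -> F nu = 0) ->
  exists c : young d -> C, forall nu,
    F nu = \sum_(la : young d | (nrows la <= N)%N) c la * kost la nu.
Proof.
move=> Fsym Fd.
pose Y := {la : young d | (nrows la <= N)%N}.
have bigY (G : young d -> C) : \sum_(la : young d | (nrows la <= N)%N) G la = \sum_(y : Y) G (val y).
  by rewrite big_sub.
pose M : 'M[C]_#|{: Y}| := ker_mx (fun y z : Y => kost (val y) (shape N (val z))).
have Mu : M \in unitmx.
  rewrite -row_free_unit; apply/inj_row_free => v vM.
  pose c la := if insub la is Some y then v 0 (enum_rank (y : Y)) else 0.
  have cE (y : Y) : c (val y) = v 0 (enum_rank y) by rewrite /c valK.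
  have c0 : forall la, (nrows la <= N)%N -> c la = 0.
    apply: kost_independence => la laN; rewrite bigY.
    have := congr1 (fun w : 'rV[C]_#|{: Y}| => w 0 (enum_rank (Sub la laN : Y))) vM.
    rewrite [LHS]mxE [RHS]mxE sum_enum_rank => e; rewrite -[RHS]e; apply: eq_bigr => y _.
    by rewrite cE ker_mxE SubK.
  apply/rowP => i; rewrite mxE -(enum_valK i) -cE; apply: c0; exact: (valP (enum_val i)).
pose v := (\row_i F (shape N (val (enum_val i : Y)))) *m invmx M.
pose c la := if insub la is Some y then v 0 (enum_rank (y : Y)) else 0.
have cE (y : Y) : c (val y) = v 0 (enum_rank y) by rewrite /c valK.
exists c => nu.
have [nud|nud] := eqVneq (\sum_i nu i)%N d; last first.
  rewrite Fd; last exact/eqP.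
  rewrite big1 // => la laN; apply/eqP; rewrite mulf_eq0; apply/orP; right.
  apply: contraNT nud => nz.
  have nzw : wt R nu != 0 by apply: contraNneq nz => e; rewrite /kost e mul0mx mxtrace0.
  have [f <-] : exists f : {ffun 'I_d -> 'I_N}, content f = nu.
    apply: contrapT => none; case/eqP: nzw; apply/matrixP => i j; rewrite !mxE.
    case: andP => // -[_ /eqP e]; by case: none; exists (enum_val i).
  rewrite -[X in _ == X](card_ord d) -sum1_card (partition_big f xpredT) //=; apply/eqP.
  by apply: eq_bigr => i _; rewrite contentE -sum1_card; apply: eq_bigl => k; rewrite inE.
have [la [p [laN ->]]] := sort_composition nud.
rewrite Fsym (eq_bigr _ (fun mu _ => congr1 (fun z => c mu * z) (kost_perm mu _ p))) bigY.
have vM : v *m M = \row_i F (shape N (val (enum_val i : Y))) by rewrite mulmxKV.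
have := congr1 (fun w : 'rV[C]_#|{: Y}| => w 0 (enum_rank (Sub la laN : Y))) vM.
rewrite [LHS]mxE [RHS]mxE enum_rankK SubK => <-; rewrite sum_enum_rank; apply: eq_bigr => y _.
by rewrite cE ker_mxE SubK.
Qed.

End KostkaExpansion.

(** * Characters of the circle *)

Section CircleCharacters.
Variable R : realType.
Local Notation C := R[i].
Implicit Types (x y : R) (z w : C).
Local Open Scope complex_scope.

Definition cis x : C := cos x +i* sin x.

Lemma cisD x y : cis (x + y) = cis x * cis y.
Proof. by rewrite /cis cosD sinD; apply/eqP; rewrite eq_complex /= eqxx /= addrC. Qed.

Lemma cis0 : cis 0 = 1.
Proof. by rewrite /cis cos0 sin0. Qed.

Lemma norm_cis x : `|cis x| = 1.
Proof. by rewrite normc_def /= cos2Dsin2 sqrtr1. Qed.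

Lemma cis_neq0 x : cis x != 0.
Proof. by rewrite -normr_eq0 norm_cis oner_eq0. Qed.

Lemma cisMn x n : cis (x *+ n) = cis x ^+ n.
Proof. by elim: n => [|n IH]; rewrite ?cis0 // mulrS cisD IH exprS. Qed.

Lemma cis2pi n : cis (pi *+ 2 *+ n) = 1.
Proof. by rewrite cisMn /cis cos2pi sin2pi expr1n. Qed.

Lemma norm1_sqr z : `|z| = 1 -> complex.Re z ^+ 2 + complex.Im z ^+ 2 = 1.
Proof.
rewrite normc_def => /(congr1 (@complex.Re R)) /= /(congr1 (fun a => a ^+ 2)).
by rewrite sqr_sqrtr ?expr1n // addr_ge0 ?sqr_ge0.
Qed.

Lemma norm1_cis z : `|z| = 1 ->
  z = cis (acos (complex.Re z)) \/ z = cis (- acos (complex.Re z)).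
Proof.
move=> /norm1_sqr; case: z => a b /= ab.
have a1 : a ^+ 2 <= 1 by rewrite -ab lerDl sqr_ge0.
have a11 : -1 <= a <= 1
  by rewrite -ler_norml -(@ler_sqr R) ?nnegrE // ?normr_ge0 // real_normK ?num_real // expr1n.
have b2 : Num.sqrt (1 - a ^+ 2) = `|b| by rewrite -ab addrC addKr sqrtr_sqr.
rewrite /cis cosN sinN sin_acos // b2 acosK //.
by case: (ger0P b) => hb; [left|right]; rewrite ?opprK.
Qed.

Lemma norm1_cis_ge0 z : `|z| = 1 -> exists2 x, 0 <= x & z = cis x.
Proof.
move=> z1; have := norm1_sqr z1.
have a11 : -1 <= complex.Re z <= 1.
  rewrite -ler_norml -(@ler_sqr R) ?nnegrE // ?normr_ge0 // real_normK ?num_real // expr1n.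
  by rewrite -(norm1_sqr z1) lerDl sqr_ge0.
move=> _; case: (norm1_cis z1) => ->; first by exists (acos (complex.Re z)); rewrite ?acos_ge0.
exists (- acos (complex.Re z) + pi *+ 2).
  by rewrite addrC subr_ge0 (le_trans (acos_lepi a11)) // mulr2n lerDl pi_ge0.
by rewrite cisD -[pi *+ 2]mulr1n cis2pi mulr1.
Qed.

Lemma norm1_cis_half z : `|z| = 1 -> 0 < complex.Re z ->
  exists2 x, z = cis x & - (pi / 2) < x < pi / 2.
Proof.
move=> z1 z0.
have a11 : -1 <= complex.Re z <= 1.
  rewrite -ler_norml -(@ler_sqr R) ?nnegrE // ?normr_ge0 // real_normK ?num_real // expr1n.
  by rewrite -(norm1_sqr z1) lerDl sqr_ge0.
have h : acos (complex.Re z) < pi / 2.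
  rewrite ltNge; apply/negP => le.
  have : cos (acos (complex.Re z)) <= 0.
    rewrite -(@cos_pihalf R) leNgt ltr_cos ?in_itv /= ?acos_ge0 ?acos_lepi // -?leNgt //.
    by apply/andP; split; rewrite ?divr_ge0 ?pi_ge0 // ler_pdivrMr // ler_peMr ?pi_ge0 // ler1n.
  by rewrite acosK // leNgt z0.
have p2 : 0 < pi / 2 :> R by rewrite divr_gt0 ?pi_gt0.
case: (norm1_cis z1) => e; [exists (acos (complex.Re z))|exists (- acos (complex.Re z))] => //.
  by rewrite h andbT (lt_le_trans _ (acos_ge0 a11)) // oppr_lt0.
by rewrite ltrN2 h /= (le_lt_trans _ p2) // oppr_le0 acos_ge0.
Qed.

Lemma posC_real (e : C) : 0 < e -> exists2 r : R, 0 < r & e = r%:C.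
Proof. by case: e => a b; rewrite ltcE /= => /andP[/eqP -> a0]; exists a. Qed.

Lemma norm_complex_le z : `|z| <= (`|complex.Re z| + `|complex.Im z|)%:C.
Proof.
case: z => a b /=.
have -> : a +i* b = a%:C + (0 +i* b) by apply/eqP; rewrite eq_complex /= addr0 add0r !eqxx.
rewrite rmorphD /=; apply: le_trans (ler_normD _ _) _.
by rewrite !normc_def /= expr0n /= addr0 add0r !sqrtr_sqr.
Qed.

Lemma cis_near1 (e : C) : 0 < e -> exists2 r : R, 0 < r & forall x, `|x| < r -> `|cis x - 1| < e.
Proof.
move=> /posC_real[e' e0 ->]; have e2 : 0 < e' / 2 by rewrite divr_gt0.
have [r1 /= r10 H1] := (nbhs_ballP _ _).1 ((cvgrPdist_lt _ _).1 (@continuous_cos R 0) _ e2).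
have [r2 /= r20 H2] := (nbhs_ballP _ _).1 ((cvgrPdist_lt _ _).1 (@continuous_sin R 0) _ e2).
exists (Num.min r1 r2); first by rewrite lt_min r10 r20.
move=> x; rewrite lt_min => /andP[x1 x2].
apply: le_lt_trans (norm_complex_le _) _; rewrite /= ltcR [e']splitr.
apply: ltrD.
  have := H1 x; rewrite /ball /= sub0r normrN => /(_ x1).
  by rewrite cos0 distrC.
have := H2 x; rewrite /ball /= sub0r normrN => /(_ x2).
by rewrite sin0 sub0r normrN oppr0 addr0.
Qed.

Lemma dyadic_small (a r : R) : 0 < r -> exists j : nat, a / (2 ^ j)%:R < r.
Proof.
move=> r0; exists (Num.truncn (a / r)).+1.
rewrite ltr_pdivrMr ?ltr0n ?expn_gt0 // mulrC -ltr_pdivrMr //.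
have [ar|ar] := ltP (a / r) 0; first by apply: lt_trans ar _; rewrite ltr0n expn_gt0.
apply: lt_trans (truncnS_gt _) _; rewrite ltr_nat; exact: ltn_expl.
Qed.

Lemma dyadic_floor (x : R) j : 0 <= x -> exists p : nat, `|x - p%:R / (2 ^ j)%:R| <= 1 / (2 ^ j)%:R.
Proof.
move=> x0; have d0 : 0 < (2 ^ j)%:R :> R by rewrite ltr0n expn_gt0.
exists (Num.truncn (x * (2 ^ j)%:R)).
have /andP[l u] := truncn_itv (mulr_ge0 x0 (ltW d0)).
rewrite ger0_norm; last by rewrite subr_ge0 ler_pdivrMr.
by rewrite lerBlDr -mulrDl ler_pdivlMr // addrC -natr1 in u *; exact: ltW.
Qed.

(** The points [w] are dyadic rotations. Finite order matters because such torus elements act by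
    diagonalizable matrices. *)
Lemma circle_torsion_dense z (e : C) : `|z| = 1 -> 0 < e ->
  exists w m, [/\ (0 < m)%N, w ^+ m = 1, `|w| = 1 & `|z / w - 1| < e].
Proof.
move=> /norm1_cis_ge0[x x0 ->] /cis_near1[r r0 H].
pose y := x / (pi *+ 2).
have tp0 : 0 < pi *+ 2 :> R by rewrite mulr2n addr_gt0 ?pi_gt0.
have [j hj] := dyadic_small (pi *+ 2) r0.
have [|p hp] := dyadic_floor (x := y) j; first by rewrite divr_ge0 // ltW.
exists (cis (p%:R / (2 ^ j)%:R * (pi *+ 2))), (2 ^ j)%N; split; rewrite ?expn_gt0 ?norm_cis //.
  rewrite -cisMn -mulrnAl -[_ *+ (2 ^ j)]mulr_natr divfK ?pnatr_eq0 -?lt0n ?expn_gt0 //.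
  by rewrite mulr_natl cis2pi.
rewrite -{1}(subrK (p%:R / (2 ^ j)%:R * (pi *+ 2)) x) cisD mulfK ?cis_neq0 //.
apply: H; rewrite -{1}(divfK (lt0r_neq0 tp0) x) -/y -mulrBl normrM (gtr0_norm tp0).
apply: le_lt_trans _ hj; rewrite mulrC ler_pM2l //.
by move: hp; rewrite div1r.
Qed.

Section Character.
Variable chi : C -> C.
Hypothesis chiM : forall z w, `|z| = 1 -> `|w| = 1 -> chi (z * w) = chi z * chi w.
Hypothesis chi1 : chi 1 = 1.
Hypothesis chi_cont : forall e : C, 0 < e ->
  exists2 r : C, 0 < r & forall w, `|w| = 1 -> `|w - 1| < r -> `|chi w - 1| < e.

Let f x := chi (cis x).

Let fD x y : f (x + y) = f x * f y.
Proof. by rewrite /f cisD chiM ?norm_cis. Qed.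

Let f0 : f 0 = 1. Proof. by rewrite /f cis0. Qed.

Let fMn x n : f (x *+ n) = f x ^+ n.
Proof. by elim: n => [|n IH]; rewrite ?f0 // mulrS fD IH exprS. Qed.

Let f_cont (e : C) : 0 < e -> exists2 r : R, 0 < r & forall x, `|x| < r -> `|f x - 1| < e.
Proof.
move=> /chi_cont[s s0 Hs]; have [r r0 Hr] := cis_near1 s0.
by exists r => // x /Hr xs; apply: Hs => //; exact: norm_cis.
Qed.

Let tp : R := pi *+ 2.
Let tp0 : 0 < tp. Proof. by rewrite /tp mulr2n addr_gt0 ?pi_gt0. Qed.
Let pw0 j : 0 < (2 ^ j)%:R :> R. Proof. by rewrite ltr0n expn_gt0. Qed.

Let Re_pos z : `|z - 1| < 1 -> 0 < complex.Re z.
Proof.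
move=> z1; have : `|complex.Re (z - 1)| < 1.
  have := le_lt_trans (normc_ge_Re (z - 1)) z1.
  by rewrite ltcE /= eqxx.
case: z {z1} => a b /=; rewrite ltr_norml => /andP[h _].
by move: h; rewrite ltrBrDr addNr.
Qed.

(* On a small dyadic rotation [chi] has positive real part, so that successive
   square roots are determined and [chi] agrees with [cis (b x)] there. *)
Let f_dyadic : exists (b : R) (J : nat),
  forall j, f (tp / (2 ^ (J + j))%:R) = cis (b * (tp / (2 ^ (J + j))%:R)).
Proof.
have [r r0 Hr] := f_cont ltr01.
have [J hJ] := dyadic_small tp r0.
have small j : `|tp / (2 ^ (J + j))%:R| < r.
  rewrite ger0_norm ?divr_ge0 ?ltW //; apply: le_lt_trans hJ.
  by rewrite ler_pM2l // lef_pV2 ?posrE ?pw0 // ler_nat leq_pexp2l ?leq_addr.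
have rpos j : 0 < complex.Re (f (tp / (2 ^ (J + j))%:R)) by apply/Re_pos/Hr/small.
(* The modulus of [chi] is not given; at a dyadic rotation it is 1 because the value is a root of
   unity. *)
have tor : f (tp / (2 ^ J)%:R) ^+ (2 ^ J) = 1.
  rewrite -fMn -[_ *+ (2 ^ J)]mulr_natr divfK ?lt0r_neq0 //.
  by rewrite /f /tp -[pi *+ 2]mulr1n cis2pi chi1.
have n1 : `|f (tp / (2 ^ J)%:R)| = 1.
  have /eqP := congr1 Num.norm tor; rewrite normrX normr1 pexpr_eq1 ?expn_gt0 ?normr_ge0 //.
  by move/eqP.
have [a fa aP] := norm1_cis_half n1 (ltac:(by have := rpos 0%N; rewrite addn0)).
exists (a / (tp / (2 ^ J)%:R)), J.
have bE j : a / (tp / (2 ^ J)%:R) * (tp / (2 ^ (J + j))%:R) = a / (2 ^ j)%:R.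
  have := lt0r_neq0 tp0; have := lt0r_neq0 (pw0 J); have := lt0r_neq0 (pw0 j).
  rewrite expnD natrM; move: ((2 ^ J)%:R : R) ((2 ^ j)%:R : R) tp => A B c B0 A0 c0.
  by field; rewrite B0 A0 c0.
elim=> [|j IH]; first by rewrite bE addn0 fa expn0 divr1.
rewrite bE; rewrite bE in IH.
set u := f _; set v := cis _.
have dbl (c : R) : c / (2 ^ j.+1)%:R *+ 2 = c / (2 ^ j)%:R.
  rewrite expnS natrM -mulr_natr; have := lt0r_neq0 (pw0 j).
  by move: ((2 ^ j)%:R : R) => B B0; field.
have uv : u ^+ 2 = v ^+ 2.
  rewrite /u /v -fMn -cisMn dbl -IH; congr f.
  rewrite addnS expnS natrM -mulr_natr; have := lt0r_neq0 (pw0 (J + j)).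
  by move: ((2 ^ (J + j))%:R : R) => B B0; field.
have v0 : 0 < complex.Re v.
  rewrite /v /=; apply: cos_gt0_pihalf; case/andP: aP => l h.
  have p2 : 0 < pi / 2 :> R by rewrite divr_gt0 ?pi_gt0.
  have g1 : 1 <= (2 ^ j.+1)%:R :> R by rewrite ler1n expn_gt0.
  rewrite ltr_pdivlMr // ltr_pdivrMr //; apply/andP; split.
    by apply: le_lt_trans _ l; rewrite mulNr lerN2; apply: ler_peMr => //; exact: ltW.
  by apply: lt_le_trans h _; apply: ler_peMr => //; exact: ltW.
have u0 : 0 < complex.Re u by exact: rpos.
move/eqP: uv; rewrite eqf_sqr => /orP[/eqP //|/eqP e].
by move: u0; rewrite e; case: (v) v0 => c s /= c0; rewrite oppr_gt0 ltNge ltW.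
Qed.

(** Both sides agree at multiples of a dyadic angle [q], and on the remainder [s] both are within
    [e / 2] of 1. With [e] the distance between the two sides, this gives [e < e]. *)
Lemma circle_character_cis : exists b : R, forall x, 0 <= x -> f x = cis (b * x).
Proof.
have [b [J bJ]] := f_dyadic; exists b => x x0.
apply/eqP; rewrite -subr_eq0 -normr_eq0; apply/eqP.
apply: contrapT => /eqP; rewrite normr_eq0 -normr_gt0 => pos.
set e := `|_| in pos.
have e2 : 0 < e / 2 by rewrite divr_gt0.
have [r1 r10 H1] := f_cont e2; have [r2 r20 H2] := cis_near1 e2.
have [j1 hj1] := dyadic_small tp r10.
have [j2 hj2] := dyadic_small (tp * `|b|) r20.
pose j := (j1 + j2)%N.
pose q := tp / (2 ^ (J + j))%:R.
have q0 : 0 < q by rewrite divr_gt0.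
pose p := Num.truncn (x / q).
have /andP[pl pu] := truncn_itv (divr_ge0 x0 (ltW q0)).
pose s := x - q *+ p.
have s0 : 0 <= s by rewrite subr_ge0 -mulr_natl -ler_pdivlMr.
have sq : s <= q.
  by move: pu; rewrite ltr_pdivrMr // -/p -natr1 mulrDl mul1r mulr_natl => /ltW; rewrite lerBlDl.
have qj k : (k <= J + j)%N -> q <= tp / (2 ^ k)%:R.
  by move=> kj; rewrite ler_pM2l // lef_pV2 ?posrE ?pw0 // ler_nat leq_pexp2l.
have sm1 : `|s| < r1.
  rewrite ger0_norm //; apply: le_lt_trans sq _; apply: le_lt_trans hj1.
  by apply: qj; rewrite /j (leq_trans (leq_addr j2 j1)) // leq_addl.
have sm2 : `|b * s| < r2.
  rewrite normrM (ger0_norm s0); apply: le_lt_trans hj2.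
  rewrite mulrC mulrAC ler_wpM2r ?normr_ge0 //; apply: le_trans sq _.
  by apply: qj; rewrite /j (leq_trans (leq_addl j1 j2)) // leq_addl.
have xE : x = q *+ p + s by rewrite /s addrC subrK.
have : e < e.
  rewrite {1}/e xE fD mulrDr cisD fMn bJ -/q -cisMn -mulrnAr -mulrBr normrM norm_cis mul1r.
  have -> : f s - cis (b * s) = (f s - 1) - (cis (b * s) - 1) by rewrite opprB addrA subrK.
  apply: le_lt_trans (ler_normB _ _) _; rewrite [e]splitr.
  by apply: ltrD; [exact: H1 | exact: H2].
by rewrite ltxx.
Qed.

Lemma cis_2pi_int (b : R) : cis (b * tp) = 1 -> exists k : int, b = k%:~R.
Proof.
move=> b1; exists (Num.floor b).
have /andP[l u] := floor_itv b; pose r := b - (Num.floor b)%:~R.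
have r0 : 0 <= r by rewrite subr_ge0.
have r1 : r < 1 by rewrite ltrBlDl -intrD1 in u *.
have cis_int k : cis (k%:~R * tp) = 1.
  case: k => n; first by rewrite -pmulrn mulr_natl cis2pi.
  have := cisD ((Negz n)%:~R * tp) (n.+1%:R * tp).
  by rewrite -mulrDl NegzE mulrNz -pmulrn addNr mul0r cis0 mulr_natl cis2pi mulr1 => <-.
have : cis (r * tp) = 1.
  have := cisD (r * tp) ((Num.floor b)%:~R * tp).
  by rewrite -mulrDl subrK b1 cis_int mulr1 => <-.
rewrite /cis /tp mulrnAr => /eqP; rewrite eq_complex /= => /andP[/eqP c1 _].
have : sin (r * pi) ^+ 2 = 0.
  apply: (@mulfI _ 2); first by rewrite pnatr_eq0.
  move: c1; rewrite cos_mulr2n cos2sin2 mulr0 => c1.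
  by move: c1 => /eqP; rewrite mulrnBl; move/eqP; rewrite -[_ *+ 2]mulr_natl mulr1
    -[(sin _ ^+ 2) *+ 2]mulr_natl; lra.
move/eqP; rewrite sqrf_eq0 => s0; apply/eqP; rewrite -subr_eq0 -/r.
apply: contraTT s0 => rn; rewrite lt0r_neq0 // sin_gt0_pi //.
by rewrite mulr_gt0 ?pi_gt0 ?lt0r ?rn //= -[X in _ < X]mul1r ltr_pM2r ?pi_gt0.
Qed.

Lemma cis_int_exp x (k : int) : cis (k%:~R * x) = cis x ^ k.
Proof.
case: k => n; first by rewrite -pmulrn mulr_natl cisMn.
have := cisD ((Negz n)%:~R * x) (n.+1%:R * x).
rewrite -mulrDl NegzE mulrNz -pmulrn addNr mul0r cis0 mulr_natl cisMn => e.
by apply: (mulIf (expf_neq0 n.+1 (cis_neq0 x))); rewrite -e -exprnN mulVf ?expf_neq0 ?cis_neq0.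
Qed.

Theorem circle_character : exists k : int, forall z, `|z| = 1 -> chi z = z ^ k.
Proof.
have [b bP] := circle_character_cis.
have [k bk] : exists k : int, b = k%:~R.
  by apply: cis_2pi_int; rewrite -bP ?ltW // /f /tp -[pi *+ 2]mulr1n cis2pi.
exists k => z /norm1_cis_ge0[x x0 ->].
by rewrite -cis_int_exp -bk -bP.
Qed.

End Character.
End CircleCharacters.

(** * Burnside theorem *)

Section Burnside.
Variables (K : numClosedFieldType) (n : nat) (B : 'M[K]_n -> Prop).
Hypothesis n_gt0 : (0 < n)%N.
Hypothesis B1 : B 1%:M.
Hypothesis BM : forall X Y, B X -> B Y -> B (X *m Y).
Hypothesis BL : forall a X Y, B X -> B Y -> B (a *: X + Y).
Hypothesis Birr : forall S : {vspace 'cV[K]_n},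
  (forall X v, B X -> v \in S -> X *m v \in S) -> S = 0%VS \/ S = fullv.

Let B0 : B 0.
Proof. by have := BL (-1) B1 B1; rewrite scaleN1r addNr. Qed.

Let Bsum (I : finType) (a : I -> K) (X : I -> 'M[K]_n) :
  (forall i, B (X i)) -> B (\sum_i a i *: X i).
Proof. by move=> BX; elim/big_rec: _ => // i x _ Bx; apply: BL. Qed.

Lemma orbit_full (v w : 'cV[K]_n) : v != 0 -> exists2 X, B X & X *m v = w.
Proof.
move=> v0; pose P u := exists2 X, B X & X *m v = u.
have [X XP PX] := spanning_seq P.
have spanP u : u \in <<X>>%VS -> P u.
  move=> /(@coord_span _ _ _ (in_tuple X)) ->.
  have Y (i : 'I_(size X)) : {Y : 'M[K]_n | B Y & Y *m v = X`_i}.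
    by apply: cid2; have := XP _ (mem_nth 0 (ltn_ord i)).
  exists (\sum_i coord (in_tuple X) i u *: s2val (Y i)).
    by apply: Bsum => i; exact: s2valP.
  by rewrite mulmx_suml; apply: eq_bigr => i _; rewrite -scalemxAl (s2valP' (Y i)).
have [|e|e] := Birr (S := <<X>>%VS).
- move=> Y u BY /spanP[Z BZ <-]; apply: PX; exists (Y *m Z); rewrite ?mulmxA //; exact: BM.
- have : v \in <<X>>%VS by apply: PX; exists 1%:M; rewrite ?mul1mx.
  by rewrite e memv0 (negPf v0).
- by apply: spanP; rewrite e memvf.
Qed.

(** By duality: a linear form vanishing on all [v *m X] is a column [c] with [v *m X *m c = 0]; if
    [c] is nonzero its orbit is everything, which forces [v = 0]. *)
Lemma coorbit_full (v w : 'rV[K]_n) : v != 0 -> exists2 X, B X & v *m X = w.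
Proof.
move=> v0; pose P u := exists2 X, B X & v *m X = u.
have [|k [a [y [yP ->]]]] := @span_duality _ _ P w.
  move=> phi phiL phiP; pose c : 'cV[K]_n := \col_j phi (delta_mx 0 j).
  have phi0 : phi 0 = 0 by have := phiL (-1) 0 0; rewrite scaler0 addr0 mulN1r addNr.
  have phiE u : phi u = (u *m c) 0 0.
    rewrite {1}[u]row_sum_delta mxE; elim/big_rec2: _ => [|i x y _ <-]; first exact: phi0.
    by rewrite phiL mxE.
  have [c0|c0] := eqVneq c 0; first by rewrite phiE c0 mulmx0 mxE.
  case/eqP: v0; apply/rowP => j.
  have [X BX Xc] := orbit_full (delta_mx j 0) c0.
  have := phiP (v *m X) (ex_intro2 _ _ X BX erefl).
  by rewrite phiE -mulmxA Xc -colE !mxE.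
have Y i : {Y : 'M[K]_n | B Y & v *m Y = y i} by apply: cid2; exact: yP.
exists (\sum_i a i *: s2val (Y i)); first by apply: Bsum => i; exact: s2valP.
by rewrite mulmx_sumr; apply: eq_bigr => i _; rewrite -scalemxAr (s2valP' (Y i)).
Qed.

(* A nonzero element [X] of minimal rank satisfies [X A X = c X] for every [A],
   since subtracting an eigenvalue lowers the rank; transitivity then forces
   the rank to be one. *)
Lemma rank1_element : exists (l : 'cV[K]_n) (m : 'rV[K]_n), [/\ l != 0, m != 0 & B (l *m m)].
Proof.
pose Q r := `[< exists X, [/\ B X, X != 0 & \rank X = r] >].
have one0 : (1%:M : 'M[K]_n) != 0.
  by rewrite -mxrank_eq0 mxrank1 -lt0n.
have exQ : exists r, Q r by exists (\rank (1%:M : 'M[K]_n)); apply/asboolP; exists 1%:M.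
case: (ex_minnP exQ) => r /asboolP[X [BX X0 rX]] rmin.
have eX := mulmx_base X; move: (col_base_full X) (row_base_free X).
move: (col_base X) (row_base X) eX; rewrite rX => L M eX Lf Mf.
have r0 : (0 < r)%N by rewrite -rX lt0n mxrank_eq0.
have [L' L'L] : exists L', L' *m L = 1%:M by apply/row_fullP.
have [M' MM'] : exists M', M *m M' = 1%:M by apply/row_freeP.
have key A : B A -> exists c, M *m A *m L = c%:M.
  move=> BA; have [c] := eigenvalue_closed (M *m A *m L) r0.
  rewrite /eigenvalue /eigenspace -mxrank_eq0 mxrank_ker subn_eq0 -ltnNge => cr.
  exists c; apply/eqP; rewrite -subr_eq0; apply/eqP; set D := _ - _ in cr *.
  suff LDM : L *m D *m M = 0.
    by rewrite -[D]mul1mx -L'L -[_ *m D]mulmx1 -MM' !mulmxA -(mulmxA L') -(mulmxA L') LDM mulmx0 mul0mx.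
  apply/eqP; apply: contraT => nz.
  have LDME : L *m D *m M = - c *: X + X *m A *m X.
    have -> : X *m A *m X = L *m (M *m A *m L) *m M by rewrite -eX !mulmxA.
    by rewrite /D mulmxBr mulmxBl mul_mx_scalar -scalemxAl eX scaleNr addrC.
  have /rmin : Q (\rank (L *m D *m M)).
    apply/asboolP; exists (L *m D *m M); split=> //.
    by rewrite LDME; apply: BL => //; do !apply: BM.
  rewrite leqNgt => /negP; case; apply: leq_ltn_trans cr.
  by apply: leq_trans (mxrankM_maxl _ _) _; exact: mxrankM_maxr.
have r1 : r = 1%N.
  apply/eqP; rewrite eqn_leq r0 andbT leqNgt; apply/negP => r2.
  pose i0 : 'I_r := Ordinal r0; pose i1 : 'I_r := Ordinal r2.
  have Li0 : L *m delta_mx i0 (0 : 'I_1) != 0.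
    apply/eqP => /(congr1 (mulmx L')); rewrite mulmxA L'L mul1mx mulmx0.
    by move/matrixP/(_ i0 0)/eqP; rewrite !mxE !eqxx oner_eq0.
  have [A BA AL] := orbit_full (M' *m delta_mx i1 (0 : 'I_1)) Li0.
  have [c ec] := key A BA.
  have : M *m (A *m (L *m delta_mx i0 (0 : 'I_1))) = delta_mx i1 0 by rewrite AL mulmxA MM' mul1mx.
  rewrite !mulmxA ec mul_scalar_mx => /matrixP/(_ i1 0)/eqP; rewrite !mxE !eqxx /=.
  by rewrite mulr0 eq_sym oner_eq0.
clear key L'L L' MM' M' Lf Mf; move: L M eX; rewrite r1 => L M eX; exists L, M; split; last by rewrite eX.
- by apply: contraNneq X0 => L0; rewrite -eX L0 mul0mx.
- by apply: contraNneq X0 => M0; rewrite -eX M0 mulmx0.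
Qed.

Theorem burnside_full (Y : 'M[K]_n) : B Y.
Proof.
have [l [m [l0 m0 Blm]]] := rank1_element.
rewrite [Y]matrix_sum_delta pair_big /=; apply: Bsum => -[i j] /=.
have [X BX Xl] := orbit_full (delta_mx i 0) l0.
have [Z BZ mZ] := coorbit_full (delta_mx 0 j) m0.
have -> : delta_mx i j = X *m (l *m m) *m Z.
  by rewrite mulmxA Xl -mulmxA mZ mul_delta_mx.
by do !apply: BM.
Qed.

End Burnside.

Lemma scalar_mx_commutant (K : fieldType) n (Y : 'M[K]_n) :
  (forall X, Y *m X = X *m Y) -> exists c, Y = c%:M.
Proof.
case: n Y => [|n] Y H; first by exists 0; apply/matrixP => -[].
exists (Y 0 0); apply/matrixP => i j; rewrite mxE.
have := congr1 (fun A : 'M[K]_n.+1 => A i 0) (H (delta_mx j 0)).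
rewrite [LHS]mxE [RHS]mxE (bigD1 j) //= mxE !eqxx mulr1 big1 ?addr0 => [|k /negPf kj]; last first.
  by rewrite mxE kj mulr0.
move=> ->; rewrite (bigD1 0) //= mxE eqxx andbT big1 ?addr0 => [|k /negPf kj]; last first.
  by rewrite mxE kj andbF mul0r.
by rewrite mulr_natl.
Qed.

(** * Weights of unitary representations *)

Lemma uact_near1 (C : numClosedFieldType) N (W : unitary_rep C N) (e : C) : 0 < e ->
  exists2 r : C, 0 < r & forall g : 'M[C]_N, g \is unitarymx ->
    (forall i j, `|g i j - (1%:M : 'M[C]_N) i j| < r) ->
    forall a b, `|uact W g a b - (1%:M : 'M[C]_(dimW W)) a b| < e.
Proof.
move=> e0; have one1 : [set g : 'M[C]_N | g \is unitarymx]%classic 1%:M by exact: unitarymx1.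
have := (subspace_continuousP _ _).1 (@uact_continuous _ _ W) _ one1.
move=> /(_ (ball (uact W 1%:M) e)) /= /(_ (nbhsx_ballx _ _ e0)) H.
have {H} [r /= r0 H] := (nbhs_ballP _ _).1 H.
exists r => // g gU g1 a b.
have [] := H g _ gU; last by move=> _ /(_ a b); rewrite uact1 /ball /= distrC.
split=> // i j; rewrite /ball /= distrC; exact: g1.
Qed.

(** The minimal polynomial divides ['X^m - 1], which has simple roots in characteristic zero. *)
Lemma diagonalizable_torsion (C : numClosedFieldType) n (A : 'M[C]_n) m : (0 < m)%N ->
  A ^+ m = 1%:M -> diagonalizable A.
Proof.
case: n A => [|n] A m0 Am.
  exists 1%:M; first exact: unitmx1.
  by apply/is_diag_mxP => -[].
apply/diagonalizableP.
have [rs e] := closed_field_poly_normal ('X^m - 1 : {poly C}).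
have mon : ('X^m - 1 : {poly C}) \is monic by rewrite -[1]/(1%:P); exact: monicXnsubC.
rewrite (monicP mon) scale1r in e.
exists rs; last first.
  rewrite -e; apply/mxminpoly_minP.
  by rewrite rmorphB rmorphXn /= horner_mx_X rmorph1 Am subrr.
by rewrite -separable_prod_XsubC -e separable_Xn_sub_1 // pnatr_eq0 -lt0n.
Qed.

(** * Simultaneous diagonalization of the torus *)

Section TorusWeights.
Variables (R : realType) (N : nat) (W : unitary_rep R[i] N).
Local Notation C := R[i].
Local Notation D := (dimW W).

Definition coord_torus (i : 'I_N) (z : C) : 'M[C]_N :=
  diag_mx (\row_j (if j == i then z else 1)).

Lemma coord_torus_unitary i z : `|z| = 1 -> coord_torus i z \is unitarymx.
Proof. by move=> z1; apply: diag_unitary => j; rewrite mxE; case: ifP; rewrite ?normr1. Qed.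

Lemma coord_torusM i z w : coord_torus i (z * w) = coord_torus i z *m coord_torus i w.
Proof.
rewrite mulmx_diag; congr diag_mx; apply/rowP => j; rewrite !mxE.
by case: ifP; rewrite ?mulr1.
Qed.

Lemma coord_torus1 i : coord_torus i 1 = 1%:M.
Proof.
rewrite /coord_torus (_ : \row_j _ = const_mx 1) ?diag_const_mx //.
by apply/rowP => j; rewrite !mxE; case: ifP.
Qed.

Let A i z := uact W (coord_torus i z).

Let AM i z w : `|z| = 1 -> `|w| = 1 -> A i (z * w) = A i z *m A i w.
Proof. by move=> z1 w1; rewrite /A coord_torusM uactM ?coord_torus_unitary. Qed.

Let A1 i : A i 1 = 1%:M.
Proof. by rewrite /A coord_torus1 uact1. Qed.

Let AX i z n : `|z| = 1 -> A i (z ^+ n) = A i z ^+ n.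
Proof.
move=> z1; elim: n => [|n IH]; first by rewrite !expr0 A1.
by rewrite !exprS AM ?normrX ?z1 ?expr1n // IH.
Qed.

Let AC i j z w : `|z| = 1 -> `|w| = 1 -> comm_mx (A i z) (A j w).
Proof.
move=> z1 w1; have := coord_torus_unitary i z1; have := coord_torus_unitary j w1 => uw uz.
by rewrite /comm_mx /A -(uactM W uz uw) -(uactM W uw uz) diag_mxC.
Qed.

Let A_near1 i (e : C) : 0 < e -> exists2 r : C, 0 < r &
  forall z, `|z| = 1 -> `|z - 1| < r -> forall a b, `|A i z a b - (1%:M : 'M[C]_D) a b| < e.
Proof.
move=> /(uact_near1 W)[r r0 H]; exists r => // z z1 zr; apply: H; first exact: coord_torus_unitary.
move=> k l; rewrite !mxE; case: (k == l); rewrite ?mulr1n ?mulr0n ?subrr ?normr0 //.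
by case: ifP => //; rewrite subrr normr0.
Qed.

Lemma conj_coord_torus_near1 (P : 'M[C]_D) i (e : C) : P \in unitmx -> 0 < e ->
  exists2 r : C, 0 < r & forall z, `|z| = 1 -> `|z - 1| < r ->
    forall a b, `|(P *m A i z *m invmx P) a b - (1%:M : 'M[C]_D) a b| < e.
Proof.
move=> Pu e0.
(* [M] dominates the relevant double sum for all entries [a], [b] at once; the added 1 makes it
   positive and the final estimate strict. *)
pose M : C := \sum_a \sum_b \sum_c \sum_k `|P a c| * `|invmx P k b| + 1.
have M0 : 0 < M.
  rewrite ltr_wpDl ?ltr01 // sumr_ge0 // => a _; rewrite sumr_ge0 // => b _.
  by rewrite sumr_ge0 // => c _; rewrite sumr_ge0 // => k _; rewrite mulr_ge0.
have [r r0 Hr] := A_near1 i (divr_gt0 e0 M0).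
exists r => // z z1 zr a b.
have XE : (P *m A i z *m invmx P) a b - (1%:M : 'M[C]_D) a b =
    \sum_c \sum_k P a c * (A i z c k - (1%:M : 'M[C]_D) c k) * invmx P k b.
  have -> : (P *m A i z *m invmx P) a b - (1%:M : 'M[C]_D) a b =
      (P *m (A i z - 1%:M) *m invmx P) a b.
    by rewrite mulmxBr mulmx1 mulmxBl mulmxV // [RHS]mxE [Z in _ = _ + Z]mxE.
  rewrite mxE; under eq_bigr => k _ do rewrite mxE mulr_suml.
  rewrite exchange_big; apply: eq_bigr => c _; apply: eq_bigr => k _.
  by rewrite !mxE.
have le_one : \sum_c \sum_k `|P a c| * `|invmx P k b| <= M - 1.
  rewrite /M addrK [leRHS](bigD1 a) //= [X in _ <= X + _](bigD1 b) //= -addrA lerDl addr_ge0 //.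
    by rewrite sumr_ge0 // => b' _; rewrite sumr_ge0 // => c _; rewrite sumr_ge0 // => k _; rewrite mulr_ge0.
  rewrite sumr_ge0 // => a' _; rewrite sumr_ge0 // => b' _.
  by rewrite sumr_ge0 // => c _; rewrite sumr_ge0 // => k _; rewrite mulr_ge0.
have eM : 0 <= e / M by rewrite divr_ge0 // ltW.
rewrite XE; apply: (@le_lt_trans _ _ ((M - 1) * (e / M))).
  apply: le_trans (ler_wpM2r eM le_one).
  rewrite mulr_suml; apply: le_trans (ler_norm_sum _ _ _) _; apply: ler_sum => c _.
  rewrite mulr_suml; apply: le_trans (ler_norm_sum _ _ _) _; apply: ler_sum => k _.
  rewrite !normrM mulrAC ler_wpM2l ?mulr_ge0 //; apply: ltW; exact: Hr.
by rewrite mulrCA gtr_pMr // ltr_pdivrMr // mul1r ltrBlDr ltrDl ltr01.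
Qed.

(** Torsion elements commute and are diagonalizable, hence are diagonalized together through a
    finite spanning family. For general [z] and a torsion point [w] close to it, an off-diagonal
    entry has the same modulus at [z] and at [z / w], and near 1 such entries are arbitrarily
    small. *)
Lemma torus_conj_diag : exists2 P : 'M[C]_D, P \in unitmx &
  forall i z, `|z| = 1 -> is_diag_mx (P *m A i z *m invmx P).
Proof.
pose Q (Y : 'M[C]_D) := exists i z m, [/\ (0 < m)%N, z ^+ m = 1, `|z| = 1 & Y = A i z].
have [Ys YsQ QYs] := spanning_seq Q.
have /codiagonalizableP[P Pu /allP Pd] : {in Ys &, forall X Y, comm_mx X Y} /\
    {in Ys, forall X, diagonalizable X}.
  split=> [X Y /YsQ[i [z [m [_ _ z1 ->]]]] /YsQ[j [w [k [_ _ w1 ->]]]]|X]; first exact: AC.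
  move=> /YsQ[i [z [m [m0 zm z1 ->]]]]; apply: (diagonalizable_torsion m0).
  by rewrite -AX // zm A1.
exists P => //.
have tor i z m : (0 < m)%N -> z ^+ m = 1 -> `|z| = 1 -> is_diag_mx (P *m A i z *m invmx P).
  move=> m0 zm z1; have /(@coord_span _ _ _ (in_tuple Ys)) -> : A i z \in <<Ys>>%VS.
    by apply: QYs; exists i, z, m.
  rewrite mulmx_sumr mulmx_suml; apply/is_diag_mxP => a b ab; rewrite summxE big1 // => k _.
  rewrite -scalemxAr -scalemxAl mxE.
  have /Pd : Ys`_k \in Ys by exact: mem_nth.
  move=> /(diagonalizable_forLR Pu)[v ev].
  rewrite (_ : (in_tuple Ys)`_k = conjmx (invmx P) (diag_mx v)) // conjVmx //.
  by rewrite !mulmxA mulmxV // mul1mx mulmxK // mxE (negPf (ab : a != b)) mulr0n mulr0.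
move=> i z z1; apply/is_diag_mxP => a b ab.
apply/eqP; apply: contraT; rewrite -normr_gt0; set e := `|_| => e0.
have [r r0 Hr] := conj_coord_torus_near1 i Pu e0.
have [w [m [m0 wm w1 zw]]] := circle_torsion_dense z1 r0.
have zw1 : `|z / w| = 1 by rewrite normf_div z1 w1 divr1.
have w0 : w != 0 by rewrite -normr_eq0 w1 oner_eq0.
pose X := P *m A i (z / w) *m invmx P.
have [Y eY Yd] : exists2 Y, Y = P *m A i w *m invmx P & forall c k, c != k -> Y c k = 0.
  by exists (P *m A i w *m invmx P) => //; apply/is_diag_mxP/(tor i w m).
have Yrow (Z : 'M[C]_D) k : (Y *m Z) a k = Y a a * Z a k.
  rewrite mxE (bigD1 a) //= big1 ?addr0 // => c ca.
  have ac : a != c by rewrite eq_sym.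
  by rewrite (Yd a c ac) mul0r.
have eab : (P *m A i z *m invmx P) a b = Y a a * X a b.
  have -> : A i z = A i w *m A i (z / w) by rewrite -AM // mulrC divfK.
  by rewrite -Yrow eY /X !mulmxA mulmxKV.
have na : `|Y a a| = 1.
  apply/eqP; rewrite -(pexpr_eq1 m0) ?normr_ge0 // -normrX.
  have pw k : Y a a ^+ k = (P *m A i (w ^+ k) *m invmx P) a a.
    elim: k => [|k IH]; first by rewrite !expr0 A1 mulmx1 mulmxV // mxE eqxx.
    have wk : `|w ^+ k| = 1 by rewrite normrX w1 expr1n.
    by rewrite exprS IH exprS (AM i w1 wk) -Yrow eY !mulmxA mulmxKV.
  by rewrite pw wm A1 mulmx1 mulmxV // mxE eqxx normr1.
have Xab : `|X a b| < e.
  by have := Hr _ zw1 zw a b; rewrite [(1%:M : 'M[C]_D) a b]mxE (negPf (ab : a != b)) subr0.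
by move: Xab; rewrite -[`|X a b|]mul1r -na -normrM -eab ltxx.
Qed.

(** Each diagonal entry is, in each coordinate, a continuous character of the circle, hence a power;
    the coordinates are then multiplied together one at a time. *)
Lemma torus_weights : exists2 P : 'M[C]_D, P \in unitmx &
  exists mu : 'I_D -> 'I_N -> int, forall x : 'rV[C]_N, (forall i, `|x 0 i| = 1) ->
    P *m uact W (diag_mx x) *m invmx P = diag_mx (\row_a \prod_i x 0 i ^ mu a i).
Proof.
have [P Pu Pd] := torus_conj_diag; exists P => //.
pose Y i z := P *m A i z *m invmx P.
have YM i z w : `|z| = 1 -> `|w| = 1 -> Y i (z * w) = Y i z *m Y i w.
  by move=> z1 w1; rewrite /Y AM // !mulmxA mulmxKV.
have Y1 i : Y i 1 = 1%:M by rewrite /Y A1 mulmx1 mulmxV.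
have Yd i z a b : `|z| = 1 -> a != b -> Y i z a b = 0.
  by move=> z1; apply/is_diag_mxP/Pd.
have Ycont i a (e : C) : 0 < e -> exists2 r : C, 0 < r &
    forall z, `|z| = 1 -> `|z - 1| < r -> `|Y i z a a - 1| < e.
  move=> e0; have [r r0 Hr] := conj_coord_torus_near1 i Pu e0; exists r => // z z1 zr.
  by have := Hr z z1 zr a a; rewrite [(1%:M : 'M[C]_D) a a]mxE eqxx.
move: Y Y1 YM Yd Ycont (erefl : Y = fun i z => P *m A i z *m invmx P) => Y Y1 YM Yd Ycont YE.
have chi a i : {k : int | forall z, `|z| = 1 -> Y i z a a = z ^ k}.
  apply: cid; apply: (circle_character (chi := fun z => Y i z a a)).
  - move=> z w z1 w1; rewrite YM // mxE (bigD1 a) //= big1 ?addr0 // => c ca.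
    have ac : a != c by rewrite eq_sym.
    by rewrite (Yd i z a c z1 ac) mul0r.
  - by rewrite Y1 mxE eqxx.
  - exact: Ycont.
exists (fun a i => sval (chi a i)) => x x1.
pose tr k : 'rV[C]_N := \row_j (if (j < k)%N then x 0 j else 1).
have tr1 k j : `|tr k 0 j| = 1 by rewrite mxE; case: ifP; rewrite ?x1 ?normr1.
have trN : tr N = x by apply/rowP => j; rewrite mxE ltn_ord.
have main k : (k <= N)%N -> P *m uact W (diag_mx (tr k)) *m invmx P =
    diag_mx (\row_a \prod_(i < N | (i < k)%N) x 0 i ^ sval (chi a i)).
  elim: k => [_|k IH kN].
    have -> : diag_mx (tr 0) = 1%:M.
      by rewrite -diag_const_mx; congr diag_mx; apply/rowP => j; rewrite !mxE.
    rewrite uact1 mulmx1 mulmxV // -diag_const_mx; congr diag_mx.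
    by apply/rowP => a; rewrite !mxE big_pred0.
  pose i := Ordinal kN.
  have -> : diag_mx (tr k.+1) = diag_mx (tr k) *m coord_torus i (x 0 i).
    rewrite mulmx_diag; congr diag_mx; apply/rowP => j; rewrite !mxE ltnS leq_eqVlt.
    have [->|ne] := eqVneq j i; first by rewrite /= eqxx ltnn mul1r.
    by rewrite -val_eqE /= in ne; rewrite (negPf ne) mulr1.
  have ut : diag_mx (tr k) \is unitarymx by apply: diag_unitary.
  rewrite (uactM W ut (coord_torus_unitary i (x1 i))).
  have -> : P *m (uact W (diag_mx (tr k)) *m uact W (coord_torus i (x 0 i))) *m invmx P =
     (P *m uact W (diag_mx (tr k)) *m invmx P) *m Y i (x 0 i).
    by rewrite YE !mulmxA mulmxKV.
  rewrite (IH (ltnW kN)).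
  have -> : Y i (x 0 i) = diag_mx (\row_a x 0 i ^ sval (chi a i)).
    apply/matrixP => a b; have [<-|ab] := eqVneq a b.
      by rewrite (svalP (chi a i) _ (x1 i)) !mxE eqxx mulr1n.
    by rewrite (Yd i _ a b (x1 i) ab) mxE (negPf ab) mulr0n.
  rewrite mulmx_diag; congr diag_mx; apply/rowP => a; rewrite !mxE [in RHS](bigD1 i) //= mulrC.
  congr (_ * _); apply: eq_bigl => j; by rewrite ltnS ltn_neqAle andbC -val_eqE.
have := main N (leqnn N); rewrite trN => ->; congr diag_mx; apply/rowP => a; rewrite !mxE.
by apply: eq_bigl => j; rewrite ltn_ord.
Qed.

End TorusWeights.

(** * Symmetry, positivity and multiplicities of weights *)

Section Weights.
Variables (R : realType) (N : nat) (W : unitary_rep R[i] N).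
Local Notation C := R[i].
Local Notation D := (dimW W).

Lemma uact_unit g : g \is unitarymx -> uact W g \in unitmx.
Proof.
move=> gU; have gV := unitarymx_inv gU.
have : uact W g *m uact W (invmx g) = 1%:M.
  by rewrite -(uactM W gU gV) mulmxV ?uact1 // unitarymx_unit.
by move/mulmx1_unit => [].
Qed.

Lemma uchar_conj v g : v \is unitarymx -> g \is unitarymx ->
  uchar W (invmx v *m g *m v) = uchar W g.
Proof.
move=> vU gU; have vV := unitarymx_inv vU.
have vgU : invmx v *m g \is unitarymx by exact: mul_unitarymx.
rewrite /uchar (uactM W vgU vU) mxtrace_mulC -(uactM W vU vgU).
by rewrite mulmxA mulmxV ?mul1mx // unitarymx_unit.
Qed.

Lemma perm_mx_unitary (s : 'S_N) : (perm_mx s : 'M[C]_N) \is unitarymx.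
Proof.
apply/unitarymxP; rewrite tr_perm_mx map_perm_mx -perm_mxM mulgV; exact: perm_mx1.
Qed.

Lemma diag_perm_mx (x : 'rV[C]_N) (s : 'S_N) :
  diag_mx x *m perm_mx s = perm_mx s *m diag_mx (\row_i x 0 (s^-1%g i)).
Proof.
rewrite -row_permE; apply/matrixP => i j; rewrite mxE (bigD1 i) //= !mxE eqxx mulr1n.
rewrite big1 ?addr0 => [|k ki]; last by rewrite mxE eq_sym (negPf ki) mulr0n mul0r.
by rewrite permK mulr_natr.
Qed.

Lemma weight_perm mu (s : 'S_N) : is_weight W mu -> is_weight W (fun i => mu (s i)).
Proof.
move=> [v v0 vP]; exists (uact W (perm_mx s) *m v).
  by apply: contraNneq v0 => e; rewrite -(mulKmx (uact_unit (perm_mx_unitary s)) v) e mulmx0.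
move=> x x1; rewrite mulmxA -(uactM W (diag_unitary x1) (perm_mx_unitary s)) diag_perm_mx.
have y1 i : `|(\row_i x 0 (s^-1%g i)) 0 i| = 1 by rewrite mxE.
rewrite (uactM W (perm_mx_unitary s) (diag_unitary y1)) -mulmxA vP // -scalemxAr; congr (_ *: _).
by rewrite (reindex_inj (@perm_inj _ s)) /=; apply: eq_bigr => i _; rewrite mxE permK.
Qed.

Lemma uchar_diag_perm (x : 'rV[C]_N) (s : 'S_N) : (forall i, `|x 0 i| = 1) ->
  uchar W (diag_mx (\row_i x 0 (s i))) = uchar W (diag_mx x).
Proof.
move=> x1; have y1 i : `|(\row_i x 0 (s i)) 0 i| = 1 by rewrite mxE.
rewrite -(uchar_conj (perm_mx_unitary s^-1%g) (diag_unitary x1)); congr (uchar W _).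
have := diag_perm_mx x s^-1%g; rewrite invgK -mulmxA => ->.
by rewrite mulKmx // unitarymx_unit // perm_mx_unitary.
Qed.

(** Every partial sum of a positive root [e_i - e_j] with [i < j] is 0 or 1. *)
Lemma weight_le_prefix (mu la : 'I_N -> int) (m : nat) : weight_le mu la ->
  \sum_(k < N | (k < m)%N) mu k <= \sum_(k < N | (k < m)%N) la k.
Proof.
move=> [c cP]; rewrite -subr_ge0 -sumrB (eq_bigr _ (fun k _ => cP k)).
rewrite exchange_big /=; apply: sumr_ge0 => i _; rewrite exchange_big /=; apply: sumr_ge0 => j ij.
rewrite -mulr_sumr mulr_ge0 // sumrB subr_ge0.
have S (a : 'I_N) : \sum_(k < N | (k < m)%N) (k == a)%:Z = (a < m)%N%:Z.
  rewrite big_mkcond (bigD1 a) //= eqxx big1 ?addr0 => [|k /negPf ->]; last by case: ifP.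
  by case: ifP.
by rewrite !S lez_nat; case: (ltnP j m) => // jm; rewrite (ltn_trans ij jm).
Qed.

Lemma weight_le_total (mu la : 'I_N -> int) : weight_le mu la ->
  \sum_(k < N) mu k = \sum_(k < N) la k.
Proof.
move=> [c cP]; apply/eqP; rewrite eq_sym -subr_eq0 -sumrB (eq_bigr _ (fun k _ => cP k)).
rewrite exchange_big /= big1 // => i _; rewrite exchange_big /= big1 // => j ij.
rewrite -mulr_sumr sumrB.
have S (a : 'I_N) : \sum_(k < N) (k == a)%:Z = 1%:Z.
  by rewrite (bigD1 a) //= eqxx big1 ?addr0 // => k /negPf ->.
by rewrite !S subrr mulr0.
Qed.

Variables (d : nat) (la : young d).
Hypothesis laN : (nrows la <= N)%N.
Hypothesis hW : has_highest_weight W (fun i => (row_len la i)%:Z).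

Lemma sum_row_len : (\sum_(i < N) row_len la i = d)%N.
Proof.
have ltN b : (box_row la b < N)%N by apply: leq_trans (box_row_lt_nrows la b) laN.
rewrite -[RHS]card_ord -sum1_card (partition_big (fun b => Ordinal (ltN b)) xpredT) //=.
apply: eq_bigr => i _; rewrite -card_box_row -sum1_card; apply: eq_bigl => b.
by rewrite inE -val_eqE.
Qed.

Lemma weight_total mu : is_weight W mu -> \sum_i mu i = d%:Z.
Proof.
move=> /hW.2 /weight_le_total ->; rewrite -(big_morph Posz PoszD (erefl 0%:Z)).
by rewrite sum_row_len.
Qed.

(** Permute the weight so that [mu k] comes last. The sum of the other entries is at most that of
    [la] and the totals agree, so [mu k] is at least the last entry of [la]. *)
Lemma weight_ge0 mu k : is_weight W mu -> 0 <= mu k.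
Proof.
move=> wmu; have N0 : (0 < N)%N by apply: leq_ltn_trans (ltn_ord k).
have lN : (N.-1 < N)%N by rewrite prednK.
pose l : 'I_N := Ordinal lN; pose s := tperm k l.
have wmu' := weight_perm s wmu.
have split (F : 'I_N -> int) : \sum_i F i = F l + \sum_(i < N | (i < N.-1)%N) F i.
  rewrite (bigD1 l) //=; congr (_ + _); apply: eq_bigl => i.
  rewrite -val_eqE /= ltn_neqAle; suff -> : (i <= N.-1)%N by rewrite andbT.
  by rewrite -ltnS prednK.
have := weight_le_prefix N.-1 (hW.2 _ wmu'); have := weight_le_total (hW.2 _ wmu').
rewrite !split /s tpermR => e le; have : (row_len la l)%:Z <= mu k.
  by move: e le; set A := \sum_(i < N | _) _; set B := \sum_(i < N | _) _; lia.
exact: le_trans.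
Qed.

(** Weights are nonnegative of total [d], so they fit in [{ffun 'I_N -> 'I_d.+1}]; [F] counts the
    vectors of a diagonalizing basis by weight. *)
Lemma highest_weight_multiplicities : exists F : {ffun 'I_N -> 'I_d.+1} -> C,
  [/\ forall x : 'rV[C]_N, (forall i, `|x 0 i| = 1) ->
        uchar W (diag_mx x) = \sum_nu F nu * \prod_i x 0 i ^+ nu i,
      F (shape N la) != 0,
      forall nu : {ffun 'I_N -> 'I_d.+1}, F nu != 0 -> dominated nu (shape N la) &
      forall nu : {ffun 'I_N -> 'I_d.+1}, (\sum_i nu i)%N <> d -> F nu = 0].
Proof.
have [P Pu [mu muP]] := torus_weights W.
have uE (x : 'rV[C]_N) : (forall i, `|x 0 i| = 1) -> uact W (diag_mx x) =
    invmx P *m diag_mx (\row_a \prod_i x 0 i ^ mu a i) *m P.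
  by move=> /muP <-; rewrite !mulmxA mulVmx // mul1mx mulmxKV.
have wmu a : is_weight W (mu a).
  exists (invmx P *m delta_mx a (0 : 'I_1)).
    apply/eqP => /(congr1 (mulmx P)); rewrite mulmx0 mulmxA mulmxV // mul1mx => /matrixP/(_ a 0)/eqP.
    by rewrite !mxE !eqxx oner_eq0.
  move=> x x1; rewrite (uE x x1) mulmxA -(mulmxA _ P) mulmxV // mulmx1 -mulmxA scalemxAr.
  congr (_ *m _); apply/matrixP => b j; rewrite mul_diag_mx !mxE.
  by have [->|_] := eqVneq b a; rewrite ?mulr0.
have mu_le a i : (`|mu a i|%N < d.+1)%N.
  rewrite ltnS -lez_nat -(weight_total (wmu a)) gez0_abs; last exact: weight_ge0.
  by rewrite (bigD1 i) //= lerDl sumr_ge0 // => j _; exact: weight_ge0.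
pose nu a : {ffun 'I_N -> 'I_d.+1} := [ffun i => inord `|mu a i|%N].
have nuE a i : (nu a i)%:Z = mu a i.
  by rewrite ffunE inordK // gez0_abs //; exact: weight_ge0.
exists (fun ka => \sum_(a | nu a == ka) 1); split.
- move=> x x1; rewrite /uchar (uE x x1) mxtrace_mulC mulmxA mulmxV // mul1mx mxtrace_diag.
  rewrite (partition_big nu xpredT) //=; apply: eq_bigr => ka _; rewrite mulr_suml.
  apply: eq_bigr => a /eqP <-; rewrite mxE mul1r; apply: eq_bigr => i _.
  by rewrite -nuE.
- have [v v0 vP] := hW.1.
  have [a va] : exists a, (P *m v) a 0 != 0.
    apply: contrapT => none; case/eqP: v0; rewrite -(mulKmx Pu v) (_ : P *m v = 0) ?mulmx0 //.
    apply/matrixP => a j; rewrite ord1 [RHS]mxE; apply/eqP; apply: contrapT => /negP h.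
    by apply: none; exists a.
  (* A nonzero coordinate of [P *m v] has weight [la]: the two monomials agree on the torus, and
     varying one coordinate at a time compares the exponents. *)
  have nua : nu a = shape N la.
    apply/ffunP => i; apply: val_inj; rewrite /= shapeE.
    suff /(congr1 (fun p : {poly C} => size p)) : 'X^(nu a i) = 'X^(row_len la i) :> {poly C}.
      by rewrite !size_polyXn => -[].
    apply/eqP; rewrite -subr_eq0; apply/eqP; apply: poly_circle_eq0 => z z1.
    rewrite hornerD hornerN !hornerXn; apply/eqP; rewrite subr_eq0; apply/eqP.
    pose x : 'rV[C]_N := \row_j (if j == i then z else 1).
    have x1 j : `|x 0 j| = 1 by rewrite mxE; case: ifP; rewrite ?normr1.
    have prodx (k : 'I_N -> nat) : \prod_j x 0 j ^ (k j)%:Z = z ^+ k i.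
      rewrite (bigD1 i) //= big1 ?mulr1 => [|j ji]; first by rewrite mxE eqxx.
      by rewrite mxE (negPf ji) exp1rz.
    have := congr1 (fun u => (P *m u) a 0) (vP x x1).
    rewrite (uE x x1) !mulmxA mulmxV // mul1mx -mulmxA mul_diag_mx -scalemxAr
      [LHS]mxE [RHS]mxE => /(mulIf va).
    rewrite mxE prodx (eq_bigr (fun j => x 0 j ^ (nu a j)%:Z)) => [|j _]; last by rewrite nuE.
    by rewrite prodx.
  rewrite sumr_const pnatr_eq0 -lt0n; apply/card_gt0P; exists a.
  by rewrite -[_ \in _]/(nu a == shape N la) nua eqxx.
- move=> ka; have [/existsP[a /eqP <-] _|none] := boolP [exists a, nu a == ka]; last first.
    rewrite big_pred0 ?eqxx // => a; apply/negbTE; apply: contraNN none => h.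
    by apply/existsP; exists a.
  move=> k; have := weight_le_prefix k (hW.2 _ (wmu a)); rewrite -lez_nat /prefix.
  rewrite !(big_morph Posz PoszD (erefl 0%:Z)).
  rewrite (eq_bigr (fun i => (nu a i)%:Z)) => [|i _]; last by rewrite nuE.
  by rewrite [X in _ <= X -> _](eq_bigr (fun i => (shape N la i)%:Z)) // => i _; rewrite shapeE.
- move=> ka kad; rewrite big_pred0 // => a; apply/negP => /eqP e; apply: kad.
  apply/eqP; rewrite -eqz_nat -(weight_total (wmu a)) (big_morph Posz PoszD (erefl 0%:Z)) -e.
  by apply/eqP; apply: eq_bigr => i _; rewrite nuE.
Qed.

End Weights.

(** * The character of a highest weight representation *)

Section HighestWeightCharacter.
Variables (R : realType) (N d : nat) (W : unitary_rep R[i] N) (la : young d).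
Local Notation C := R[i].
Local Notation D := (dimW W).
Local Notation T := 'M[C]_#|{: {ffun 'I_d -> 'I_N}}|.
Local Notation E := (tens_sym R N).
Hypothesis laN : (nrows la <= N)%N.
Hypothesis hW : is_Wrep W la.

Lemma uchar_expansion : exists c : young d -> C, c la != 0 /\
  forall g, g \is unitarymx ->
    uchar W g = \sum_(mu : young d | (nrows mu <= N)%N) c mu * \tr (tens d g *m E mu).
Proof.
have [F [FE Fla Fdom Fd]] := highest_weight_multiplicities laN hW.2.
have Fsym (nu : {ffun 'I_N -> 'I_d.+1}) (p : 'S_N) : F [ffun i => nu (p i)] = F nu.
  apply: symmetric_coefficients => x x1.
  pose y : 'rV[C]_N := \row_i x i.
  have y1 i : `|y 0 i| = 1 by rewrite mxE.
  have yp1 i : `|(\row_i y 0 (p i)) 0 i| = 1 by rewrite mxE.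
  have e1 := FE _ y1; have e2 := FE _ yp1.
  rewrite (uchar_diag_perm W p y1) e1 in e2.
  transitivity (\sum_ka F ka * \prod_i (\row_i y 0 (p i)) 0 i ^+ ka i).
    by apply: eq_bigr => ka _; congr (_ * _); apply: eq_bigr => i _; rewrite !mxE.
  by rewrite -e2; apply: eq_bigr => ka _; congr (_ * _); apply: eq_bigr => i _; rewrite mxE.
have [c cE] := kost_expansion Fsym Fd.
exists c; split.
  (* Some [mu0] with nonzero coefficient lies above [la], because [F (shape N la) != 0]. A diagram
     [mu] of maximal rank with nonzero coefficient has [F (shape N mu) != 0], hence lies below [la];
     comparing ranks gives [mu = la]. *)
  pose Q mu := (nrows mu <= N)%N && (c mu != 0).
  have [mu0 [Q0 D0]] : exists mu0, Q mu0 /\ dominated (shape N la) (shape N mu0).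
    apply: contrapT => none; case/eqP: Fla; rewrite cE big1 // => mu muN.
    have [->|cmu] := eqVneq (c mu) 0; first by rewrite mul0r.
    have [->|kmu] := eqVneq (kost R mu (shape N la)) 0; first by rewrite mulr0.
    by case: none; exists mu; rewrite /Q muN cmu; split=> //; exact: kost_dominated kmu.
  have [mu /andP[muN cmu] mumax] := @arg_maxnP _ mu0 Q (fun mu => dom_rank (shape N mu)) Q0.
  have Fmu : F (shape N mu) != 0.
    rewrite cE (bigD1 mu) //= big1 ?addr0 => [|ka /andP[kaN ne]].
      by rewrite mulf_neq0 // kost_shape // kappa_neq0.
    have [->|cka] := eqVneq (c ka) 0; first by rewrite mul0r.
    have [->|kka] := eqVneq (kost R ka (shape N mu)) 0; first by rewrite mulr0.
    have D1 := kost_dominated kaN kka.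
    have := mumax ka; rewrite /Q kaN cka => /(_ isT) /(dominated_rank_eq D1) /(shape_inj muN kaN) e.
    by rewrite e eqxx in ne.
  have le1 := dominated_rank D0; have le2 := mumax _ Q0.
  have /(shape_inj muN laN) <- // := dominated_rank_eq (Fdom _ Fmu) (leq_trans le1 le2).
move=> g gU; have [v [x [vU x1 ->]]] := unitary_diag gU.
have -> : uchar W (invmx v *m diag_mx x *m v) = uchar W (diag_mx x).
  by apply: uchar_conj vU (diag_unitary x1).
rewrite (FE x x1) (eq_bigr _ (fun nu _ => congr1 (fun z => z * _) (cE nu))).
under eq_bigr => nu _ do rewrite mulr_suml.
rewrite exchange_big /=; apply: eq_bigr => mu _.
have -> : \tr (tens d (invmx v *m diag_mx x *m v) *m E mu) = \tr (tens d (diag_mx x) *m E mu).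
  rewrite /tens_sym symmetrizerE; apply: trace_tens_conj_sum; exact: unitarymx_unit.
by rewrite trace_diag_kost mulr_sumr; apply: eq_bigr => nu _; rewrite mulrA.
Qed.

(** The graph of the algebra map from the commutant to [End W]. It is a relation because it is not
    known in advance that a linear relation between the [tens d g] also holds between the
    [uact W g]; this is [tens_pair_fun0]. *)
Inductive tens_pair : T -> 'M[C]_D -> Prop :=
| tens_pair_unit g : g \is unitarymx -> tens_pair (tens d g) (uact W g)
| tens_pair_lin a X Y X' Y' : tens_pair X Y -> tens_pair X' Y' ->
    tens_pair (a *: X + X') (a *: Y + Y').

Lemma tens_pair1 : tens_pair 1%:M 1%:M.
Proof.
by rewrite -(tens1 C N d) -(uact1 W); apply: tens_pair_unit; exact: unitarymx1.
Qed.

Lemma tens_pair0 : tens_pair 0 0.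
Proof. by have := tens_pair_lin (-1) tens_pair1 tens_pair1; rewrite !scaleN1r !addNr. Qed.

Lemma tens_pairB X Y X' Y' : tens_pair X Y -> tens_pair X' Y' -> tens_pair (X - X') (Y - Y').
Proof.
by move=> XY XY'; have := tens_pair_lin (-1) XY' XY; rewrite !scaleN1r ![- _ + _]addrC.
Qed.

Lemma tens_pairZ a X Y : tens_pair X Y -> tens_pair (a *: X) (a *: Y).
Proof. by move=> XY; have := tens_pair_lin a XY tens_pair0; rewrite !addr0. Qed.

Lemma tens_pairM X Y X' Y' : tens_pair X Y -> tens_pair X' Y' -> tens_pair (X *m X') (Y *m Y').
Proof.
move=> XY XY'; elim: XY => [g gU|a X1 Y1 X2 Y2 _ IH1 _ IH2]; last first.
  by rewrite !mulmxDl -!scalemxAl; exact: tens_pair_lin.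
elim: XY' => [h hU|a X1 Y1 X2 Y2 _ IH1 _ IH2].
  by rewrite -tensM -(uactM W gU hU); apply/tens_pair_unit/mul_unitarymx.
by rewrite !mulmxDr -!scalemxAr; exact: tens_pair_lin.
Qed.

Lemma tens_pair_equivariant X Y : tens_pair X Y -> equivariant X.
Proof.
elim=> [g gU|a X1 Y1 X2 Y2 _ IH1 _ IH2]; first exact: equivariant_tens.
by move=> s; rewrite mulmxDl mulmxDr -scalemxAl -scalemxAr IH1 IH2.
Qed.

Lemma tens_pair_left X : equivariant X -> exists Y, tens_pair X Y.
Proof.
move=> /equivariant_unitary_span[n [a [g [gU ->]]]].
exists (\sum_k a k *: uact W (g k)).
elim/big_rec2: _ => [|k X1 Y1 _ IH]; first exact: tens_pair0.
by apply: tens_pair_lin IH; exact: tens_pair_unit.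
Qed.

Lemma tens_pair_right Y : exists X, tens_pair X Y.
Proof.
apply: (burnside_full (B := fun Y => exists X, tens_pair X Y)).
- exact: hW.1.1.
- by exists 1%:M; exact: tens_pair1.
- by move=> Y1 Y2 [X1 H1] [X2 H2]; exists (X1 *m X2); exact: tens_pairM.
- by move=> a Y1 Y2 [X1 H1] [X2 H2]; exists (a *: X1 + X2); exact: tens_pair_lin.
- move=> S SS; apply: hW.1.2 => g v gU vS; apply: SS => //.
  by exists (tens d g); exact: tens_pair_unit.
Qed.

Lemma trace_nondegenerate n (Y : 'M[C]_n) : (forall Z, \tr (Y *m Z) = 0) -> Y = 0.
Proof.
move=> H; apply/matrixP => i j; rewrite [RHS]mxE -(H (delta_mx j i)) /mxtrace.
rewrite (bigD1 i) //= big1 ?addr0 => [|k ki].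
  rewrite mxE (bigD1 j) //= mxE !eqxx mulr1 big1 ?addr0 // => k kj.
  by rewrite mxE (negPf kj) mulr0.
by rewrite mxE big1 // => l _; rewrite mxE (negPf ki) andbF mulr0.
Qed.

Section Trace.
Variable tau : T -> C.
Hypothesis tauL : forall a X Y, tau (a *: X + Y) = a * tau X + tau Y.
Hypothesis tauU : forall g, g \is unitarymx -> uchar W g = tau (tens d g).

Lemma tens_pair_trace X Y : tens_pair X Y -> \tr Y = tau X.
Proof.
elim=> [g gU|a X1 Y1 X2 Y2 _ IH1 _ IH2]; first exact: tauU.
by rewrite tauL linearP /= IH1 IH2.
Qed.

(** Every [Z] in [End W] has a partner [X'], so [tau] computes the trace form of [End W], which is
    nondegenerate. *)
Lemma tens_pair_eq0 X Y : tens_pair X Y ->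
  (forall X', equivariant X' -> tau (X *m X') = 0) -> Y = 0.
Proof.
move=> XY H; apply: trace_nondegenerate => Z; have [X' X'Z] := tens_pair_right Z.
by rewrite (tens_pair_trace (tens_pairM XY X'Z)) H //; exact: tens_pair_equivariant X'Z.
Qed.

Lemma tens_pair_fun0 Y : tens_pair 0 Y -> Y = 0.
Proof.
move=> H; apply: (tens_pair_eq0 H) => X' _; rewrite mul0mx.
by have := tauL (-1) 0 0; rewrite scaler0 addr0 mulN1r addNr.
Qed.

End Trace.

Lemma equivariant_class_sum al :
  equivariant (\sum_(s in conj_class al) place_perm C N s : T).
Proof.
move=> s; pose z x : C := (x \in conj_class al)%:R.
have -> : \sum_(s in conj_class al) place_perm C N s = \sum_x z x *: place_repr C N d x.
  rewrite big_mkcond; apply: eq_bigr => x _; rewrite /z.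
  by case: ifP => _; rewrite ?scale1r ?scale0r.
symmetry; apply: (class_function_sum_comm (place_repr C N d)) => x y.
by rewrite /z -mulgA -conjgE conj_classJ.
Qed.

(** Any [mu] with [c mu != 0] has the same class scalars as [la]. By [sum_power_sum_hatK1] these
    determine the traces, hence the numbers [kost], and diagrams with the same [kost] dominate each
    other. *)
Lemma uchar_multiple : exists c : C, forall g, g \is unitarymx ->
  uchar W g = c * \tr (tens d g *m E la).
Proof.
have [c [cla cE]] := uchar_expansion; exists (c la) => g gU; rewrite (cE g gU).
pose tau (X : T) := \sum_(mu : young d | (nrows mu <= N)%N) c mu * \tr (X *m E mu).
have tauL a X Y : tau (a *: X + Y) = a * tau X + tau Y.
  rewrite /tau mulr_sumr -big_split; apply: eq_bigr => mu _ /=.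
  by rewrite mulmxDl linearD /= -scalemxAl linearZ /= mulrDr mulrCA.
rewrite (bigD1 la) //= big1 ?addr0 // => mu /andP[muN ne].
have [->|cmu] := eqVneq (c mu) 0; first by rewrite mul0r.
case/eqP: ne.
have hatKE al : hatK1 C al mu = hatK1 C al la.
  set Z : T := \sum_(s in conj_class al) place_perm C N s.
  have eZ : equivariant Z := @equivariant_class_sum al.
  have [Y ZY] := tens_pair_left eZ.
  have ZX X : equivariant X -> Z *m X = X *m Z.
    by move=> eX; rewrite mulmx_sumr mulmx_suml; apply: eq_bigr => s _; rewrite eX.
  have [s Ys] : exists s, Y = s%:M.
    apply: scalar_mx_commutant => V; have [X XV] := tens_pair_right V.
    apply/eqP; rewrite -subr_eq0; apply/eqP; apply: (tens_pair_fun0 tauL cE).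
    have := tens_pairB (tens_pairM ZY XV) (tens_pairM XV ZY).
    by rewrite (ZX X (tens_pair_equivariant XV)) subrr.
  (* The trace of the partner of [Z *m X] is computed twice: [Z] acts by [s] on [W] and by
     [hatK1 C al ka] on [E ka]. Taking weight projections for [X] then brings in
     [kost_independence]. *)
  have key X : equivariant X ->
      \sum_(ka : young d | (nrows ka <= N)%N) (c ka * (hatK1 C al ka - s)) * \tr (X *m E ka) = 0.
    move=> eX; have [V XV] := tens_pair_left eX.
    have := tens_pair_trace tauL cE (tens_pairM ZY XV).
    rewrite Ys mul_scalar_mx linearZ /= (tens_pair_trace tauL cE XV) /tau mulr_sumr => e.
    have trZ ka : \tr (Z *m X *m E ka) = hatK1 C al ka * \tr (X *m E ka).
      rewrite (ZX X eX) -mulmxA (equivariant_tens_sym ka eZ).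
      have -> : E ka *m Z = hatK1 C al ka *: E ka.
        exact: (hatK1_symmetrizer ka al (place_repr C N d)).
      by rewrite -scalemxAr linearZ.
    apply/eqP; move/eqP: e; rewrite eq_sym -subr_eq0 -sumrB; congr (_ == 0).
    by apply: eq_bigr => ka _; rewrite trZ; ring.
  have H ka : (nrows ka <= N)%N -> c ka * (hatK1 C al ka - s) = 0.
    apply: (@kost_independence R N d (fun ka => c ka * (hatK1 C al ka - s))) => ka' _.
    exact: (key _ (@equivariant_wt R N d (shape N ka'))).
  have /eqP := H mu muN; rewrite mulf_eq0 (negPf cmu) subr_eq0 /= => /eqP ->.
  by have /eqP := H la laN; rewrite mulf_eq0 (negPf cla) subr_eq0 /= => /eqP ->.
have kostE (nu : {ffun 'I_N -> 'I_d.+1}) : kost R mu nu = kost R la nu.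
  apply/eqP; rewrite -subr_eq0; apply/eqP.
  apply: (@monomial_independence C _ _ (fun ka => kost R mu ka - kost R la ka)) => x x1.
  have y1 i : `|(\row_i x i) 0 i| = 1 by rewrite mxE.
  have yU := diag_unitary y1.
  have e : \tr (tens d (diag_mx (\row_i x i)) *m E mu) = \tr (tens d (diag_mx (\row_i x i)) *m E la).
    rewrite -(sum_power_sum_hatK1 mu yU) -(sum_power_sum_hatK1 la yU).
    by apply: eq_bigr => al _; rewrite hatKE.
  move/eqP: e; rewrite !trace_diag_kost -subr_eq0 -sumrB => /eqP e; rewrite -[RHS]e.
  apply: eq_bigr => ka _; rewrite -mulrBl; congr (_ * _).
  by apply: eq_bigr => i _; rewrite mxE.
have D1 : dominated (shape N mu) (shape N la).
  by apply: (kost_dominated (R := R) laN); rewrite -kostE kost_shape // kappa_neq0.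
have D2 : dominated (shape N la) (shape N mu).
  by apply: (kost_dominated (R := R) muN); rewrite kostE kost_shape // kappa_neq0.
exact: shape_inj muN laN (dominated_rank_eq D1 (dominated_rank D2)).
Qed.

Local Notation kappa := (@sym_kappa C d (box_row la) (box_col la)).

(* [w], the projection on the weight space of [la], satisfies [w X w e = q w e]
   for every [X] in the commutant; hence its image [p] in [End W] is an
   idempotent with [p Y p = q p] for all [Y], and so has trace one. *)
Lemma uchar_symmetrizer g : g \is unitarymx ->
  uchar W g = kappa^-1 * \tr (tens d g *m E la).
Proof.
move=> gU; have [c cE] := uchar_multiple; rewrite (cE g gU); congr (_ * _).
pose tau (X : T) := c * \tr (X *m E la).
have tauL a X Y : tau (a *: X + Y) = a * tau X + tau Y.
  by rewrite /tau mulmxDl linearD /= -scalemxAl linearZ /= mulrDr mulrCA.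
pose w : T := wt R (shape N la).
have ew : equivariant w := @equivariant_wt R N d _.
have [p wp] := tens_pair_left ew.
have [f0 f0la] := row_filling_exists laN.
(* It remains to prove that this trace is 1, which determines [c]. *)
have trp : \tr p = c * kappa.
  by rewrite (tens_pair_trace tauL cE wp) /tau (trace_wt_tens_sym R laN f0la).
have k0 := kappa_neq0 C la.
have c0 : c != 0.
  have : uchar W 1%:M != 0.
    by rewrite /uchar uact1 mxtrace1 pnatr_eq0 -lt0n; exact: hW.1.1.
  rewrite cE; last exact: unitarymx1.
  by apply: contraNneq => ->; rewrite mul0r.
have p0 : p != 0.
  have : \tr p != 0 by rewrite trp mulf_neq0.
  by apply: contraNneq => ->; rewrite mxtrace0.
have [al [be abE]] := wt_tens_sym_rank1 R laN f0la.
have EE : E la *m E la = kappa *: E la by exact: (symmetrizer_sqr (@box_inj d la) (@box_down d la)).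
have sand X : equivariant X -> forall X', equivariant X' ->
    \tr (w *m X *m w *m X' *m E la) = kappa^-1 * (be *m X *m al) 0 0 * \tr (w *m X' *m E la).
  move=> eX X' eX'.
  have eE Y : equivariant Y -> Y *m E la = E la *m Y by exact: equivariant_tens_sym.
  have -> : w *m X' *m E la = (w *m E la) *m X' by rewrite -mulmxA (eE _ eX') mulmxA.
  have wXwE : w *m X *m w *m X' *m E la =
      kappa^-1 *: ((w *m E la) *m X *m (w *m E la) *m X').
    by rewrite (commuting_sandwich EE (eE _ ew) (eE _ eX) (eE _ eX')) scalerA mulVf // scale1r.
  rewrite wXwE linearZ /= -mulrA; congr (_ * _).
  by rewrite abE rank1_sandwich -scalemxAl linearZ.
have pYp Y : exists q, p *m Y *m p = q *: p.
  have [X XY] := tens_pair_right Y; exists (kappa^-1 * (be *m X *m al) 0 0).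
  apply/eqP; rewrite -subr_eq0; apply/eqP.
  have pr := tens_pairB (tens_pairM (tens_pairM wp XY) wp)
    (tens_pairZ (kappa^-1 * (be *m X *m al) 0 0) wp).
  apply: (tens_pair_eq0 tauL cE pr) => X' eX'; rewrite /tau !mulmxBl linearB /= -!scalemxAl linearZ /=.
  by rewrite (sand _ (tens_pair_equivariant XY) _ eX') subrr mulr0.
have pp : p *m p = p.
  apply/eqP; rewrite -subr_eq0; apply/eqP.
  have := tens_pairB (tens_pairM wp wp) wp; rewrite wt_idem subrr.
  exact: (tens_pair_fun0 tauL cE).
have [a [b pab]] : exists a b, p a b != 0.
  apply: contrapT => none; case/eqP: p0; apply/matrixP => a b; rewrite mxE.
  by apply/eqP; apply: contrapT => /negP h; apply: none; exists a, b.
(* With [p a b != 0], testing on this elementary matrix gives [p i b * p a j = p a b * p i j];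
   summing over [i = j] and using [p *m p = p] yields trace one. *)
have [q qE] := pYp (delta_mx b a).
have ent i j : p i b * p a j = q * p i j.
  have := congr1 (fun V : 'M[C]_D => V i j) qE; rewrite [RHS]mxE => <-.
  rewrite -(mul_delta_mx (0 : 'I_1)) !mulmxA -mulmxA -colE -rowE mxE big_ord1.
  by rewrite !mxE.
have qab : q = p a b by have := ent a b; move/(mulIf pab).
have trp1 : \tr p = 1.
  apply: (mulfI pab); rewrite mulr1 -{1}qab mulr_sumr.
  rewrite -[in RHS]pp mxE; apply: eq_bigr => i _; by rewrite -ent mulrC.
apply: (mulIf k0); by rewrite mulVf // -trp.
Qed.

Theorem highest_weight_character g : g \is unitarymx ->
  uchar W g = (dimV C la)%:R / (d`!)%:R *
    \sum_(al : young d) power_sum al g * hatK1 C al la.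
Proof.
move=> gU; rewrite sum_power_sum_hatK1 // uchar_symmetrizer //; congr (_ * _).
rewrite -(kappa_dimV C la) invfM mulrCA divff ?mulr1 // pnatr_eq0 -lt0n; exact: dimV_gt0.
Qed.

Theorem highest_weight_dim : (0 < N)%N ->
  D%:R = (dimV C la)%:R / (d`!)%:R * content_prod la (fun c => N%:R + c%:~R) :> C.
Proof.
move=> N0; have := highest_weight_character (unitarymx1 C N).
by rewrite sum_power_sum_hatK1 ?unitarymx1 // tens1 mul1mx trace_tens_sym // /uchar uact1 mxtrace1.
Qed.

End HighestWeightCharacter.

(** * The microchiral partition function *)

Section ContentSums.
Variables (R : realType) (N d : nat) (la : young d).
Hypothesis laN : (nrows la <= N)%N.

(** Sums over ['I_N] and over ['I_d] are both reduced to the nonzero rows, since neither of [N] and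
    [d] bounds the other. *)
Lemma sum_rows_widen (n : nat) (G : nat -> int) : (nrows la <= n)%N ->
  (forall i, row_len la i = 0%N -> G i = 0) ->
  \sum_(i < n) G i = \sum_(i < nrows la) G i.
Proof.
move=> le G0; rewrite (big_ord_widen _ G le) [RHS]big_mkcond; apply: eq_bigr => i _.
by rewrite ltn_nrows; case: posnP => // /G0.
Qed.

(** With rows counted from 0, a row of length [r] contributes [r (r + N + 1 - 2 (i + 1)) = N r + r
    (r - 1 - 2 i)], and the last term is twice the sum of its contents. *)
Lemma casimirE : casimir N la =
  N%:Z * d%:Z + 2 * \sum_(k < d) ((box_col la k)%:Z - (box_row la k)%:Z).
Proof.
rewrite (big_boxes la _ (fun i j => j%:Z - i%:Z)) /casimir.
rewrite (sum_rows_widen (G := fun i => (row_len la i)%:Z *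
  ((row_len la i)%:Z + N%:Z + 1 - 2 * (i.+1)%:Z))) // => [|i ->]; last by rewrite mul0r.
rewrite (sum_rows_widen (G := fun i => \sum_(j < row_len la i) (j%:Z - i%:Z))) => [||i ->]; last 2 first.
- exact: nrows_le.
- by rewrite big_ord0.
have -> : d%:Z = \sum_(i < nrows la) (row_len la i)%:Z.
  have := congr1 Posz (sum_row_len laN); rewrite (big_morph Posz PoszD (erefl 0%:Z)) => e.
  transitivity (\sum_(i < N) (row_len la i)%:Z); first exact: esym e.
  by rewrite (sum_rows_widen (G := fun i => (row_len la i)%:Z)) // => i ->.
rewrite !mulr_sumr -big_split; apply: eq_bigr => i _ /=.
have -> : 2 * \sum_(j < row_len la i) (j%:Z - (i : nat)%:Z) =
    (row_len la i)%:Z * ((row_len la i)%:Z - 1 - 2 * (i : nat)%:Z).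
  elim: (row_len la i) => [|r IH]; first by rewrite big_ord0 mulr0 mul0r.
  by rewrite big_ord_recr mulrDr IH /= -[r.+1]addn1 PoszD; ring.
by rewrite -[i.+1]addn1 PoszD; ring.
Qed.

Lemma exp_casimir (t : R) : (0 < N)%N ->
  expR (- (t / (2 * N%:R)) * (casimir N la)%:~R) =
  expR (- (t / 2)) ^+ d * hatPsi (t / N%:R) la.
Proof.
move=> N0; have Nn : N%:R != 0 :> R by rewrite pnatr_eq0 -lt0n.
rewrite /hatPsi content_prodE -expRM_natl -expR_sum -expRD; congr expR.
rewrite casimirE rmorphD rmorphM /= rmorphM /= rmorph_sum /= -mulr_sumr -!pmulrn.
by move: (\sum_(k < d) _) => S; field; rewrite Nn.
Qed.

Lemma content_prod_hatOmega : (0 < N)%N ->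
  content_prod la (fun c => N%:R + c%:~R) = N%:R ^+ d * ((hatOmega (N%:R^-1) la)%:C)%C :> R[i].
Proof.
move=> N0.
have cE (x : int) : ((1 + N%:R^-1 * x%:~R)%:C)%C = 1 + N%:R^-1 * x%:~R :> R[i].
  by rewrite rmorphD rmorph1 rmorphM fmorphV rmorph_nat rmorph_int.
rewrite /hatOmega !content_prodE (rmorph_prod (real_complex R)).
rewrite -[in N%:R ^+ d](card_ord d) -prodr_const -big_split; apply: eq_bigr => k _ /=.
by rewrite cE mulrDr mulr1 mulrA divff ?mul1r // pnatr_eq0 -lt0n.
Qed.

End ContentSums.

Lemma sum_power_sums_hatK (R : realType) (N d m : nat) (la : young d)
    (U : 'I_m -> 'M[R[i]]_N) :
  \sum_(al : {ffun 'I_m -> young d}) power_sums al U * hatK R[i] al la =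
  \prod_(i < m) \sum_al power_sum al (U i) * hatK1 R[i] al la.
Proof.
rewrite bigA_distr_bigA /=; apply: eq_bigr => al _.
by rewrite /power_sums /hatK -big_split.
Qed.

Theorem theorem3p1 (R : realType) (N d m n : nat) (t : R)
    (hN : (1 <= N)%N) (hd : (1 <= d)%N) (ht : 0 < t)
    (W : young d -> unitary_rep R[i] N)
    (hW : forall la : young d, (nrows la <= N)%N -> is_Wrep (W la) la)
    (U : 'I_m -> 'M[R[i]]_N) (hU : forall i, U i \is unitarymx) :
  let z : R := expR (- (t / 2)) in
  microchiral n t W U =
    (z%:C%C * N%:R ^ (2 - 2 * n%:Z - m%:Z)) ^+ d *
    \sum_(al : {ffun 'I_m -> young d})
      power_sums al U *
      \sum_(la : young d | (nrows la <= N)%N)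
        ((dimV R[i] la)%:R / (d`!)%:R) ^ (2 - 2 * n%:Z) *
        hatK R[i] al la *
        (hatPsi (t / N%:R) la)%:C%C *
        ((hatOmega (N%:R^-1) la)%:C%C) ^ (2 - 2 * n%:Z - m%:Z).
Proof.
move=> z; rewrite /microchiral.
under [in RHS]eq_bigr => al _ do rewrite mulr_sumr.
rewrite exchange_big mulr_sumr /=; apply: eq_bigr => la laN.
rewrite (exp_casimir laN t hN) rmorphM rmorphXn /= -/z.
rewrite (highest_weight_dim laN (hW la laN) hN) (content_prod_hatOmega R la hN).
rewrite (eq_bigr _ (fun i _ => highest_weight_character laN (hW la laN) (hU i))).
rewrite big_split prodr_const card_ord /= -sum_power_sums_hatK.
(* The [m] characters contribute [a ^+ m] and the dimension contributes [a ^ k] with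
   [k = 2 - 2 n - m]; together they give [a ^ (2 - 2 n)]. As exponents may be negative, adding them
   requires [a != 0]. *)
set a : R[i] := _ / _; set Om := ((hatOmega _ _)%:C)%C; set Ps := ((hatPsi _ _)%:C)%C.
have a0 : a != 0 by rewrite mulf_neq0 ?invr_eq0 ?pnatr_eq0 -?lt0n ?dimV_gt0 ?fact_gt0.
set k := 2 - 2 * n%:Z - m%:Z.
have -> : \sum_al power_sums al U *
    (a ^ (2 - 2 * n%:Z) * hatK R[i] al la * Ps * Om ^ k) =
    (\sum_al power_sums al U * hatK R[i] al la) * (a ^ (2 - 2 * n%:Z) * Ps * Om ^ k).
  by rewrite mulr_suml; apply: eq_bigr => al _; rewrite !mulrA; congr (_ * _ * _); rewrite mulrAC.
move: (\sum_al _) => S.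
have -> : a ^+ m * S / (a * (N%:R ^+ d * Om)) ^ (m%:Z + 2 * n%:Z - 2) =
    a ^+ m * S * (a ^ k * (N%:R ^ k) ^+ d * Om ^ k).
  rewrite invr_expz (_ : - (m%:Z + 2 * n%:Z - 2) = k); last by rewrite /k; ring.
  by congr (_ * _); rewrite !expfzMl mulrA; congr (_ * _ * _); rewrite !exprnP exprzAC.
have -> : a ^ (2 - 2 * n%:Z) = a ^+ m * a ^ k.
  by rewrite exprnP -expfzDr // /k; congr (_ ^ _); ring.
rewrite [(_ * N%:R ^ k) ^+ d]exprMn.
move: (a ^+ m) (a ^ k) (Om ^ k) Ps (_ ^+ d) (_ ^+ d) => p q r s u v.
ring.
Qed.
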